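(* With notation as in the context, if $\overline{\mathbb M}=\mathbb G$, then the cut locus of $o$ is exactly $\mathbb M^c=\partial\mathbb M$, i.e. $\mathrm{Cut}_o=\mathbb G\setminus\mathbb M$.
   Context: Let $q,m\ge1$, $U^{(1)},\dots,U^{(m)}$ linearly independent real skew-symmetric $q\times q$ matrices; $\mathbb G=\mathbb R^q\times\mathbb R^m$ with law $(x,t)\cdot(x',t')=(x+x',t+t'+\frac12\langle\mathbb Ux,x'\rangle)$, $\langle\mathbb Ux,x'\rangle=(\langle U^{(j)}x,x'\rangle)_j$, identity $o$; $d(g)$ is the Carnot–Carathéodory distance from $o$ (infimum of $\int_0^1|x'|$ over absolutely continuous curves from $o$ to $g$ with $t'=\frac12\langle\mathbb Ux,x'\rangle$). $U(\tau)=i\sum_j\tau_jU^{(j)}$, $\Omega_*=\{\tau:\|U(\tau)\|<\pi\}$, $\phi((x,t);\tau)=\langle U(\tau)\cot U(\tau)x,x\rangle+4t\cdot\tau$. $\mathbb M$ is the set of $g$ such that $\phi(g;\cdot)$ has a nondegenerate critical point in $\Omega_*$ (an open set). $\mathrm{Cut}_o$ is the complement of $\{g:\ d^2$ is $C^\infty$ in a neighborhood of $g\}$. *)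

(* Defs.v *)
From HB Require Import structures.
From mathcomp Require Import all_boot all_order all_algebra.
From mathcomp Require Import all_classical all_reals all_analysis.
Set Implicit Arguments. Unset Strict Implicit. Unset Printing Implicit Defensive.
Import Order.TTheory GRing.Theory Num.Theory.
Import numFieldNormedType.Exports.
Local Open Scope classical_set_scope.
Local Open Scope ring_scope.

Section Carnot.
Variable R : realType.

Definition dotv n (a b : 'rV[R]_n) : R := \sum_(i < n) a 0 i * b 0 i.
Definition enorm n (a : 'rV[R]_n) : R := Num.sqrt (dotv a a).
Definition mxapp n (A : 'M[R]_n) (x : 'rV[R]_n) : 'rV[R]_n := x *m A^T.
Definition opnorm n (A : 'M[R]_n) : R :=
  sup [set enorm (mxapp A v) | v in [set v : 'rV[R]_n | enorm v <= 1]].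

Definition skew_sym n (A : 'M[R]_n) : Prop := A^T = - A.
Definition lin_indep q m (U : 'I_m -> 'M[R]_q) : Prop :=
  forall c : 'I_m -> R, \sum_(j < m) c j *: U j = 0 -> forall j, c j = 0.

Definition Uform q m (U : 'I_m -> 'M[R]_q) (x y : 'rV[R]_q) : 'rV[R]_m :=
  \row_j dotv (mxapp (U j) x) y.

Definition abs_cont (f : R -> R) (a b : R) : Prop :=
  forall e : R, 0 < e -> exists2 d : R, 0 < d &
    forall (n : nat) (I : 'I_n -> R * R),
      (forall k, a <= (I k).1 /\ (I k).1 <= (I k).2 /\ (I k).2 <= b) ->
      (forall k l, k != l -> (I k).2 <= (I l).1 \/ (I l).2 <= (I k).1) ->
      \sum_(k < n) ((I k).2 - (I k).1) < d ->
      \sum_(k < n) `|f (I k).2 - f (I k).1| < e.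

Definition unit_int : set R := [set s | 0 <= s <= 1].

Definition horizontal_curve q m (U : 'I_m -> 'M[R]_q)
    (g : 'rV[R]_q * 'rV[R]_m) (x : R -> 'rV[R]_q) (t : R -> 'rV[R]_m) : Prop :=
  [/\ x 0 = 0, t 0 = 0, x 1 = g.1 & t 1 = g.2] /\
  [/\ (forall i, abs_cont (fun s => x s 0 i) 0 1),
      (forall i, abs_cont (fun s => t s 0 i) 0 1) &
      (\forall s \ae (@lebesgue_measure R), unit_int s ->
         [/\ derivable x s 1, derivable t s 1 &
             derive1 t s = 2^-1 *: Uform U (x s) (derive1 x s)])].

Definition curve_length q (x : R -> 'rV[R]_q) : \bar R :=
  (\int[@lebesgue_measure R]_(s in unit_int) (enorm (derive1 x s))%:E)%E.

Definition ccdist q m (U : 'I_m -> 'M[R]_q) (g : 'rV[R]_q * 'rV[R]_m) : R :=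
  fine (ereal_inf [set L | exists x t, horizontal_curve U g x t /\ L = curve_length x]).

(** A(tau) = sum_j tau_j U^(j), so that U(tau) = i A(tau) *)
Definition Amat q m (U : 'I_m -> 'M[R]_q) (tau : 'rV[R]_m) : 'M[R]_q :=
  \sum_(j < m) tau 0 j *: U j.

(** Omega_* : ||U(tau)|| = ||A(tau)|| < pi *)
Definition Omega_star q m (U : 'I_m -> 'M[R]_q) : set 'rV[R]_m :=
  [set tau | opnorm (Amat U tau) < pi].

Definition zcot (z : R) : R := if z == 0 then 1 else z * cos z / sin z.
Definition zcot_coef (n : nat) : R := derive1n n zcot 0 / n`!%:R.

(** U cot U = sum_n c_n U^n, with U = i A; odd coefficients vanish and
    U^(2n) = (-1)^n A^(2n). *)
Definition UcotU q m (U : 'I_m -> 'M[R]_q) (tau : 'rV[R]_m) : 'M[R]_q :=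
  limn (series (fun n : nat =>
     (zcot_coef n.*2 * (-1) ^+ n) *: (Amat U tau) ^+ n.*2)).

Definition phi q m (U : 'I_m -> 'M[R]_q) (g : 'rV[R]_q * 'rV[R]_m) (tau : 'rV[R]_m) : R :=
  dotv (mxapp (UcotU U tau) g.1) g.1 + 4 * dotv g.2 tau.

Definition ebasis m (j : 'I_m) : 'rV[R]_m := delta_mx 0 j.

Definition nondeg_crit m (f : 'rV[R]_m -> R) (tau : 'rV[R]_m) : Prop :=
  [/\ differentiable f tau,
      (forall j, 'D_(ebasis j) f tau = 0) &
      \det (\matrix_(j < m, k < m) 'D_(ebasis j) ('D_(ebasis k) f) tau) != 0].

Definition Mset q m (U : 'I_m -> 'M[R]_q) : set ('rV[R]_q * 'rV[R]_m) :=
  [set g | exists2 tau, Omega_star U tau & nondeg_crit (phi U g) tau].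

Fixpoint iterD (V : normedModType R) (vs : seq V) (f : V -> R) : V -> R :=
  if vs is v :: vs' then 'D_v (iterD vs' f) else f.

Definition smooth_on (V : normedModType R) (A : set V) (f : V -> R) : Prop :=
  forall (vs : seq V) (x : V), A x -> differentiable (iterD vs f) x.

Definition cut_locus q m (U : 'I_m -> 'M[R]_q) : set ('rV[R]_q * 'rV[R]_m) :=
  [set g | ~ exists A : set ('rV[R]_q * 'rV[R]_m),
     [/\ open A, A g & smooth_on A (fun h => ccdist U h ^+ 2)]].

End Carnot.

(* Main.v *)
Require Import Defs.
From HB Require Import structures.
From mathcomp Require Import all_boot all_order all_algebra.
From mathcomp Require Import all_classical all_reals all_analysis.
From mathcomp Require Import measurable_realfun ring lra zify.
Import Order.TTheory GRing.Theory Num.Theory.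
Import numFieldNormedType.Exports.
(* again, because ssrnat also has a constant [iterD] *)
Import Defs.
Local Open Scope classical_set_scope.
Local Open Scope ring_scope.
Set Implicit Arguments. Unset Strict Implicit. Unset Printing Implicit Defensive.

(** Write C(tau) = U(tau) cot U(tau) and A(tau) = sum_j tau_j U^(j). Since the Taylor
    coefficients of z cot z satisfy the recurrence of its Riccati equation, K(r) = C(r tau) / r
    satisfies K' = A^2 - K^2. Hence phi(.; r tau) / r solves a Hamilton-Jacobi equation and
    calibrates horizontal curves: phi(g; tau) <= length^2 for every curve from o to g and every
    tau in Omega_*. If theta is a critical point of phi(g; .), the solution of
    x' = (K + A) x, that is x'' = 2 A x', ends at g and has length^2 = phi(g; theta), so that
    d(g)^2 = phi(g; theta) = |(C + A)(theta) x|^2. On M the implicit function theorem makes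
    theta, hence d^2, smooth.

    Conversely let d^2 be smooth near g0. Put theta = (1/4) grad_t d^2 and
    p = (1/2) grad_x d^2 + A(theta) x. As M is dense, ||U(theta)|| <= pi and the eikonal equation
    d^2 = |p|^2 hold near g0. Differentiating the eikonal equation in t shows that theta
    is homogeneous of degree one along the horizontal direction p; if ||U(theta(g0))|| were pi,
    the bound would fail at nearby points. So theta(g0) is in Omega_*, where
    grad_tau phi(g; theta(g)) = 0 by density, and differentiating this equation in t gives
    Hess_tau phi * D_t theta = -4: the critical point is nondegenerate and g0 is in M. *)

(** * Euclidean norm and operator norm *)

(** The matrices [A(tau)] are never diagonalised. Everything about [C] is drawn from its power
    series through the operator norm. The Riccati equation of z cot z serves three times: it
    determines the coefficients, it gives their sign and thereby convergence up to pi by real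
    methods, and it yields the equation for [K].

    The distance ranges over absolutely continuous curves whose speed exists only almost everywhere.
    The calibration therefore runs along arc length and rests on a monotonicity lemma for absolutely
    continuous functions. As [K] has a pole at [r = 0], the parameter [r] starts at a small positive
    value.

    That a critical point of the phase is a maximum is not obtained from concavity: it follows by
    comparison with the geodesic that the critical point generates.

    In the converse, [C] is singular on the boundary of its domain, so the phase cannot be followed
    to a point where the norm of [U(theta)] is pi. What passes to the closure of M is what can be
    said with derivatives of the squared distance alone: the nonstrict bound and the eikonal
    equation. The boundary has to be excluded from these two. *)

Section LinearAlgebra.
Variable R : realType.
Implicit Types n : nat.

Lemma dotvC n (a b : 'rV[R]_n) : dotv a b = dotv b a.
Proof. by apply: eq_bigr => i _; rewrite mulrC. Qed.

Lemma dotvDl n (a b c : 'rV[R]_n) : dotv (a + b) c = dotv a c + dotv b c.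
Proof. by rewrite -big_split; apply: eq_bigr => i _; rewrite mxE mulrDl. Qed.

Lemma dotvZl n k (a c : 'rV[R]_n) : dotv (k *: a) c = k * dotv a c.
Proof. by rewrite mulr_sumr; apply: eq_bigr => i _; rewrite mxE mulrA. Qed.

Lemma dotvDr n (a b c : 'rV[R]_n) : dotv c (a + b) = dotv c a + dotv c b.
Proof. by rewrite dotvC dotvDl !(dotvC c). Qed.

Lemma dotvZr n k (a c : 'rV[R]_n) : dotv c (k *: a) = k * dotv c a.
Proof. by rewrite dotvC dotvZl dotvC. Qed.

Lemma dotvNl n (a c : 'rV[R]_n) : dotv (- a) c = - dotv a c.
Proof. by rewrite -scaleN1r dotvZl mulN1r. Qed.

Lemma dotvNr n (a c : 'rV[R]_n) : dotv c (- a) = - dotv c a.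
Proof. by rewrite dotvC dotvNl dotvC. Qed.

Lemma dot0v n (c : 'rV[R]_n) : dotv 0 c = 0.
Proof. by rewrite -(scale0r 0) dotvZl mul0r. Qed.

Lemma dotv0 n (c : 'rV[R]_n) : dotv c 0 = 0.
Proof. by rewrite dotvC dot0v. Qed.

Lemma dotv_ge0 n (a : 'rV[R]_n) : 0 <= dotv a a.
Proof. by apply: sumr_ge0 => i _; rewrite -expr2 sqr_ge0. Qed.

Lemma dotv_eq0 n (a : 'rV[R]_n) : dotv a a = 0 -> a = 0.
Proof.
move=> /eqP; rewrite psumr_eq0 => [/allP a0|i _]; last by rewrite -expr2 sqr_ge0.
apply/rowP => i; rewrite mxE; have := a0 i; rewrite mem_index_enum => /(_ isT).
by rewrite mulf_eq0 orbb => /eqP.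
Qed.

Lemma dotv_mxapp n (A : 'M[R]_n) (x y : 'rV[R]_n) :
  dotv (mxapp A x) y = dotv x (mxapp A^T y).
Proof.
rewrite /dotv /mxapp trmxK.
under eq_bigr do rewrite !mxE mulr_suml.
rewrite exchange_big /=; apply: eq_bigr => i _.
rewrite !mxE mulr_sumr; apply: eq_bigr => j _.
by rewrite mxE mulrAC mulrA.
Qed.

Lemma mxappD n (A : 'M[R]_n) x y : mxapp A (x + y) = mxapp A x + mxapp A y.
Proof. exact: mulmxDl. Qed.

Lemma mxappZ n (A : 'M[R]_n) k x : mxapp A (k *: x) = k *: mxapp A x.
Proof. by rewrite /mxapp scalemxAl. Qed.

Lemma mxappN n (A : 'M[R]_n) x : mxapp A (- x) = - mxapp A x.
Proof. exact: mulNmx. Qed.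

Lemma mxapp0 n (A : 'M[R]_n) : mxapp A 0 = 0.
Proof. exact: mul0mx. Qed.

Lemma mxappDm n (A B : 'M[R]_n) x : mxapp (A + B) x = mxapp A x + mxapp B x.
Proof. by rewrite /mxapp linearD /= mulmxDr. Qed.

Lemma mxappZm n (A : 'M[R]_n) k x : mxapp (k *: A) x = k *: mxapp A x.
Proof. by rewrite /mxapp linearZ /= scalemxAr. Qed.

Lemma mxappNm n (A : 'M[R]_n) x : mxapp (- A) x = - mxapp A x.
Proof. by rewrite -scaleN1r mxappZm scaleN1r. Qed.

Lemma mxapp_mul n (A B : 'M[R]_n) x : mxapp (A *m B) x = mxapp A (mxapp B x).
Proof. by rewrite /mxapp trmx_mul mulmxA. Qed.

Lemma mxappE n (A : 'M[R]_n) x i : mxapp A x 0 i = \sum_j A i j * x 0 j.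
Proof. by rewrite mxE; apply: eq_bigr => j _; rewrite mxE mulrC. Qed.

Lemma quadE n (A : 'M[R]_n) (x : 'rV[R]_n) :
  dotv (mxapp A x) x = \sum_i \sum_j x 0 i * x 0 j * A i j.
Proof.
apply: eq_bigr => i _; rewrite mxappE mulr_suml; apply: eq_bigr => j _.
by ring.
Qed.

Lemma skew_dotv0 n (A : 'M[R]_n) (x : 'rV[R]_n) :
  skew_sym A -> dotv (mxapp A x) x = 0.
Proof.
move=> sA; have : dotv (mxapp A x) x = - dotv (mxapp A x) x.
  by rewrite {1}dotv_mxapp sA mxappNm dotvNr dotvC.
by lra.
Qed.

Lemma enorm_ge0 n (a : 'rV[R]_n) : 0 <= enorm a.
Proof. exact: sqrtr_ge0. Qed.

Lemma enormE n (a : 'rV[R]_n) : enorm a ^+ 2 = dotv a a.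
Proof. by rewrite sqr_sqrtr // dotv_ge0. Qed.

Lemma enorm0 n : enorm (0 : 'rV[R]_n) = 0.
Proof. by rewrite /enorm dot0v sqrtr0. Qed.

Lemma enorm_eq0 n (a : 'rV[R]_n) : enorm a = 0 -> a = 0.
Proof. by move=> a0; apply: dotv_eq0; rewrite -enormE a0 expr0n. Qed.

Lemma enormZ n k (a : 'rV[R]_n) : enorm (k *: a) = `|k| * enorm a.
Proof.
by rewrite /enorm dotvZl dotvZr mulrA sqrtrM -expr2 ?sqr_ge0 // sqrtr_sqr.
Qed.

Lemma dotv_le n (a b : 'rV[R]_n) : dotv a b <= enorm a * enorm b.
Proof.
have [/enorm_eq0 ->|a0] := eqVneq (enorm a) 0; first by rewrite dot0v enorm0 mul0r.
have [/enorm_eq0 ->|b0] := eqVneq (enorm b) 0; first by rewrite dotv0 enorm0 mulr0.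
have ap : 0 < enorm a by rewrite lt0r a0 enorm_ge0.
have bp : 0 < enorm b by rewrite lt0r b0 enorm_ge0.
have := dotv_ge0 (enorm b *: a - enorm a *: b).
rewrite !(dotvDl, dotvDr, dotvNl, dotvNr, dotvZl, dotvZr) -!enormE (dotvC b a) => h.
have : 0 <= (enorm a * enorm b) * (enorm a * enorm b - dotv a b) by lra.
by rewrite pmulr_rge0 ?mulr_gt0 // subr_ge0.
Qed.

Lemma enormD n (a b : 'rV[R]_n) : enorm (a + b) <= enorm a + enorm b.
Proof.
rewrite -(@ler_pXn2r _ 2) ?nnegrE ?addr_ge0 ?enorm_ge0 // sqrrD !enormE.
rewrite !(dotvDl, dotvDr) (dotvC b a).
by have := dotv_le a b; lra.
Qed.

Lemma enorm_coord n (a : 'rV[R]_n) i : `|a 0 i| <= enorm a.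
Proof.
rewrite -(@ler_pXn2r _ 2) ?nnegrE ?enorm_ge0 // enormE real_normK ?num_real //.
rewrite /dotv (bigD1 i) //= expr2 lerDl; apply: sumr_ge0 => j _.
by rewrite -expr2 sqr_ge0.
Qed.

Lemma enorm_le_sum n (a : 'rV[R]_n) : enorm a <= \sum_i `|a 0 i|.
Proof.
rewrite -(@ler_pXn2r _ 2) ?nnegrE ?enorm_ge0 ?sumr_ge0 // enormE expr2.
rewrite mulr_suml; apply: ler_sum => i _.
apply: (le_trans (ler_norm _)); rewrite normrM ler_wpM2l //.
by rewrite (bigD1 i) //= lerDl sumr_ge0.
Qed.

Lemma coord_le_norm m n (A : 'M[R]_(m, n)) i j : `|A i j| <= `|A|.
Proof.
by rewrite [leRHS]/Num.norm /= mx_normrE; apply/bigmax_geP; right; exists (i, j).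
Qed.

Lemma mx_norm_le m n (A : 'M[R]_(m, n)) (e : R) :
  0 <= e -> (forall i j, `|A i j| <= e) -> `|A| <= e.
Proof.
by move=> e0 Ae; rewrite [leLHS]/Num.norm /= mx_normrE; apply/bigmax_leP; split=> // -[].
Qed.

Lemma mx_norm_lt m n (A : 'M[R]_(m, n)) (e : R) :
  0 < e -> (forall i j, `|A i j| < e) -> `|A| < e.
Proof.
by move=> e0 Ae; rewrite [ltLHS]/Num.norm /= mx_normrE; apply/bigmax_ltP; split=> // -[].
Qed.

Lemma enorm_le_norm n (a : 'rV[R]_n) : enorm a <= n%:R * `|a|.
Proof.
apply: le_trans (enorm_le_sum a) _.
apply: (@le_trans _ _ (\sum_(i < n) `|a|)); last first.
  by rewrite sumr_const card_ord mulr_natl.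
by apply: ler_sum => i _; exact: coord_le_norm.
Qed.

(** Entrywise sum norm. It bounds the operator norm from above, which makes the supremum in [opnorm]
    a genuine one, and unlike [opnorm] it can be estimated entry by entry. *)
Definition mxl1 m n (A : 'M[R]_(m, n)) : R := \sum_i \sum_j `|A i j|.

Lemma mxl1_ge0 m n (A : 'M[R]_(m, n)) : 0 <= mxl1 A.
Proof. by apply: sumr_ge0 => i _; apply: sumr_ge0. Qed.

Lemma mxl1D m n (A B : 'M[R]_(m, n)) : mxl1 (A + B) <= mxl1 A + mxl1 B.
Proof.
rewrite -big_split; apply: ler_sum => i _; rewrite -big_split; apply: ler_sum => j _.
by rewrite mxE ler_normD.
Qed.

Lemma mxl1Z m n k (A : 'M[R]_(m, n)) : mxl1 (k *: A) = `|k| * mxl1 A.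
Proof.
rewrite mulr_sumr; apply: eq_bigr => i _; rewrite mulr_sumr; apply: eq_bigr => j _.
by rewrite mxE normrM.
Qed.

Lemma mxl1_0 m n : mxl1 (0 : 'M[R]_(m, n)) = 0.
Proof. by rewrite -(scale0r 0) mxl1Z normr0 mul0r. Qed.

Lemma mxl1_sum m n (I : Type) (r : seq I) (P : pred I) (F : I -> 'M[R]_(m, n)) :
  mxl1 (\sum_(i <- r | P i) F i) <= \sum_(i <- r | P i) mxl1 (F i).
Proof.
elim/big_ind2 : _ => //; first by rewrite mxl1_0.
by move=> A a B b Aa Bb; apply: le_trans (mxl1D _ _) (lerD Aa Bb).
Qed.

Lemma coord_le_mxl1 m n (A : 'M[R]_(m, n)) i j : `|A i j| <= mxl1 A.
Proof.
rewrite /mxl1 (bigD1 i) //= (bigD1 j) //= -addrA lerDl addr_ge0 //.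
  by apply: sumr_ge0.
by apply: sumr_ge0 => k _; apply: sumr_ge0.
Qed.

Lemma mxl1_le m n (A : 'M[R]_(m, n)) e :
  (forall i j, `|A i j| <= e) -> mxl1 A <= (m * n)%:R * e.
Proof.
move=> Ae; apply: (@le_trans _ _ (\sum_(i < m) \sum_(j < n) e)).
  by apply: ler_sum => i _; apply: ler_sum.
by rewrite !sumr_const !card_ord -mulrnA mulr_natl mulnC.
Qed.

Lemma enorm_mxapp_l1 n (A : 'M[R]_n) x : enorm (mxapp A x) <= mxl1 A * enorm x.
Proof.
apply: le_trans (enorm_le_sum _) _; rewrite mulr_suml; apply: ler_sum => i _.
rewrite mxappE; apply: le_trans (ler_norm_sum _ _ _) _; rewrite mulr_suml.
by apply: ler_sum => j _; rewrite normrM ler_wpM2l // enorm_coord.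
Qed.

Let opset n (A : 'M[R]_n) := [set enorm (mxapp A v) | v in [set v : 'rV[R]_n | enorm v <= 1]].

Let opset_has_sup n (A : 'M[R]_n) : has_sup (opset A).
Proof.
split; first by exists (enorm (mxapp A 0)), 0 => //=; rewrite enorm0.
exists (mxl1 A) => _ [v v1 <-]; apply: le_trans (enorm_mxapp_l1 _ _) _.
by rewrite ler_piMr // mxl1_ge0.
Qed.

Lemma opnorm_ge0 n (A : 'M[R]_n) : 0 <= opnorm A.
Proof.
apply: (@le_trans _ _ (enorm (mxapp A 0))); first exact: enorm_ge0.
by apply: (sup_upper_bound (opset_has_sup A)); exists 0 => //=; rewrite enorm0.
Qed.

Lemma enorm_mxapp n (A : 'M[R]_n) x : enorm (mxapp A x) <= opnorm A * enorm x.
Proof.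
have [/enorm_eq0 ->|x0] := eqVneq (enorm x) 0; first by rewrite mxapp0 enorm0 mulr0.
have xp : 0 < enorm x by rewrite lt0r x0 enorm_ge0.
rewrite -ler_pdivrMr // mulrC -[X in X * _]ger0_norm ?invr_ge0 ?enorm_ge0 //.
rewrite -enormZ -mxappZ; apply: (sup_upper_bound (opset_has_sup A)).
exists ((enorm x)^-1 *: x) => //=.
by rewrite enormZ ger0_norm ?invr_ge0 ?enorm_ge0 // mulVf.
Qed.

Lemma opnorm_le n (A : 'M[R]_n) e : 0 <= e ->
  (forall x, enorm (mxapp A x) <= e * enorm x) -> opnorm A <= e.
Proof.
move=> e0 Ae; apply: sup_le_ub; first by case: (opset_has_sup A).
by move=> _ [v v1 <-]; apply: le_trans (Ae v) _; rewrite ler_piMr.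
Qed.

Lemma opnormD n (A B : 'M[R]_n) : opnorm (A + B) <= opnorm A + opnorm B.
Proof.
apply: opnorm_le => [|x]; first by rewrite addr_ge0 ?opnorm_ge0.
by rewrite mxappDm mulrDl; apply: le_trans (enormD _ _) _; rewrite lerD ?enorm_mxapp.
Qed.

Lemma opnorm_le_l1 n (A : 'M[R]_n) : opnorm A <= mxl1 A.
Proof. by apply: opnorm_le; [exact: mxl1_ge0 | exact: enorm_mxapp_l1]. Qed.

Lemma opnormZ_le n k (A : 'M[R]_n) : opnorm (k *: A) <= `|k| * opnorm A.
Proof.
apply: opnorm_le => [|x]; first by rewrite mulr_ge0 ?opnorm_ge0.
by rewrite mxappZm enormZ -mulrA ler_wpM2l // enorm_mxapp.
Qed.

Lemma opnormZ n k (A : 'M[R]_n) : opnorm (k *: A) = `|k| * opnorm A.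
Proof.
apply/eqP; rewrite eq_le opnormZ_le /=.
have [->|k0] := eqVneq k 0; first by rewrite normr0 mul0r opnorm_ge0.
rewrite -{1}[A](scalerK k0) -ler_pdivlMl ?normr_gt0 //.
by apply: le_trans (opnormZ_le _ _) _; rewrite normfV.
Qed.

End LinearAlgebra.

(** * The matrices [A(tau)] and the domain [Omega_star] *)

Section Amat.
Variables (R : realType) (q m : nat) (U : 'I_m -> 'M[R]_q).

Lemma AmatD a b : Amat U (a + b) = Amat U a + Amat U b.
Proof. by rewrite -big_split; apply: eq_bigr => j _; rewrite mxE scalerDl. Qed.

Lemma AmatZ k a : Amat U (k *: a) = k *: Amat U a.
Proof. by rewrite scaler_sumr; apply: eq_bigr => j _; rewrite mxE scalerA. Qed.

Lemma Amat_skew (sU : forall j, skew_sym (U j)) tau : skew_sym (Amat U tau).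
Proof.
rewrite /skew_sym /Amat raddf_sum -sumrN; apply: eq_bigr => j _ /=.
by rewrite linearZ /= sU scalerN.
Qed.

Lemma dotv_Uform x y tau :
  dotv (Uform U x y) tau = dotv (mxapp (Amat U tau) x) y.
Proof.
rewrite /dotv; under eq_bigr do rewrite mxE /dotv mulr_suml.
rewrite exchange_big /=; apply: eq_bigr => i _.
rewrite /mxapp /Amat raddf_sum /= mulmx_sumr summxE mulr_suml; apply: eq_bigr => j _.
rewrite linearZ /= -scalemxAr [in RHS]mxE; ring.
Qed.

Lemma mxl1_Amat_le : exists2 c : R, 0 < c & forall tau, mxl1 (Amat U tau) <= c * `|tau|.
Proof.
exists (1 + \sum_j mxl1 (U j)) => [|tau].
  by rewrite ltr_wpDr // sumr_ge0 // => j _; exact: mxl1_ge0.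
apply: le_trans (mxl1_sum _ _ _) _.
apply: (@le_trans _ _ (\sum_j `|tau| * mxl1 (U j))).
  by apply: ler_sum => j _; rewrite mxl1Z ler_wpM2r ?mxl1_ge0 ?coord_le_norm.
by rewrite -mulr_sumr mulrC ler_wpM2r // lerDr.
Qed.

Lemma Omega_near tau : Omega_star U tau -> exists2 rho : R, 0 <= rho < pi &
  \forall s \near tau, opnorm (Amat U s) < rho.
Proof.
move=> ot; have [c c0 cP] := mxl1_Amat_le.
pose rho := (opnorm (Amat U tau) + pi) / 2.
have ot0 := opnorm_ge0 (Amat U tau); have pi0 := pi_gt0 R.
rewrite /Omega_star /= in ot.
exists rho; first by rewrite /rho; apply/andP; split; lra.
have d0 : 0 < (rho - opnorm (Amat U tau)) / c by rewrite divr_gt0 // /rho; lra.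
apply/nbhs_ballP; exists ((rho - opnorm (Amat U tau)) / c) => //= s.
rewrite -ball_normE /= => ts.
have -> : s = tau + (s - tau) by rewrite addrCA subrr addr0.
rewrite AmatD; apply: le_lt_trans (opnormD _ _) _.
rewrite -ltrBrDl; apply: le_lt_trans (opnorm_le_l1 _) _.
by apply: le_lt_trans (cP _) _; rewrite -ltr_pdivlMl // distrC mulrC.
Qed.

Lemma Omega_open : open (Omega_star U).
Proof.
rewrite openE => tau /Omega_near[rho /andP[_ rp] h].
by apply: filterS h => s /= /lt_trans; apply.
Qed.

Lemma Omega_shrink tau r : Omega_star U tau -> 0 <= r <= 1 -> Omega_star U (r *: tau).
Proof.
move=> ot /andP[r0 r1]; rewrite /Omega_star /= AmatZ opnormZ ger0_norm //.
by apply: le_lt_trans ot; rewrite ler_piMl ?opnorm_ge0.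
Qed.

End Amat.

(** * Matrix power series *)

Section Differentials.
Variables (R : realType) (V W : normedModType R).

(** The bound [K] makes the candidate [df] continuous, so that [diff_unique] identifies it with the
    differential. Differentials of limits of series and of implicit functions are found in this way,
    from an estimate of the remainder. *)
Lemma is_diff_bound (f df : V -> W) (x : V) (K : R) : linear df ->
  (forall h, `|df h| <= K * `|h|) ->
  (forall e : R, 0 < e -> \forall h \near (0 : V), `|f (h + x) - f x - df h| <= e * `|h|) ->
  is_diff x f df.
Proof.
move=> dfl dfK fe.
pose D : {linear V -> W} := HB.pack_for {linear V -> W} df (GRing.isLinear.Build _ _ _ _ df dfl).
have Dc : continuous D.
  apply: bounded_linear_continuous; apply/bounded_funP => r; exists (`|K| * r) => y yr.
  apply: le_trans (dfK y) _; apply: (@le_trans _ _ (`|K| * `|y|)).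
    by rewrite ler_wpM2r // ler_norm.
  by rewrite ler_wpM2l.
have Do : f \o shift x = cst (f x) + D +o_ (0 : V) id.
  apply/eqaddoP => e e0; apply: filterS (fe e e0) => h /=.
  by rewrite opprD addrA.
have dE := diff_unique Dc Do.
by apply: DiffDef => //; apply/diff_locallyP; rewrite dE.
Qed.

Lemma linear_is_diff (L : V -> W) (K : R) x :
  linear L -> (forall h, `|L h| <= K * `|h|) -> is_diff x L L.
Proof.
move=> Ll LK; apply: (@is_diff_bound _ _ _ K) => // e e0.
apply/nbhs_ballP; exists 1 => //= h _.
have -> : L (h + x) = L h + L x by have := Ll 1 h x; rewrite !scale1r.
by rewrite addrK subrr normr0 mulr_ge0 // ltW.
Qed.

Lemma diff_bound (f : V -> W) (x : V) : differentiable f x ->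
  forall e : R, 0 < e ->
  \forall h \near (0 : V), `|f (h + x) - f x - 'd f x h| <= e * `|h|.
Proof.
move=> /diff_locally /eqaddoP fe e e0; apply: filterS (fe e e0) => h /=.
by rewrite opprD addrA.
Qed.

Lemma is_diff_derive (f df : V -> W) (x v : V) : is_diff x f df -> 'D_v f x = df v.
Proof. by move=> fd; rewrite deriveE // diff_val. Qed.

End Differentials.

Section Opnorm.
Variable R : realType.

Lemma opnormM n (A B : 'M[R]_n) : opnorm (A *m B) <= opnorm A * opnorm B.
Proof.
apply: opnorm_le => [|x]; first by rewrite mulr_ge0 ?opnorm_ge0.
rewrite mxapp_mul; apply: le_trans (enorm_mxapp _ _) _.
by rewrite -mulrA ler_wpM2l ?opnorm_ge0 // enorm_mxapp.
Qed.

Lemma opnorm0 n : opnorm (0 : 'M[R]_n) = 0.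
Proof. by rewrite -(scale0r 0) opnormZ normr0 mul0r. Qed.

Lemma opnormX n (A : 'M[R]_n) k rho : opnorm A <= rho -> opnorm (A ^+ k) <= rho ^+ k.
Proof.
move=> Ar; elim: k => [|k IH].
  by rewrite !expr0; apply: opnorm_le => // x; rewrite mul1r /mxapp trmx1 mulmx1.
rewrite !exprS; apply: le_trans (opnormM _ _) _.
by rewrite ler_pM ?opnorm_ge0.
Qed.

Lemma coord_le_opnorm n (A : 'M[R]_n) i j : `|A i j| <= opnorm A.
Proof.
have -> : A i j = mxapp A (delta_mx 0 j) 0 i.
  rewrite mxappE (bigD1 j) //= mxE !eqxx mulr1 big1 ?addr0 // => l lj.
  by rewrite mxE eqxx (negPf lj) mulr0.
apply: le_trans (enorm_coord _ _) _; apply: le_trans (enorm_mxapp _ _) _.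
suff -> : enorm (delta_mx 0 j : 'rV[R]_n) = 1 by rewrite mulr1.
rewrite /enorm /dotv (bigD1 j) //= mxE !eqxx mulr1 big1 ?addr0 ?sqrtr1 // => l lj.
by rewrite mxE eqxx (negPf lj) mulr0.
Qed.

(** Matrix model of the dual number [X + eps H] with [eps ^ 2 = 0]: a power series evaluated at it
    carries its derivative at [X] in the direction [H] in the upper right block. *)
Definition blk n (X H : 'M[R]_n) : 'M[R]_(n + n) := block_mx X H 0 X.

Lemma enorm_row_mx n1 n2 (a : 'rV[R]_n1) (b : 'rV[R]_n2) :
  enorm (row_mx a b) ^+ 2 = enorm a ^+ 2 + enorm b ^+ 2.
Proof.
rewrite !enormE /dotv big_split_ord /=; congr (_ + _); apply: eq_bigr => i _.
  by rewrite !row_mxEl.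
by rewrite !row_mxEr.
Qed.

Lemma opnorm_blk n (X H : 'M[R]_n) : opnorm (blk X H) <= opnorm X + opnorm H.
Proof.
have -> : blk X H = block_mx X 0 0 X + block_mx 0 H 0 0.
  by rewrite add_block_mx !addr0 add0r.
apply: le_trans (opnormD _ _) _; apply: lerD; apply: opnorm_le => [|x];
  rewrite ?opnorm_ge0 //; rewrite -[x]hsubmxK /mxapp tr_block_mx !trmx0 mul_row_block;
  rewrite !mulmx0 ?addr0 ?add0r -(@ler_pXn2r _ 2) ?nnegrE ?mulr_ge0 ?enorm_ge0 ?opnorm_ge0 //.
- rewrite exprMn !enorm_row_mx mulrDr -!exprMn.
  by apply: lerD; rewrite ler_pXn2r ?nnegrE ?mulr_ge0 ?enorm_ge0 ?opnorm_ge0 // enorm_mxapp.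
- rewrite exprMn !enorm_row_mx enorm0 expr0n /= addr0 mulrDr -!exprMn.
  rewrite -[leLHS]add0r; apply: lerD; first by rewrite exprn_ge0 // mulr_ge0 ?enorm_ge0 ?opnorm_ge0.
  by rewrite ler_pXn2r ?nnegrE ?mulr_ge0 ?enorm_ge0 ?opnorm_ge0 // enorm_mxapp.
Qed.

(* derivative of [X ^+ k] in the direction [H] *)
Fixpoint dpow n (X H : 'M[R]_n) k : 'M[R]_n :=
  if k is k'.+1 then X *m dpow X H k' + H *m X ^+ k' else 0.

Lemma dpow_linear n (X : 'M[R]_n) k : linear (fun H => dpow X H k).
Proof.
move=> c G H; elim: k => [|k IH] /=; first by rewrite scaler0 addr0.
by rewrite IH mulmxDr -scalemxAr mulmxDl -scalemxAl scalerDr addrACA.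
Qed.

Lemma dpow_self n (X : 'M[R]_n) k : dpow X X k = k%:R *: X ^+ k.
Proof.
elim: k => [|k IH] /=; first by rewrite scale0r.
rewrite IH -scalemxAr -[X *m X ^+ k]/(X * X ^+ k)%R -exprS -{2}[X ^+ k.+1]scale1r.
by rewrite -scalerDl natr1.
Qed.

Lemma blk_exp n (X H : 'M[R]_n) k : blk X H ^+ k = block_mx (X ^+ k) (dpow X H k) 0 (X ^+ k).
Proof.
elim: k => [|k IH]; first by rewrite !expr0 /= -scalar_mx_block.
rewrite exprS IH -[(_ * _)%R]/(_ *m _) /blk mulmx_block !mul0mx !mulmx0 !addr0 !add0r.
by rewrite !exprS.
Qed.

(** Induction on [(X + H)^(k+1) - X^(k+1) = (X + H) ((X + H)^k - X^k) + H X^k]. The factor [rho] on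
    the left avoids the exponent [k - 1] and a case distinction at [k = 0]. *)
Lemma powB_bound n (X H : 'M[R]_n) rho k : opnorm X <= rho -> opnorm (X + H) <= rho ->
  rho * opnorm ((X + H) ^+ k - X ^+ k) <= k%:R * rho ^+ k * opnorm H.
Proof.
move=> Xr XHr; have r0 : 0 <= rho := le_trans (opnorm_ge0 _) Xr.
elim: k => [|k IH]; first by rewrite !expr0 subrr opnorm0 mulr0 !mul0r.
have -> : (X + H) ^+ k.+1 - X ^+ k.+1 = (X + H) *m ((X + H) ^+ k - X ^+ k) + H *m X ^+ k.
  by rewrite !exprS mulmxBr -addrA; congr (_ + _); rewrite mulmxDl opprD addrNK.
apply: (@le_trans _ _ (rho * (rho * opnorm ((X + H) ^+ k - X ^+ k) + opnorm H * rho ^+ k))).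
  rewrite ler_wpM2l //; apply: le_trans (opnormD _ _) _; apply: lerD.
    apply: le_trans (opnormM _ _) _.
    by rewrite ler_wpM2r ?opnorm_ge0.
  apply: le_trans (opnormM _ _) _.
  by rewrite ler_wpM2l ?opnorm_ge0 ?opnormX.
rewrite mulrDr; move: IH => /(ler_wpM2l r0).
rewrite exprS -[k.+1%:R]natr1; set a := opnorm _; set b := opnorm _; set c := rho ^+ k.
by move=> IH; rewrite mulrDl mul1r !mulrDl; apply: lerD; lra.
Qed.

(** The second order remainder satisfies [rem (k+1) = X rem k + H ((X + H)^k - X^k)], and
    [powB_bound] controls the last term. The natural factor [k (k - 1) / 2] is rounded up to
    [k ^ 2]. *)
Lemma powB_dpow_bound n (X H : 'M[R]_n) rho k : opnorm X <= rho -> opnorm (X + H) <= rho ->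
  rho ^+ 2 * opnorm ((X + H) ^+ k - X ^+ k - dpow X H k)
    <= k%:R ^+ 2 * rho ^+ k * opnorm H ^+ 2.
Proof.
move=> Xr XHr; have r0 : 0 <= rho := le_trans (opnorm_ge0 _) Xr.
elim: k => [|k IH]; first by rewrite /= !expr0 subrr subr0 opnorm0 mulr0 expr0n !mul0r.
have -> : (X + H) ^+ k.+1 - X ^+ k.+1 - dpow X H k.+1 =
    X *m ((X + H) ^+ k - X ^+ k - dpow X H k) + H *m ((X + H) ^+ k - X ^+ k).
  rewrite /= !exprS !mulmxBr -![(_ * _)%R]/(_ *m _) mulmxDl opprD.
  by rewrite !addrA [LHS](ACl (1*3*4*2*5)) /= ?addrA.
have B := powB_bound k Xr XHr.
set a := opnorm _; set b := opnorm H.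
have aP : a <= rho * opnorm ((X + H) ^+ k - X ^+ k - dpow X H k)
               + b * opnorm ((X + H) ^+ k - X ^+ k).
  apply: le_trans (opnormD _ _) _; apply: lerD; apply: le_trans (opnormM _ _) _ => //.
  by rewrite ler_wpM2r ?opnorm_ge0.
move: IH B aP; rewrite [rho ^+ k.+1]exprS -[k.+1%:R]natr1; set c := opnorm _.
have b0 : 0 <= b := opnorm_ge0 _.
move=> /(ler_wpM2l r0) IH /(ler_wpM2l (mulr_ge0 r0 b0)) B.
move=> /(ler_wpM2l (sqr_ge0 rho)) /le_trans; apply.
have Z : 0 <= k%:R * (rho * rho ^+ k) * b ^+ 2.
  by rewrite !mulr_ge0 ?exprn_ge0.
have Z2 : 0 <= (rho * rho ^+ k) * b ^+ 2 by rewrite !mulr_ge0 ?exprn_ge0.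
rewrite -/b in IH B *.
set d2 := opnorm (_ - _) in B *.
lra.
Qed.

End Opnorm.

Section SeriesFacts.
Variable R : realType.
Implicit Types (c u v : nat -> R) (rho : R).

Definition csum c rho := cvgn (series (fun k => `|c k| * rho ^+ k)).

Lemma lim_series_abs_le u v : cvgn (series v) -> (forall k, `|u k| <= v k) ->
  cvgn (series u) /\ `|limn (series u)| <= limn (series v).
Proof.
move=> cv uv.
have cn : cvgn [normed series u].
  apply: series_le_cvg cv => [k|k|k]; [exact: normr_ge0|exact: le_trans (normr_ge0 _) (uv k)|exact: uv].
split; first exact: normed_cvg.
apply: le_trans (lim_series_norm cn) _; exact: lim_series_le.
Qed.

Lemma csum_le c rho rho' : 0 <= rho <= rho' -> csum c rho' -> csum c rho.
Proof.
move=> /andP[r0 rr]; have r0' := le_trans r0 rr; apply: series_le_cvg => k.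
- by rewrite mulr_ge0 // exprn_ge0.
- by rewrite mulr_ge0 // exprn_ge0.
- by rewrite ler_wpM2l // lerXn2r.
Qed.

(** Bernoulli's inequality: if [(1 + e)^2 <= rho' / rho], then squaring [k e <= (1 + e)^k] gives the
    claim with [M = 1 / e^2]. A slightly larger radius thus pays for the factor [k ^ 2] of second
    order remainders. *)
Lemma sqr_geom_bound rho rho' : 0 < rho < rho' ->
  exists2 M : R, 0 <= M & forall k, k%:R ^+ 2 * rho ^+ k <= M * rho' ^+ k.
Proof.
move=> /andP[r0 rr].
pose t := rho' / rho; have t1 : 1 < t by rewrite ltr_pdivlMr // mul1r.
(* Since [e <= 1], [(1 + e)^2 <= 1 + 3 e], which is at most [t]. *)
pose e := Num.min 1 ((t - 1) / 3).
have e0 : 0 < e by rewrite lt_min ltr01 /=; lra.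
have e1 : e <= 1 by rewrite ge_min lexx.
have e2 : e <= (t - 1) / 3 by rewrite ge_min lexx orbT.
have et : (1 + e) ^+ 2 <= t.
  by have : e * e <= e * 1 by [rewrite ler_wpM2l // ltW]; lra.
have bern k : 1 + k%:R * e <= (1 + e) ^+ k.
  elim: k => [|k IH]; first by rewrite mul0r addr0 expr0.
  have : (1 + e) * (1 + k%:R * e) <= (1 + e) * (1 + e) ^+ k by rewrite ler_wpM2l //; lra.
  rewrite exprS -natr1; have : 0 <= k%:R * (e * e) by rewrite !mulr_ge0 // ltW.
  lra.
exists (e ^- 2) => [|k]; first by rewrite invr_ge0 exprn_ge0 // ltW.
have -> : rho' = t * rho by rewrite /t divfK // gt_eqF.
rewrite exprMn mulrA ler_wpM2r ?exprn_ge0 ?(ltW r0) // ler_pdivlMl ?exprn_gt0 // mulrC.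
rewrite -exprMn; apply: (@le_trans _ _ (((1 + e) ^+ 2) ^+ k)); last first.
  by rewrite lerXn2r // nnegrE ?exprn_ge0 //; lra.
rewrite -exprM mulnC exprM lerXn2r ?nnegrE ?mulr_ge0 ?exprn_ge0 //; try lra.
by apply: le_trans (bern k); lra.
Qed.

Lemma csum_sqr c rho rho' : 0 < rho < rho' -> csum c rho' ->
  cvgn (series (fun k => `|c k| * (k%:R ^+ 2 * rho ^+ k))).
Proof.
move=> rr cs; have [M M0 MP] := sqr_geom_bound rr.
move/andP: rr => [r0 rr].
apply: (@series_le_cvg _ _ (M *: (fun k => `|c k| * rho' ^+ k))) => [k|k|k|].
- by rewrite !mulr_ge0 ?exprn_ge0 // ltW.
- by rewrite !mulr_ge0 ?exprn_ge0 // ltW // (lt_trans r0).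
- change (`|c k| * (k%:R ^+ 2 * rho ^+ k) <= M * (`|c k| * rho' ^+ k)).
  by rewrite [leRHS]mulrCA ler_wpM2l.
- exact: is_cvg_seriesZ.
Qed.

End SeriesFacts.

Section MatrixPowerSeries.
Variable R : realType.
Implicit Types (c : nat -> R) (rho : R).

(** The limit is taken entry by entry, so that only real series occur. *)
Definition mxps c n (X : 'M[R]_n) : 'M[R]_n :=
  \matrix_(i, j) limn (series (fun k => c k * (X ^+ k) i j)).

Lemma mxps_cvg c n (X : 'M[R]_n) rho : opnorm X <= rho -> csum c rho ->
  forall i j, cvgn (series (fun k => c k * (X ^+ k) i j)).
Proof.
move=> Xr cs i j.
apply: (lim_series_abs_le cs _).1 => k; rewrite normrM ler_wpM2l //.
exact: le_trans (coord_le_opnorm _ _ _) (opnormX _ Xr).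
Qed.
Arguments mxps_cvg {c n X rho} Xr cs i j.

Section Derivative.
Variables (V : normedModType R) (n : nat) (L Lam : V -> 'M[R]_n) (x : V) (kL rho rho' : R).
Hypothesis Laff : forall y h, L (h + y) = L y + Lam h.
Hypothesis Lamlin : linear Lam.
Hypothesis Lamb : forall h, opnorm (Lam h) <= kL * `|h|.
Hypothesis rr : 0 < rho < rho'.
Hypothesis Lnear : \forall y \near x, opnorm (L y) <= rho.

(** Termwise differentiation: [powB_dpow_bound] bounds the remainder of each term, and the gap
    between [rho] and [rho'] makes the sum of these bounds finite. The argument is an arbitrary
    affine map [L], so that the block matrices produced by differentiation are covered as well. *)
Lemma mxps_is_diff c a b : csum c rho' ->
  is_diff x (fun y => mxps c (L y) a b)
    (fun v => limn (series (fun k => c k * dpow (L x) (Lam v) k a b))).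
Proof.
move=> cs.
have r0 : 0 < rho by case/andP: rr.
have cs1 : csum c rho by apply: csum_le cs; case/andP: rr => *; rewrite !ltW.
have cs2 := csum_sqr rr cs.
set S := limn (series (fun k => `|c k| * (k%:R ^+ 2 * rho ^+ k))).
have S0 : 0 <= S.
  apply: limr_ge => //; apply: nearW => k; apply: sumr_ge0 => i _.
  by rewrite !mulr_ge0 ?exprn_ge0 // ltW.
have Lx := nbhs_singleton Lnear; rewrite /= in Lx.
have dbound v k : `|c k * dpow (L x) (Lam v) k a b| <=
    (2 * opnorm (Lam v) / rho) * (`|c k| * (k%:R ^+ 2 * rho ^+ k)).
  suff : rho * opnorm (dpow (L x) (Lam v) k) <= 2 * opnorm (Lam v) * (k%:R ^+ 2 * rho ^+ k).
    move=> h; rewrite normrM mulrCA ler_wpM2l // mulrAC ler_pdivlMr // mulrC.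
    by apply: le_trans h; rewrite ler_wpM2l ?coord_le_opnorm // ltW.
  elim: k => [|k IH] /=; first by rewrite opnorm0 expr0n /= mul0r !mulr0.
  apply: (@le_trans _ _ (rho * (rho * opnorm (dpow (L x) (Lam v) k) + opnorm (Lam v) * rho ^+ k))).
    rewrite (ler_wpM2l (ltW r0)) //; apply: le_trans (opnormD _ _) _; apply: lerD;
    apply: le_trans (opnormM _ _) _; first by rewrite ler_wpM2r ?opnorm_ge0.
    by rewrite ler_wpM2l ?opnorm_ge0 ?opnormX.
  rewrite mulrDr; move: IH => /(ler_wpM2l (ltW r0)) IH.
  have Z : 0 <= k%:R * (rho * rho ^+ k) * opnorm (Lam v).
    by rewrite !mulr_ge0 ?exprn_ge0 ?opnorm_ge0 ?(ltW r0).
  have Z2 : 0 <= (rho * rho ^+ k) * opnorm (Lam v).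
    by rewrite !mulr_ge0 ?exprn_ge0 ?opnorm_ge0 ?(ltW r0).
  by rewrite [rho ^+ k.+1]exprS -natr1; lra.
have cs2' v : cvgn (series ((2 * opnorm (Lam v) / rho) *:
    (fun k => `|c k| * (k%:R ^+ 2 * rho ^+ k)))) by exact: is_cvg_seriesZ.
have dcvg v : cvgn (series (fun k => c k * dpow (L x) (Lam v) k a b)).
  exact: (lim_series_abs_le (cs2' v) (dbound v)).1.
apply: (@is_diff_bound _ _ _ _ _ _ (2 * kL / rho * S)).
- move=> k u v; rewrite Lamlin.
  have -> : (fun j => c j * dpow (L x) (k *: Lam u + Lam v) j a b) =
    k *: (fun j => c j * dpow (L x) (Lam u) j a b) + (fun j => c j * dpow (L x) (Lam v) j a b).
    apply/funext => j; rewrite dpow_linear !mxE mulrDr.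
    by congr (_ + _); rewrite mulrCA.
  set F := (fun j => c j * dpow (L x) (Lam u) j a b).
  have cF : cvgn (series F) by exact: dcvg.
  have ckF : cvgn (series (k *: F)) by exact: is_cvg_seriesZ.
  by rewrite lim_seriesD // lim_seriesZ.
- move=> v; apply: le_trans (lim_series_abs_le (cs2' v) (dbound v)).2 _.
  rewrite (lim_seriesZ _ cs2) -/S -[_ *: S]/(_ * S) [leRHS]mulrAC ler_wpM2r //.
  have r2 : 0 <= 2 / rho by rewrite divr_ge0 // ltW.
  by have := ler_wpM2l r2 (Lamb v); lra.
- move=> e e0.
  have SK : 0 <= S * kL ^+ 2 / rho ^+ 2.
    by apply: divr_ge0; [apply: mulr_ge0 => //; exact: sqr_ge0|exact: sqr_ge0].
  (* The remainder is at most [S * kL^2 / rho^2] times [|h|^2]. This [d] turns one factor [|h|] into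
     [e]; the added 1 keeps the denominator positive. *)
  pose d := e / (S * kL ^+ 2 / rho ^+ 2 + 1).
  have den : 0 < S * kL ^+ 2 / rho ^+ 2 + 1.
    by rewrite ltr_wpDl.
  have d0 : 0 < d by rewrite divr_gt0.
  have hn : \forall h \near (0 : V), opnorm (L (h + x)) <= rho.
    by move: Lnear; rewrite {1}(near_shift 0 x); apply: filterS => h /=; rewrite subr0.
  have hd : \forall h \near (0 : V), `|h| <= d.
    apply/nbhs_ballP; exists d => //= h; rewrite -ball_normE /= sub0r normrN; exact: ltW.
  near=> h.
  have Lh : opnorm (L (h + x)) <= rho by near: h.
  have hle : `|h| <= d by near: h.
  rewrite Laff in Lh *.
  have sb k : `|c k * ((L x + Lam h) ^+ k) a b - c k * (L x ^+ k) a b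
       - c k * dpow (L x) (Lam h) k a b| <=
      (opnorm (Lam h) ^+ 2 / rho ^+ 2) * (`|c k| * (k%:R ^+ 2 * rho ^+ k)).
    rewrite -!mulrBr normrM mulrCA ler_wpM2l // mulrAC ler_pdivlMr ?exprn_gt0 //.
    rewrite [leRHS]mulrC; apply: le_trans (powB_dpow_bound k Lx Lh); rewrite mulrC ler_wpM2l ?sqr_ge0 //.
    by have := coord_le_opnorm ((L x + Lam h) ^+ k - L x ^+ k - dpow (L x) (Lam h) k) a b;
      rewrite !mxE.
  have cs3 : cvgn (series ((opnorm (Lam h) ^+ 2 / rho ^+ 2) *:
    (fun k => `|c k| * (k%:R ^+ 2 * rho ^+ k)))) by exact: is_cvg_seriesZ.
  have := (lim_series_abs_le cs3 sb).2.
  rewrite (lim_seriesZ _ cs2) -/S -[_ *: S]/(_ * S) => /le_trans lt.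
  rewrite !mxE.
  have c1 := mxps_cvg Lh cs1 a b; have c2 := mxps_cvg Lx cs1 a b.
  rewrite -lim_seriesB // -lim_seriesB //; last exact: is_cvg_seriesB.
  apply: lt; apply: (@le_trans _ _ ((S * kL ^+ 2 / rho ^+ 2) * `|h| * `|h|)).
    have : opnorm (Lam h) ^+ 2 <= (kL * `|h|) ^+ 2.
      by rewrite lerXn2r ?nnegrE ?opnorm_ge0 // (le_trans (opnorm_ge0 _) (Lamb h)).
    move=> hh; have ri : 0 <= S / rho ^+ 2 by rewrite divr_ge0 // exprn_ge0 // ltW.
    have := ler_wpM2l ri hh; rewrite exprMn; lra.
  rewrite ler_wpM2r //.
  apply: (@le_trans _ _ ((S * kL ^+ 2 / rho ^+ 2 + 1) * d)).
    by apply: ler_pM => //; rewrite lerDl.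
  by rewrite /d mulrC divfK // gt_eqF.
Unshelve. all: by end_near. Qed.

Lemma mxps_blk c a b v :
  mxps c (blk (L x) (Lam v)) (lshift n a) (rshift n b) =
  limn (series (fun k => c k * dpow (L x) (Lam v) k a b)).
Proof.
by rewrite mxE; congr (limn (series _)); apply/funext => k; rewrite blk_exp block_mxEur.
Qed.

End Derivative.

End MatrixPowerSeries.
Arguments mxps_cvg {R c n X rho} Xr cs i j.

(** * Smoothness by iterated directional derivatives *)

Section SmoothOn.
Variables (R : realType) (V : normedModType R).
Implicit Types (A : set V) (f g : V -> R).

Lemma iterD_cat f (vs ws : seq V) : iterD (vs ++ ws) f = iterD vs (iterD ws f).
Proof. by elim: vs => //= v vs ->. Qed.

Lemma smooth_onD1 A f v : smooth_on A f -> smooth_on A ('D_v f).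
Proof. by move=> sf vs x Ax; have := sf (vs ++ [:: v]) x Ax; rewrite iterD_cat. Qed.

Lemma smooth_on_diff A f x : smooth_on A f -> A x -> differentiable f x.
Proof. by move=> sf Ax; exact: (sf [::] x Ax). Qed.

Lemma near_eq_diff f g x : (\forall y \near x, f y = g y) ->
  differentiable f x -> differentiable g x.
Proof.
move=> fg df.
suff : is_diff x g ('d f x) by case.
have fgx := nbhs_singleton fg; rewrite /= in fgx.
have [K K0 dK] : exists2 K, 0 < K & forall h, `|'d f x h| <= K * `|h|.
  exact/linear_lipschitz/diff_continuous.
apply: (@is_diff_bound _ _ _ _ _ _ K) => //; first exact: linearP.
move=> e e0; have := diff_bound df e0; apply: filter_app.
have : \forall h \near (0 : V), f (h + x) = g (h + x).
  by move: fg; rewrite {1}(near_shift 0 x); apply: filterS => h /=; rewrite subr0.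
by apply: filterS => h <-; rewrite fgx.
Qed.

(** Coinduction principle: a class of differentiable functions that is stable under directional
    derivatives contains all iterated derivatives of its members. The main smoothness proofs consist
    in finding such a class. *)
Lemma smooth_on_coind A (S : (V -> R) -> Prop) : open A ->
  (forall f g, S f -> (forall x, A x -> f x = g x) -> S g) ->
  (forall f x, S f -> A x -> differentiable f x) ->
  (forall f v, S f -> S ('D_v f)) ->
  forall f, S f -> smooth_on A f.
Proof.
move=> oA Seq Sd SD f Sf vs x Ax; apply: Sd Ax.
by elim: vs => //= v vs IH; apply: SD.
Qed.

Lemma open_near A x : open A -> A x -> \forall y \near x, A y.
Proof. by rewrite openE => oA Ax; exact: oA. Qed.

Lemma derive_eq_on A f g x v : open A -> (forall y, A y -> f y = g y) -> A x ->
  'D_v f x = 'D_v g x.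
Proof.
move=> oA fg Ax; have [->|v0] := eqVneq v 0; first by rewrite !derive0.
by apply: near_eq_derive => //; apply: filterS (open_near oA Ax).
Qed.

Lemma smooth_on_eq A f g : open A -> (forall x, A x -> f x = g x) ->
  smooth_on A f -> smooth_on A g.
Proof.
move=> oA fg sf vs x Ax.
suff : forall y, A y -> iterD vs f y = iterD vs g y.
  move=> fgv; apply: near_eq_diff (sf vs x Ax).
  by apply: filterS (open_near oA Ax) => y; exact: fgv.
elim: vs {x Ax} => //= v vs IH y Ay; exact: (derive_eq_on _ oA).
Qed.

End SmoothOn.

Section PsFun.
Variables (R : realType) (V : normedModType R) (D : set V) (c : nat -> R) (rho : R).
Hypotheses (oD : open D) (cr : csum c rho).

(* Entries of matrix power series with affine argument; a derivative is again of this form,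
   with the argument [L] replaced by the block matrix [blk L L'] (see [blk_exp]). *)
Definition psfun (f : V -> R) : Prop :=
  exists (n : nat) (L Lam : V -> 'M[R]_n) (kL r s : R) (a b : 'I_n),
  [/\ (forall y h, L (h + y) = L y + Lam h), linear Lam,
      (forall h, opnorm (Lam h) <= kL * `|h|), 0 < r < rho &
      forall y, D y -> opnorm (L y) <= r /\ f y = s * mxps c (L y) a b].

Lemma psfun_diff f : psfun f -> forall x, D x -> differentiable f x.
Proof.
move=> [n [L [Lam [kL [r [s [a [b [Laff Lamlin Lamb rr LfE]]]]]]]]] x Dx.
have Lnear : \forall y \near x, opnorm (L y) <= r.
  by apply: filterS (open_near oD Dx) => y /LfE[].
have [df _] := mxps_is_diff Laff Lamlin Lamb rr Lnear a b cr.
apply: near_eq_diff (differentiableZ s df).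
by apply: filterS (open_near oD Dx) => y /LfE[_ ->].
Qed.

(** The derivative is an upper right block of the series at [blk], but a long direction [v] could
    push the block matrix out of the disc of convergence. The direction is shrunk by [e], and the
    factor [s / e] undoes this. *)
Lemma psfun_derive f v : psfun f -> psfun ('D_v f).
Proof.
move=> [n [L [Lam [kL [r [s [a [b [Laff Lamlin Lamb /andP[r0 rr] LfE]]]]]]]]].
(* Makes the norm of [Lam] at [e v] at most [(rho - r) / 2], so that the block matrix has norm at
   most [(rho + r) / 2]. *)
pose e := (rho - r) / (2 * (opnorm (Lam v) + 1)).
have o1 : 0 < opnorm (Lam v) + 1 by rewrite ltr_wpDl // opnorm_ge0.
have e0 : 0 < e by rewrite divr_gt0 ?mulr_gt0 // subr_gt0.
have Lam0 h k : Lam (k *: h) = k *: Lam h.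
  have L0 : Lam 0 = 0 by have := Lamlin (-1) 0 0; rewrite scaler0 addr0 scaleN1r addNr.
  by have := Lamlin k h 0; rewrite !addr0 L0 addr0.
exists (n + n)%N, (fun y => blk (L y) (Lam (e *: v))), (fun h => blk (Lam h) 0), kL,
  ((rho + r) / 2), (s / e), (lshift n a), (rshift n b); split.
- by move=> y h; rewrite /blk Laff add_block_mx !addr0.
- by move=> k x y; rewrite /blk Lamlin scale_block_mx add_block_mx !scaler0 !addr0.
- by move=> h; apply: le_trans (opnorm_blk _ _) _; rewrite opnorm0 addr0.
- by apply/andP; split; lra.
- move=> y Dy; have [Lr _] := LfE y Dy; split.
    apply: le_trans (opnorm_blk _ _) _.
    have : opnorm (Lam (e *: v)) <= (rho - r) / 2.
      rewrite Lam0 opnormZ gtr0_norm // /e; set o := opnorm _ in o1 *.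
      have -> : (rho - r) / (2 * (o + 1)) * o = (rho - r) / 2 * (o / (o + 1)).
        by field; rewrite gt_eqF.
      rewrite ler_piMr //; first by lra.
      by rewrite ler_pdivrMr // mul1r lerDl.
    lra.
  have Lnear : \forall z \near y, opnorm (L z) <= r.
    by apply: filterS (open_near oD Dy) => z /LfE[].
  have rr' : 0 < r < rho by rewrite r0.
  have dp := mxps_is_diff Laff Lamlin Lamb rr' Lnear a b cr.
  have dif : differentiable (fun y => mxps c (L y) a b) y by case: dp.
  rewrite (@derive_eq_on _ _ D f (s *: (fun y => mxps c (L y) a b))) //; last first.
    by move=> z /LfE[_ ->].
  rewrite deriveZ; last exact: diff_derivable.
  rewrite mxps_blk -[s *: _]/(s * _) -mulrA; congr (_ * _).
  rewrite -(is_diff_derive _ dp) !deriveE // linearZ /= -[e *: _]/(e * _) mulKf //.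
  by rewrite gt_eqF.
Qed.

Lemma psfun_smooth f : psfun f -> smooth_on D f.
Proof.
apply: smooth_on_coind => // {f}.
- move=> f g [n [L [Lam [kL [r [s [a [b [? ? ? ? LfE]]]]]]]]] fg.
  exists n, L, Lam, kL, r, s, a, b; split=> // y Dy; have [? <-] := LfE y Dy.
  by rewrite fg.
- by move=> f x; move=> /psfun_diff; apply.
- by move=> f v; exact: psfun_derive.
Qed.

End PsFun.

(** * The power series of z cot z *)

Section Cauchy.
Variable R : realType.
Implicit Types (c u : nat -> R) (rho : R).

Lemma cvg_sumr (T : Type) (F : set_system T) (FF : Filter F) (I : Type) (r : seq I)
    (f : I -> T -> R) (a : I -> R) : (forall i, f i x @[x --> F] --> a i) ->
  \sum_(i <- r) f i x @[x --> F] --> \sum_(i <- r) a i.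
Proof.
move=> fa; elim: r => [|i r IH].
  by rewrite big_nil; under eq_fun do rewrite big_nil; exact: cvg_cst.
by rewrite big_cons; under eq_fun do rewrite big_cons; exact: cvgD.
Qed.

Definition conv2 c k : R := \sum_(i < k.+1) c i * c (k - i)%N.

Lemma sum_antidiag (T : nmodType) (F : nat -> nat -> T) N :
  \sum_(n < N) \sum_(i < n.+1) F i (n - i)%N = \sum_(i < N) \sum_(j < N - i) F i j.
Proof.
elim: N => [|N IH]; first by rewrite !big_ord0.
rewrite big_ord_recr /= IH [RHS]big_ord_recr /= subSnn big_ord1.
rewrite big_ord_recr /= subnn addrA; congr (_ + _).
rewrite -big_split /=; apply: eq_bigr => i _.
by rewrite (subSn (ltnW (ltn_ord i))) big_ord_recr.
Qed.

(** The square of a partial sum is the partial sum of the Cauchy product plus a corner. The corner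
    is kept explicit because it will be compared with the corner of a majorant. *)
Lemma sum_square_split (T : nmodType) (F : nat -> nat -> T) N :
  \sum_(i < N) \sum_(j < N) F i j =
  \sum_(n < N) \sum_(i < n.+1) F i (n - i)%N + \sum_(i < N) \sum_(N - i <= j < N) F i j.
Proof.
rewrite sum_antidiag -big_split /=; apply: eq_bigr => i _.
by rewrite -!(big_mkord xpredT) -big_cat_nat // leq_subr.
Qed.

(** The terms being nonnegative, a squeeze suffices: the triangle of size [N] lies in the square of
    size [N], which lies in the triangle of size [2 N]. *)
Lemma conv2_series_cvg u : (forall k, 0 <= u k) -> cvgn (series u) ->
  series (conv2 u) @ \oo --> limn (series u) ^+ 2.
Proof.
move=> u0 cu.
have c0 k : 0 <= conv2 u k by apply: sumr_ge0 => i _; exact: mulr_ge0.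
have ndu : nondecreasing_seq (series u) by apply: nondecreasing_series.
have ndc : nondecreasing_seq (series (conv2 u)) by apply: nondecreasing_series.
have sq N : series u N ^+ 2 = \sum_(i < N) \sum_(j < N) u i * u j.
  rewrite /series /= big_mkord expr2 mulr_suml; apply: eq_bigr => i _.
  by rewrite mulr_sumr.
have up N : series (conv2 u) N <= series u N ^+ 2.
  rewrite sq (sum_square_split (fun i j => u i * u j)) /series /= big_mkord lerDl.
  by apply: sumr_ge0 => i _; apply: sumr_ge0 => j _; exact: mulr_ge0.
have low N : series u N ^+ 2 <= series (conv2 u) N.*2.
  rewrite sq /series /= big_mkord (sum_antidiag (fun i j => u i * u j)).
  rewrite -(big_mkord xpredT (fun i => \sum_(j < N) u i * u j)).
  rewrite -(big_mkord xpredT (fun i => \sum_(j < N.*2 - i) u i * u j)).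
  rewrite (@big_cat_nat _ _ _ N 0 N.*2) //=; last by rewrite -addnn leq_addr.
  rewrite -[leLHS]addr0; apply: lerD; last first.
    by apply: sumr_ge0 => i _; apply: sumr_ge0 => j _; exact: mulr_ge0.
  rewrite !big_nat; apply: ler_sum => i /andP[_ iN].
  rewrite -!(big_mkord xpredT (fun j => u i * u j)).
  rewrite (@big_cat_nat _ _ _ N 0 (N.*2 - i)) //=; last by lia.
  by rewrite lerDl; apply: sumr_ge0 => j _; exact: mulr_ge0.
have uS N : series u N <= limn (series u) by apply: nondecreasing_cvgn_le.
have su0 N : 0 <= series u N by apply: sumr_ge0.
have S0 := le_trans (su0 0%N) (uS 0%N).
have cc : cvgn (series (conv2 u)).
  apply: nondecreasing_is_cvgn => //; exists (limn (series u) ^+ 2) => _ [N _ <-].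
  by apply: le_trans (up N) _; rewrite lerXn2r ?nnegrE.
suff -> : limn (series u) ^+ 2 = limn (series (conv2 u)) by [].
have cs2 : series u n ^+ 2 @[n --> \oo] --> limn (series u) ^+ 2.
  by rewrite expr2; under eq_fun do rewrite expr2; exact: cvgM.
apply/eqP; rewrite eq_le; apply/andP; split.
- rewrite -(cvg_lim _ cs2) //; apply: limr_le; first by apply: cvgP cs2.
  apply: nearW => N; apply: le_trans (low N) _; exact: nondecreasing_cvgn_le.
- apply: limr_le => //; apply: nearW => N; apply: le_trans (up N) _.
  by rewrite lerXn2r ?nnegrE.
Qed.

Lemma conv2_abs_le c rho k : 0 <= rho ->
  `|conv2 c k| * rho ^+ k <= conv2 (fun k => `|c k| * rho ^+ k) k.
Proof.
move=> r0; apply: (@le_trans _ _ ((\sum_(i < k.+1) `|c i * c (k - i)%N|) * rho ^+ k)).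
  by rewrite ler_wpM2r ?exprn_ge0 // ler_norm_sum.
rewrite mulr_suml; apply: ler_sum => i _.
have ik : (i <= k)%N by rewrite -ltnS.
by rewrite normrM mulrACA -exprD subnKC.
Qed.

Lemma csum_conv2 c rho : 0 <= rho -> csum c rho -> csum (conv2 c) rho.
Proof.
move=> r0 cs; apply: (@series_le_cvg _ _ (conv2 (fun k => `|c k| * rho ^+ k))) => [k|k|k|].
- by rewrite mulr_ge0 // exprn_ge0.
- by apply: sumr_ge0 => i _; rewrite !mulr_ge0 // exprn_ge0.
- exact: conv2_abs_le.
- apply: cvgP (conv2_series_cvg _ cs) => k.
  by rewrite mulr_ge0 // exprn_ge0.
Qed.

(** The square of a partial sum and the partial sum of the Cauchy product differ by a corner sum.
    Entrywise it is dominated by the corner of the scalar majorant [v], which tends to zero by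
    [conv2_series_cvg]. *)
Lemma mxps_sqr c n (X : 'M[R]_n) rho : opnorm X <= rho -> csum c rho ->
  mxps c X *m mxps c X = mxps (conv2 c) X.
Proof.
move=> Xr cs; have r0 : 0 <= rho := le_trans (opnorm_ge0 _) Xr.
set v := fun k => `|c k| * rho ^+ k.
have v0 k : 0 <= v k by rewrite mulr_ge0 // exprn_ge0.
pose S N := \sum_(k < N) c k *: X ^+ k.
have SE N i j : S N i j = series (fun k => c k * (X ^+ k) i j) N.
  by rewrite /series /= big_mkord summxE; apply: eq_bigr => k _; rewrite mxE.
have Scvg i j : S N i j @[N --> \oo] --> mxps c X i j.
  rewrite (_ : (fun N => S N i j) = series (fun k => c k * (X ^+ k) i j)); last first.
    by apply/funext => N; rewrite SE.
  have -> : mxps c X i j = limn (series (fun k => c k * (X ^+ k) i j)) by rewrite mxE.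
  by have := mxps_cvg Xr cs i j.
apply/matrixP => i j.
have cv1 : (S N *m S N) i j @[N --> \oo] --> (mxps c X *m mxps c X) i j.
  under eq_fun do rewrite mxE; rewrite mxE.
  by apply: cvg_sumr => k; exact: cvgM.
have cc := mxps_cvg Xr (csum_conv2 r0 cs) i j.
have cv2 : series (fun k => conv2 c k * (X ^+ k) i j) N @[N --> \oo] --> mxps (conv2 c) X i j.
  by rewrite mxE.
have rem : (S N *m S N) i j - series (fun k => conv2 c k * (X ^+ k) i j) N @[N --> \oo] --> (0 : R).
  have B N : `|(S N *m S N) i j - series (fun k => conv2 c k * (X ^+ k) i j) N| <=
      series v N ^+ 2 - series (conv2 v) N.
    have -> : series v N ^+ 2 - series (conv2 v) N = \sum_(i < N) \sum_(N - i <= j < N) v i * v j.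
      rewrite /series /= !big_mkord expr2 mulr_suml.
      rewrite (eq_bigr (fun i : 'I_N => \sum_(j < N) v i * v j)); last by move=> i' _; rewrite mulr_sumr.
      by rewrite (sum_square_split (fun i j => v i * v j)) addrAC subrr add0r.
    have -> : (S N *m S N) = \sum_(k < N) \sum_(l < N) (c k * c l) *: X ^+ (k + l).
      rewrite mulmx_suml; apply: eq_bigr => k _; rewrite mulmx_sumr; apply: eq_bigr => l _.
      by rewrite -scalemxAl -scalemxAr scalerA exprD.
    rewrite (sum_square_split (fun k l => (c k * c l) *: X ^+ (k + l))) mxE.
    have -> : (\sum_(k < N) \sum_(l < k.+1) (c l * c (k - l)%N) *: X ^+ (l + (k - l))) i j =
        series (fun k => conv2 c k * (X ^+ k) i j) N.
      rewrite /series /= big_mkord summxE; apply: eq_bigr => k _.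
      rewrite summxE mulr_suml; apply: eq_bigr => l _; rewrite mxE subnKC //.
      by rewrite -ltnS.
    rewrite addrAC subrr add0r summxE; apply: le_trans (ler_norm_sum _ _ _) _.
    apply: ler_sum => k _; rewrite summxE; apply: le_trans (ler_norm_sum _ _ _) _.
    apply: ler_sum => l _; rewrite mxE !normrM /v mulrACA ler_wpM2l ?mulr_ge0 //.
    rewrite -exprD; apply: le_trans (coord_le_opnorm _ _ _) _; exact: opnormX.
  apply/norm_cvg0P; apply: (@squeeze_cvgr _ _ _ _ (cst 0) (fun N => series v N ^+ 2 - series (conv2 v) N)).
  - by apply: nearW => N; rewrite normr_ge0 /=; exact: B.
  - exact: cvg_cst.
  - rewrite -(subrr (limn (series v) ^+ 2)); apply: cvgB; last exact: conv2_series_cvg.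
    by rewrite expr2; under eq_fun do rewrite expr2; exact: cvgM.
apply/eqP; rewrite -subr_eq0; apply/eqP; rewrite -(cvg_lim (@Rhausdorff R) rem).
by apply/esym/cvg_lim => //; exact: cvgB.
Qed.

(** The matrix identity for matrices of size one. *)
Lemma pseries_sqr c (x : R) : csum c `|x| ->
  limn (series (fun k => c k * x ^+ k)) ^+ 2 = limn (series (fun k => conv2 c k * x ^+ k)).
Proof.
move=> cs; pose X : 'M[R]_1 := x%:M.
have XX k : (X ^+ k) 0 0 = x ^+ k.
  elim: k => [|k IH]; first by rewrite !expr0 mxE.
  by rewrite !exprS -[(X * _)%R]/(X *m _) mul_scalar_mx mxE IH.
have Xo : opnorm X <= `|x|.
  apply: opnorm_le => // v; rewrite /mxapp tr_scalar_mx mul_mx_scalar enormZ //.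
have := congr1 (fun M : 'M[R]_1 => M 0 0) (mxps_sqr Xo cs).
rewrite mxE big_ord1 !mxE.
by under eq_fun do rewrite XX; under [in RHS]eq_fun do rewrite XX; rewrite expr2.
Qed.

End Cauchy.

(** * Uniqueness by a Gronwall estimate *)

Section Gronwall.
Variable R : realType.

(** The product of [f y ^ 2] with [exp (s y)] is nondecreasing for [s = 2 M] and nonincreasing for
    [s = - 2 M]. The first carries the zero of [f] to the left of [x0], the second to the right. *)
Lemma gronwall0 (f df : R -> R) (a b M : R) :
  (forall y, a <= y <= b -> is_derive y 1 f (df y)) ->
  (forall y, a <= y <= b -> `|df y| <= M * `|f y|) ->
  forall x0 x, a <= x0 <= b -> a <= x <= b -> f x0 = 0 -> f x = 0.
Proof.
move=> fd fM.
have dg s y : a <= y <= b ->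
    is_derive y 1 (fun y => f y ^+ 2 * expR (s * y)) ((2 * f y * df y + s * f y ^+ 2) * expR (s * y)).
  move=> /fd fy; have d1 : is_derive y 1 (fun y => s * y) s.
    have := @is_deriveZ _ _ _ id s y 1 1 _; rewrite -[s *: 1]/(s * 1) mulr1.
    by apply.
  have d2 : is_derive y 1 (fun y => expR (s * y)) (expR (s * y) * s).
    exact: (@is_derive1_comp _ expR (fun y => s * y)).
  apply: is_derive_eq; rewrite /GRing.scale /=; ring.
have der s : forall y, y \in `]a, b[ -> derivable (fun y => f y ^+ 2 * expR (s * y)) y 1.
  by move=> y; rewrite in_itv /= => /andP[ay yb]; have := dg s y; rewrite !ltW // => /(_ isT)[].
have derv s y : y \in `]a, b[ -> derive1 (fun y => f y ^+ 2 * expR (s * y)) y =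
    (2 * f y * df y + s * f y ^+ 2) * expR (s * y).
  rewrite in_itv /= => /andP[ay yb]; rewrite derive1E; have := dg s y; rewrite !ltW // => /(_ isT)[_].
  by [].
have con s : {within `[a, b], continuous (fun y => f y ^+ 2 * expR (s * y))}.
  by apply: derivable_within_continuous => y; rewrite in_itv /= => /(dg s)[].
have bnd y : a <= y <= b -> `|2 * f y * df y| <= 2 * M * f y ^+ 2.
  move=> /fM h; rewrite !normrM ger0_norm // -mulrA -[X in _ <= _ * X]real_normK ?num_real // expr2.
  rewrite -!mulrA ler_wpM2l // mulrCA ler_wpM2l // mulrC.
move=> x0 x /andP[ax0 x0b] /andP[ax xb] fx0.
apply/eqP; rewrite -sqrf_eq0 eq_le sqr_ge0 andbT.
have [xx0|x0x] := leP x x0.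
- have := @ger0_derive1_ndecr _ (fun y => f y ^+ 2 * expR ((2 * M) * y)) a b (der _) _ (con _) x x0 ax xx0 x0b.
  rewrite fx0 expr0n mul0r pmulr_lle0 ?expR_gt0 //; apply => y yab; rewrite derv //.
  rewrite mulr_ge0 ?expR_ge0 //; move: yab; rewrite in_itv /= => /andP[ay yb].
  have /bnd : a <= y <= b by rewrite !ltW.
  by rewrite ler_norml => /andP[]; lra.
- have := @ler0_derive1_nincr _ (fun y => f y ^+ 2 * expR ((- (2 * M)) * y)) a b (der _) _ (con _) x0 x ax0 (ltW x0x) xb.
  rewrite fx0 expr0n mul0r pmulr_lle0 ?expR_gt0 //; apply => y yab; rewrite derv //.
  rewrite mulr_le0_ge0 ?expR_ge0 //; move: yab; rewrite in_itv /= => /andP[ay yb].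
  have /bnd : a <= y <= b by rewrite !ltW.
  by rewrite ler_norml => /andP[]; lra.
Qed.

End Gronwall.

(** * Real power series and their Taylor coefficients *)

Section PowerSeries.
Variable R : realType.
Implicit Types (c u : nat -> R) (r x : R).

Definition rad c r := forall rho, 0 <= rho < r -> csum c rho.

Lemma cvg_series_shift u : cvgn (series u) ->
  series (fun k => u k.+1) @ \oo --> limn (series u) - u 0%N.
Proof.
move=> cu; have -> : series (fun k => u k.+1) = (fun n => series u n.+1 - u 0%N).
  apply/funext => n; rewrite /series /= big_nat_recl //=.
  by rewrite addrC addKr.
by apply: cvgB; [rewrite (cvg_shiftS (series u))|exact: cvg_cst].
Qed.

Lemma rad_diffs c r : rad c r -> rad (pseries_diffs c) r.
Proof.
move=> cr rho /andP[r0 rr].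
(* Two radii above [rho]: the series converges at [t], and passing from [t] down to [s] absorbs the
   factor [k]. Moreover [s > 0] even if [rho = 0], so that [s] may be divided by. *)
pose s := (rho + r) / 2; pose t := (s + r) / 2.
have [s0 [rs [st tr]]] : 0 < s /\ rho <= s /\ s < t /\ t < r by rewrite /t /s; do !split; lra.
have ct : csum c t by apply: cr; apply/andP; split; lra.
have st' : 0 < s < t by rewrite s0.
have := csum_sqr st' ct.
set u := (fun k => _) => cu.
have c1 : cvgn (series (s^-1 *: (fun k => u k.+1))).
  by apply: is_cvg_seriesZ; apply: cvgP (cvg_series_shift cu).
apply: series_le_cvg c1 => k.
- by rewrite mulr_ge0 // exprn_ge0.
- change (0 <= s^-1 * u k.+1); rewrite /u !mulr_ge0 ?invr_ge0 ?exprn_ge0 //; exact: ltW.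
- change (`|pseries_diffs c k| * rho ^+ k <= s^-1 * u k.+1).
  rewrite /u /pseries_diffs normrM [s ^+ k.+1]exprS normr_nat.
  have -> : s^-1 * (`|c k.+1| * (k.+1%:R ^+ 2 * (s * s ^+ k))) =
     (k.+1%:R * `|c k.+1|) * (k.+1%:R * s ^+ k) by field; rewrite gt_eqF.
  rewrite ler_wpM2l ?mulr_ge0 //.
  apply: (@le_trans _ _ (s ^+ k)); first by rewrite lerXn2r // nnegrE // ltW.
  by rewrite ler_peMl ?exprn_ge0 ?ler1n // ltW.
Qed.

Lemma csum_pseries c x : csum c `|x| -> cvgn (pseries c x).
Proof.
move=> cs; apply: (lim_series_abs_le cs _).1 => k.
by rewrite normrM normrX.
Qed.

Lemma pseries_is_derive c r x : rad c r -> `|x| < r ->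
  is_derive x 1 (fun x => limn (pseries c x)) (limn (pseries (pseries_diffs c) x)).
Proof.
move=> cr xr; have xr0 := normr_ge0 x.
pose K := (`|x| + r) / 2.
have K0 : 0 <= K by rewrite /K; lra.
have H c' : rad c' r -> cvgn (pseries c' K).
  by move=> cr'; apply/csum_pseries/cr'; rewrite ger0_norm // /K; apply/andP; split; lra.
apply: (@pseries_snd_diffs _ _ K).
- exact: H.
- exact/H/rad_diffs.
- exact/H/rad_diffs/rad_diffs.
- by rewrite (ger0_norm K0) /K; lra.
Qed.

(** The Euler operator [x d/dx] multiplies the coefficient of degree [k] by [k]; written with it,
    the Riccati equation becomes a recurrence without index shift. *)
Lemma mul_pseries_diffs c r x : rad c r -> `|x| < r ->
  x * limn (pseries (pseries_diffs c) x) = limn (series (fun k => k%:R * c k * x ^+ k)).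
Proof.
move=> cr xr.
have cd : cvgn (pseries (pseries_diffs c) x).
  by apply/csum_pseries/(rad_diffs cr); rewrite normr_ge0.
rewrite -[x * _]/(x *: _) -lim_seriesZ //; apply/esym/cvg_lim => //.
rewrite -(cvg_shiftS (series _)).
rewrite (_ : (fun n => _ n.+1) = series (x *: (fun i => pseries_diffs c i * x ^+ i))).
  have H : cvgn (series (x *: (fun i => pseries_diffs c i * x ^+ i))) by exact: is_cvg_seriesZ.
  exact: H.
apply/funext => n; rewrite /series /= big_nat_recl // !mul0r add0r.
apply: eq_bigr => k _; rewrite -[RHS]/(x * (_ * _)) /pseries_diffs exprS; ring.
Qed.

Lemma pseries0 c : limn (pseries c 0) = c 0%N.
Proof.
apply/cvg_lim => //; rewrite -(cvg_shiftS (pseries c 0)).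
rewrite (_ : (fun n => _ n.+1) = cst (c 0%N)); first exact: cvg_cst.
apply/funext => n; rewrite /pseries /series /= big_nat_recl // expr0 mulr1.
by rewrite big1 ?addr0 // => k _; rewrite expr0n mulr0.
Qed.

(** Gives access to [zcot_coef], which is defined by iterated derivatives at zero: a power series
    representation near zero determines them. *)
Lemma derive1n_pseries0 c r f : 0 < r -> rad c r ->
  (forall x, `|x| < r -> f x = limn (pseries c x)) ->
  forall n, derive1n n f 0 = n`!%:R * c n.
Proof.
move=> r0 cr fE n.
have dn : rad (iter n (@pseries_diffs R) c) r by elim: n => //= n; exact: rad_diffs.
have nE x : `|x| < r -> derive1n n f x = limn (pseries (iter n (@pseries_diffs R) c) x).
  elim: n dn x => [_|n IH dn] x xr; first exact: fE.
  have dn' : rad (iter n (@pseries_diffs R) c) r.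
    by elim: {IH dn} n => //= n; exact: rad_diffs.
  rewrite derive1nS derive1E.
  have [_ <-] := pseries_is_derive dn' xr.
  apply: (@derive_eq_on _ _ [set y : R | `|y| < r]) => //=; last by move=> y; exact: IH.
  have -> : [set y : R | `|y| < r] = ball (0 : R) r.
    by apply/seteqP; split=> y /=; rewrite -ball_normE /= sub0r normrN.
  exact: ball_open.
rewrite nE ?normr0 //.
rewrite pseries0.
have {nE dn}: forall k, iter n (@pseries_diffs R) c k * k`!%:R = (n + k)`!%:R * c (n + k)%N.
  elim: n {dn nE} => [|n IH] k /=; first by rewrite mulrC.
  by rewrite /pseries_diffs mulrAC -natrM -factS mulrC IH addnS.
by move/(_ 0%N); rewrite mulr1 addn0.
Qed.

(** Coefficients in [z] of the series whose coefficients in [z ^ 2] are [u]. *)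
Definition interleave0 u n := if odd n then 0 else u n./2.

Lemma series_interleave0 u n : series (interleave0 u) n = series u (uphalf n).
Proof.
elim: n => [|n IH]; first by rewrite /series /= !big_nil.
have -> : uphalf n.+1 = n./2.+1 by [].
rewrite !seriesSr IH /interleave0 uphalf_half; case: ifP => on.
  by rewrite addr0 add1n seriesSr.
by rewrite add0n.
Qed.

Lemma cvg_interleave0 u (l : R) : series u @ \oo --> l -> series (interleave0 u) @ \oo --> l.
Proof.
move=> cu; rewrite (_ : series _ = series u \o uphalf); last first.
  by apply/funext => n; rewrite series_interleave0.
apply: cvg_comp cu; move=> P [N _ NP]; exists N.*2 => // n /= Nn.
by apply: NP => /=; lia.
Qed.

Lemma csum_interleave0 u r : 0 <= r -> csum u (r ^+ 2) -> csum (interleave0 u) r.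
Proof.
move=> r0 cs; have /cvg_interleave0 := cs.
rewrite (_ : interleave0 _ = fun k => `|interleave0 u k| * r ^+ k); first by move=> /cvgP.
apply/funext => k; rewrite /interleave0; case: ifPn => ok; first by rewrite normr0 mul0r.
by rewrite -exprM mul2n even_halfK.
Qed.

End PowerSeries.

(** * Coefficients and radius of convergence of z cot z *)

Section Zcot.
Variable R : realType.
Implicit Types (y z : R).

(* z cot z = 1 - \sum_k bz k z^(2k): the Riccati equation satisfied by z cot z
   becomes the recurrence bz_rec, which shows that these coefficients are nonnegative. *)
Fixpoint bz_seq n : seq R :=
  if n is n'.+1 then
    rcons (bz_seq n') (((n' == 1%N)%:R + \sum_(i < n') (bz_seq n')`_i * (bz_seq n')`_(n' - i))
      / n'.*2.+1%:R)
  else [::].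

Definition bz n : R := (bz_seq n.+1)`_n.

Lemma size_bz_seq n : size (bz_seq n) = n.
Proof. by elim: n => //= n IH; rewrite size_rcons IH. Qed.

Lemma nth_bz_seq n i : (i < n)%N -> (bz_seq n)`_i = bz i.
Proof.
elim: n => // n IH; rewrite ltnS leq_eqVlt => /orP[/eqP ->|ltin] //.
by rewrite /= nth_rcons size_bz_seq ltin IH.
Qed.

Lemma natr_double1 n : n.*2.+1%:R = 2 * n%:R + 1 :> R.
Proof. by rewrite -natr1 -muln2 natrM mulrC. Qed.

Lemma bz0 : bz 0 = 0.
Proof. by rewrite /bz /= big_ord0 addr0 mul0r. Qed.

(** Since [bz 0 = 0], the two end terms of the convolution vanish. So only smaller indices occur on
    the right for [n > 0], which justifies the recursion in [bz_seq] and gives nonnegativity by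
    induction. *)
Lemma bz_rec n : n.*2.+1%:R * bz n = (n == 1%N)%:R + conv2 bz n.
Proof.
rewrite {1}/bz /= nth_rcons size_bz_seq ltnn eqxx mulrC divfK ?pnatr_eq0 //.
congr (_ + _); rewrite /conv2 big_ord_recr /= subnn bz0 mulr0 addr0.
apply: eq_bigr => i _; rewrite nth_bz_seq //.
have [i0|i0] := posnP i; first by rewrite i0 bz0 !mul0r.
by rewrite nth_bz_seq // ltn_subrL i0 (leq_ltn_trans _ (ltn_ord i)).
Qed.

Lemma bz_ge0 n : 0 <= bz n.
Proof.
elim/ltn_ind: n => n IH; rewrite -(@pmulr_rge0 _ (n.*2.+1%:R)) ?ltr0n // bz_rec.
rewrite addr_ge0 // /conv2 big_ord_recr /= subnn bz0 mulr0 addr0.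
apply: sumr_ge0 => i _; have [i0|i0] := posnP i; first by rewrite i0 bz0 mul0r.
by apply: mulr_ge0; apply: IH => //; rewrite ltn_subrL i0 (leq_ltn_trans _ (ltn_ord i)).
Qed.

Definition Gz N : {poly R} := \sum_(k < N) bz k *: 'X^(k.*2).
(** Chosen so that [z Q' = G] for the polynomials [Q = Qz N] and [G = Gz N]: then [exp (- Q)] is the
    integrating factor in [Gz_bound]. *)
Definition Qz N : {poly R} := \sum_(k < N) (bz k / k.*2%:R) *: 'X^(k.*2).

Lemma mulX_deriv_even (c : nat -> R) N :
  'X * (\sum_(k < N) c k *: 'X^(k.*2))^`() = \sum_(k < N) (k.*2%:R * c k) *: 'X^(k.*2).
Proof.
rewrite raddf_sum mulr_sumr; apply: eq_bigr => k _ /=.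
rewrite derivZ derivXn -scalerAr; case: (nat_of_ord k) => [|i].
  by rewrite /= mulr0n mulr0 mul0r scaler0 scale0r.
by rewrite mulrnAr -exprS -scaler_nat scalerA mulrC prednK.
Qed.

Lemma horner_even (c : nat -> R) N z :
  (\sum_(k < N) c k *: 'X^(k.*2)).[z] = \sum_(k < N) c k * (z ^+ 2) ^+ k.
Proof.
rewrite horner_sum; apply: eq_bigr => k _.
by rewrite hornerZ hornerXn -exprM mul2n.
Qed.

Lemma conv2_scale (c : nat -> R) y k : conv2 (fun k => c k * y ^+ k) k = conv2 c k * y ^+ k.
Proof.
rewrite /conv2 mulr_suml; apply: eq_bigr => i _; rewrite mulrACA -exprD subnKC //.
by rewrite -ltnS.
Qed.

Lemma conv2_partial_le (u : nat -> R) N : (forall k, 0 <= u k) ->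
  \sum_(k < N) conv2 u k <= (\sum_(k < N) u k) ^+ 2.
Proof.
move=> u0; rewrite expr2 mulr_suml; under [leRHS]eq_bigr do rewrite mulr_sumr.
rewrite (sum_square_split (fun i j => u i * u j)) lerDl.
by apply: sumr_ge0 => i _; apply: sumr_ge0 => j _; exact: mulr_ge0.
Qed.

(** The full series satisfies this with equality. After truncation the left side keeps only part of
    the nonnegative terms of [z ^ 2 + G ^ 2], hence the inequality. *)
Lemma Gz_riccati N z : z * (Gz N)^`().[z] <= z ^+ 2 + (Gz N).[z] ^+ 2 - (Gz N).[z].
Proof.
have -> : z * (Gz N)^`().[z] = \sum_(k < N) (k.*2%:R * bz k) * (z ^+ 2) ^+ k.
  by rewrite -(horner_even (fun k => k.*2%:R * bz k)) -mulX_deriv_even hornerM hornerX.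
rewrite /Gz horner_even; set y := z ^+ 2; have y0 : 0 <= y by exact: sqr_ge0.
have -> : \sum_(k < N) (k.*2%:R * bz k) * y ^+ k =
   \sum_(k < N) ((k == 1%N :> nat)%:R * y ^+ k) + \sum_(k < N) conv2 (fun k => bz k * y ^+ k) k
   - \sum_(k < N) bz k * y ^+ k.
  rewrite -big_split -sumrB; apply: eq_bigr => k _ /=; rewrite conv2_scale.
  rewrite -mulrDl -bz_rec -mulrBl natr_double1 -muln2 natrM; ring.
rewrite lerD2r lerD //; last first.
  by apply: conv2_partial_le => k; rewrite mulr_ge0 ?bz_ge0 ?(exprn_ge0 _ y0).
have [N1|N1] := leqP N 1.
  rewrite big1 // => k _; rewrite (_ : (k == 1%N :> nat) = false) ?mul0r //.
  by apply/eqP => k1; have := ltn_ord k; rewrite k1; lia.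
rewrite (bigD1 (Ordinal N1)) //= mul1r big1 ?addr0 // => k kn.
rewrite (_ : (k == 1%N :> nat) = false) ?mul0r //; apply/negbTE.
by apply: contraNneq kn => k1; apply/eqP/val_inj.
Qed.

(** Comparison principle: multiplied by [exp (- Qz)], the difference of the two sides vanishes at
    zero and is nondecreasing by [Gz_riccati]. This bounds the partial sums by [1 - z cot z],
    uniformly in [N] and on the whole interval up to pi, and so gives convergence there. *)
Lemma Gz_bound N z : 0 < z < pi -> (Gz N).[z] * sin z <= sin z - z * cos z.
Proof.
move=> /andP[z0 zp].
pose f z := (sin z * (1 - (Gz N).[z]) - z * cos z) * expR (- (Qz N).[z]).
pose df z := (cos z * (1 - (Gz N).[z]) - sin z * (Gz N)^`().[z] - cos z + z * sin z
  - (sin z * (1 - (Gz N).[z]) - z * cos z) * (Qz N)^`().[z]) * expR (- (Qz N).[z]).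
have fd (x : R) : is_derive x (1 : R) f (df x).
  have d2 : is_derive x 1 (fun y => expR (- (Qz N).[y])) (expR (- (Qz N).[x]) * (- (Qz N)^`().[x])).
    exact: (@is_derive1_comp _ expR (fun y => - (Qz N).[y])).
  rewrite /f /df; apply: is_derive_eq; rewrite /GRing.scale /=; ring.
have QG (x : R) : x * (Qz N)^`().[x] = (Gz N).[x].
  rewrite -{1}(hornerX x) -hornerM /Qz (mulX_deriv_even (fun k => bz k / k.*2%:R)) /Gz; congr (_.[x]).
  apply: eq_bigr => k _; congr (_ *: _); rewrite mulrC; case: (nat_of_ord k) => [|i].
    by rewrite bz0 !mul0r.
  by rewrite divfK // pnatr_eq0.
have df0 (x : R) : 0 < x < pi -> 0 <= df x.
  move=> /andP[x0 xp]; rewrite mulr_ge0 ?expR_ge0 // -(pmulr_rge0 _ x0).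
  have s0 : 0 <= sin x by apply: sin_ge0_pi; rewrite !ltW.
  have := Gz_riccati N x; rewrite -subr_ge0 => /(mulr_ge0 s0).
  rewrite [X in _ -> 0 <= X](_ : _ =
    sin x * (x ^+ 2 + (Gz N).[x] ^+ 2 - (Gz N).[x] - x * (Gz N)^`().[x])) //.
  rewrite -QG; ring.
have fc : {within `[0, pi], continuous f}.
  by apply: derivable_within_continuous => x _; case: (fd x).
have f0 : f 0 = 0 by rewrite /f sin0 !mul0r subrr mul0r.
have H1 (x : R) : x \in `]0, pi[ -> derivable f x 1 by case: (fd x).
have H2 (x : R) : x \in `]0, pi[ -> 0 <= derive1 f x.
  by rewrite in_itv /= derive1E => /df0; case: (fd x) => _ ->.
have := ger0_derive1_ndecr H1 H2 fc (lexx _) (ltW z0) (ltW zp).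
rewrite f0 /f pmulr_lge0 ?expR_gt0 //; lra.
Qed.

Lemma csum_bz z : 0 <= z < pi -> csum bz (z ^+ 2).
Proof.
move=> /andP[z0 zp]; pose z1 := (z + pi) / 2; have pi0 := pi_gt0 R.
have [z10 [zz1 z1p]] : 0 < z1 /\ z <= z1 /\ z1 < pi by rewrite /z1; do !split; lra.
have s1 : 0 < sin z1 by apply: sin_gt0_pi; rewrite z10.
suff : csum bz (z1 ^+ 2) by apply: csum_le; rewrite sqr_ge0 lerXn2r // nnegrE ltW.
apply: nondecreasing_is_cvgn.
  by apply: nondecreasing_series => k _ _; rewrite mulr_ge0 // exprn_ge0 // sqr_ge0.
exists ((sin z1 - z1 * cos z1) / sin z1) => _ [N _ <-].
rewrite ler_pdivlMr //; apply: le_trans (Gz_bound N _); last by rewrite z10.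
rewrite /Gz horner_even /series /= big_mkord ler_wpM2r ?(ltW s1) //.
by apply: ler_sum => k _; rewrite ger0_norm ?bz_ge0.
Qed.

Lemma rad_bz : rad bz (pi ^+ 2).
Proof.
move=> rho /andP[r0 rp]; rewrite -(sqr_sqrtr r0); apply: csum_bz.
by rewrite sqrtr_ge0 /= -(@ltr_pXn2r _ 2) ?nnegrE ?sqrtr_ge0 ?pi_ge0 // sqr_sqrtr.
Qed.

(** Represents [1 - z cot z] in the variable [y = z ^ 2]. *)
Definition hz y : R := limn (pseries bz y).

Lemma pi_gt1 : 1 < pi :> R.
Proof. by apply: lt_le_trans (pi_ge2 R); rewrite ltr1n. Qed.

(** The recurrence [bz_rec] read as a differential equation. The factor 2 appears because the Euler
    operator in [z] is twice the one in [y = z ^ 2]. *)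
Lemma hz_riccati y : `|y| < pi ^+ 2 ->
  2 * (y * limn (pseries (pseries_diffs bz) y)) = y + hz y ^+ 2 - hz y.
Proof.
move=> yp; rewrite (mul_pseries_diffs rad_bz yp).
have cs : csum bz `|y| by apply: rad_bz; rewrite normr_ge0.
rewrite /hz pseries_sqr //.
have cb : cvgn (pseries bz y) := csum_pseries cs.
have cc : cvgn (pseries (conv2 bz) y) by apply/csum_pseries/csum_conv2.
pose e1 : nat -> R := fun k => (k == 1%N)%:R * y ^+ k.
have ce1 : series e1 @ \oo --> y.
  rewrite -(cvg_shiftS (series e1)) -(cvg_shiftS (fun n => series e1 n.+1)).
  rewrite (_ : (fun n => _ n.+2) = cst y); first exact: cvg_cst.
  apply/funext => n; rewrite /series /= big_nat_recl // big_nat_recl // /e1 /= mul0r add0r.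
  by rewrite mul1r expr1 big1 ?addr0 // => i _; rewrite mul0r.
rewrite -{2}(cvg_lim _ ce1) //.
have ce1' := cvgP _ ce1.
rewrite -lim_seriesD // -lim_seriesB //; last exact: is_cvg_seriesD.
have ck : cvgn (series (fun k => k%:R * bz k * y ^+ k)).
  have : cvgn (series ((2^-1 : R) *: (e1 + (fun k => conv2 bz k * y ^+ k) - (fun k => bz k * y ^+ k)))).
    by apply: is_cvg_seriesZ; apply: is_cvg_seriesB => //; exact: is_cvg_seriesD.
  rewrite (_ : _ *: _ = (fun k => k%:R * bz k * y ^+ k)) //.
  apply/funext => k; change (2^-1 * (e1 k + conv2 bz k * y ^+ k - bz k * y ^+ k) = k%:R * bz k * y ^+ k).
  rewrite /e1 -mulrDl -bz_rec -mulrBl natr_double1; by field.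
have -> : e1 + (fun k => conv2 bz k * y ^+ k) - (fun k => bz k * y ^+ k) =
    2 *: (fun k => k%:R * bz k * y ^+ k).
  apply/funext => k; change (e1 k + conv2 bz k * y ^+ k - bz k * y ^+ k = 2 * (k%:R * bz k * y ^+ k)).
  rewrite /e1 -mulrDl -bz_rec -mulrBl natr_double1; ring.
by rewrite lim_seriesZ.
Qed.

(** Every nonzero term carries [z ^ (2 k)] with [k >= 1], which is at most [|z|]. This factor [|z|]
    compensates the division by [z] in the Gronwall estimate of [zcot_hz]. *)
Lemma hz_bound z : -1 <= z <= 1 -> 0 <= hz (z ^+ 2) <= `|z| * hz 1.
Proof.
move=> z1; have nz1 : `|z| <= 1 by rewrite ler_norml.
have cs1 : cvgn (pseries bz 1).
  apply/csum_pseries/rad_bz; rewrite normr1 ler01 /= expr_gt1 ?pi_gt1 //.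
  exact: pi_ge0.
have csz : cvgn (pseries bz (z ^+ 2)).
  apply/csum_pseries/rad_bz; rewrite normr_ge0 /= normrX; apply: (@le_lt_trans _ _ 1).
    by rewrite exprn_ile1.
  by rewrite expr_gt1 ?pi_gt1 ?pi_ge0.
apply/andP; split.
  apply: limr_ge => //; apply: nearW => n; apply: sumr_ge0 => k _.
  by rewrite mulr_ge0 ?bz_ge0 // exprn_ge0 ?sqr_ge0.
rewrite /hz -[_ * _]/(`|z| *: _) -lim_seriesZ //; apply: lim_series_le => //.
  exact: is_cvg_seriesZ.
move=> k; change (bz k * (z ^+ 2) ^+ k <= `|z| * (bz k * 1 ^+ k)).
rewrite expr1n mulr1 mulrC; case: k => [|k]; first by rewrite bz0 !mulr0.
rewrite ler_wpM2r ?bz_ge0 // -exprM -[z ^+ _]ger0_norm; last first.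
  by rewrite exprM exprn_ge0 ?sqr_ge0.
by rewrite normrX mulnS add2n exprS ler_piMr // exprn_ile1.
Qed.

(** The defect [w = sin z (1 - hz (z^2)) - z cos z] satisfies [z w' = hz (z^2) w] and [w 0 = 0], so
    it vanishes by [gronwall0]. A neighbourhood of zero is enough, as only Taylor coefficients at
    zero are read off. *)
Lemma zcot_hz z : `|z| < 1 -> zcot z = 1 - hz (z ^+ 2).
Proof.
move=> nz1; have z1 : -1 <= z <= 1 by rewrite -ler_norml ltW.
pose w z := sin z * (1 - hz (z ^+ 2)) - z * cos z.
pose dw z := cos z * (1 - hz (z ^+ 2))
  - sin z * (2 * z * limn (pseries (pseries_diffs bz) (z ^+ 2))) - cos z + z * sin z.
have sq_lt (x : R) : -1 <= x <= 1 -> `|x ^+ 2| < pi ^+ 2.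
  rewrite -ler_norml => x1; rewrite normrX; apply: (@le_lt_trans _ _ 1).
    by rewrite exprn_ile1.
  by rewrite expr_gt1 ?pi_gt1 ?pi_ge0.
have wd (x : R) : -1 <= x <= 1 -> is_derive x 1 w (dw x).
  move=> /sq_lt xp; have dh := pseries_is_derive rad_bz xp.
  have d2 : is_derive x 1 (fun y => hz (y ^+ 2))
      (limn (pseries (pseries_diffs bz) (x ^+ 2)) * (2 * x)).
    apply: (@is_derive1_comp _ hz (fun y => y ^+ 2)).
    by apply: is_derive_eq; rewrite /GRing.scale /=; ring.
  by rewrite /w /dw; apply: is_derive_eq; rewrite /GRing.scale /=; ring.
have wM (x : R) : -1 <= x <= 1 -> `|dw x| <= hz 1 * `|w x|.
  move=> x1; have hb := hz_bound x1.
  have [x0|x0] := eqVneq x 0.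
    have h0 : hz (0 ^+ 2) = 0.
      move: hb; rewrite x0 normr0 mul0r => /andP[h0 h1].
      by apply/eqP; rewrite eq_le h1.
    rewrite /dw /w x0 h0 sin0 cos0 !mul0r !subr0 !mul1r !addr0 subrr normr0.
    by rewrite mulr0.
  rewrite -(@ler_pM2l _ `|x|) ?normr_gt0 // -normrM.
  have -> : x * dw x = hz (x ^+ 2) * w x.
    have := hz_riccati (sq_lt _ x1); rewrite /dw /w => ric.
    have -> : x * (cos x * (1 - hz (x ^+ 2)) - sin x * (2 * x * limn (pseries (pseries_diffs bz) (x ^+ 2))) -
      cos x + x * sin x) = - x * cos x * hz (x ^+ 2)
      - sin x * (2 * (x ^+ 2 * limn (pseries (pseries_diffs bz) (x ^+ 2)))) + x ^+ 2 * sin x by ring.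
    rewrite ric; ring.
  rewrite normrM mulrA ler_wpM2r // ger0_norm; first by case/andP: hb.
  by case/andP: hb.
have w0 : w 0 = 0 by rewrite /w sin0 !mul0r subrr.
have := gronwall0 wd wM _ z1 w0; rewrite lerN10 ler01 => /(_ isT) wz.
rewrite /zcot; case: eqVneq => [z0|z0].
  have := hz_bound z1; rewrite z0 normr0 mul0r => /andP[h0 h1].
  have -> : hz (0 ^+ 2) = 0 by apply/eqP; rewrite eq_le h1.
  by rewrite subr0.
have sz : sin z != 0.
  have pz : `|z| < pi by apply: lt_trans nz1 pi_gt1.
  have [zp|zn] := ltP 0 z.
    by rewrite gt_eqF // sin_gt0_pi // zp /=; rewrite gtr0_norm in pz.
  have zn' : 0 < - z by rewrite oppr_gt0 lt_neqAle z0.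
  have := @sin_gt0_pi _ (- z); rewrite zn' /= -{1}(ltr0_norm (x:=z)) -?oppr_gt0 // => /(_ pz).
  by rewrite sinN oppr_gt0 => /lt_eqF ->.
move: wz; rewrite /w => /eqP; rewrite subr_eq0 => /eqP <-.
by rewrite mulrC mulKf.
Qed.

Definition bc k : R := (k == 0%N)%:R - bz k.

Lemma csum_bc z : 0 <= z < pi -> csum bc (z ^+ 2).
Proof.
move=> /csum_bz cs; rewrite /csum.
have c1 : cvgn (series (fun k => (k == 0%N)%:R * (z ^+ 2) ^+ k)).
  apply/cvg_ex; exists 1; rewrite -(cvg_shiftS (series _)).
  rewrite (_ : (fun n => _ n.+1) = cst 1); first exact: cvg_cst.
  apply/funext => n; rewrite /series /= big_nat_recl // mul1r expr0 big1 ?addr0 // => i _.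
  by rewrite mul0r.
have := is_cvg_seriesD c1 cs; apply: series_le_cvg => k.
- by rewrite mulr_ge0 // exprn_ge0 ?sqr_ge0.
- by apply: addr_ge0; rewrite mulr_ge0 // exprn_ge0 ?sqr_ge0.
- change (`|bc k| * (z ^+ 2) ^+ k <= (k == 0%N)%:R * (z ^+ 2) ^+ k + `|bz k| * (z ^+ 2) ^+ k).
  rewrite -mulrDl ler_wpM2r ?(exprn_ge0 _ (sqr_ge0 z)) //.
  by apply: le_trans (ler_normB _ _) _; rewrite normr_nat.
Qed.

(** The Riccati equation [z f' = f - f^2 - z^2] of [f = z cot z], written for its coefficients in
    [z ^ 2]. *)
Lemma bc_rec k : k.*2%:R * bc k = bc k - conv2 bc k - (k == 1%N)%:R.
Proof.
have -> : conv2 bc k = (k == 0%N)%:R - 2 * bz k + conv2 bz k.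
  rewrite /conv2 /bc.
  under eq_bigr do rewrite mulrBl !mulrBr.
  rewrite !sumrB big_ord_recl /= subn0 mul1r.
  rewrite big1 ?addr0; last by move=> i _; rewrite mul0r.
  rewrite [X in _ - X - _]big_ord_recl /= subn0 mul1r.
  rewrite [X in _ - (_ + X) - _]big1 ?addr0; last by move=> i _; rewrite mul0r.
  rewrite big_ord_recr /= subnn mulr1 [X in _ - (X + _ - _)]big1 ?add0r; last first.
    by move=> i _; rewrite subn_eq0 leqNgt ltn_ord mulr0.
  ring.
have kd : k.*2%:R * (k == 0%N)%:R = 0 :> R by case: k => [|k]; rewrite ?mul0r ?mulr0.
have := bz_rec k; rewrite /bc mulrBr kd -natr1; lra.
Qed.

(** Identifies the coefficients in the definition of [UcotU], which are derivatives at zero, with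
    those given by the recurrence. *)
Lemma zcot_coefE n : zcot_coef R n = interleave0 bc n.
Proof.
rewrite /zcot_coef (@derive1n_pseries0 _ (interleave0 bc) 1) //.
- by rewrite mulrC mulKf // pnatr_eq0 -lt0n fact_gt0.
- move=> rho /andP[r0 r1]; apply: csum_interleave0 => //; apply: csum_bc.
  by rewrite r0 (lt_trans r1) // pi_gt1.
- move=> x x1; rewrite zcot_hz //.
  have cb : cvgn (pseries bz (x ^+ 2)).
    apply/csum_pseries; rewrite normrX; apply: csum_bz.
    by rewrite normr_ge0 (lt_trans x1) // pi_gt1.
  apply/esym/cvg_lim => //.
  rewrite (_ : pseries _ _ = series (interleave0 (fun k => bc k * (x ^+ 2) ^+ k))); last first.
    apply/funext => k; rewrite /pseries /series /=; apply: eq_bigr => i _.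
    rewrite /interleave0; case: ifPn => oi; first by rewrite mul0r.
    by rewrite -exprM mul2n even_halfK.
  apply: cvg_interleave0.
  rewrite (_ : series _ = (fun n => series (fun k => (k == 0%N)%:R * (x ^+ 2) ^+ k) n - pseries bz (x ^+ 2) n)); last first.
    apply/funext => k; rewrite /pseries /series /= -sumrB; apply: eq_bigr => i _.
    by rewrite -mulrBl.
  apply: cvgB => //; rewrite -(cvg_shiftS (series _)).
  rewrite (_ : (fun n => _ n.+1) = cst 1); first exact: cvg_cst.
  apply/funext => k; rewrite /series /= big_nat_recl // mul1r expr0 big1 ?addr0 // => i _.
  by rewrite mul0r.
Qed.

End Zcot.

(** * The matrix function U cot U *)

Section MatrixSeries.
Variable R : realType.

Lemma cvg_mx (T : Type) (F : set_system T) (FF : Filter F) m n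
    (f : T -> 'M[R]_(m, n)) (M : 'M[R]_(m, n)) :
  (forall i j, f x i j @[x --> F] --> M i j) -> f @ F --> M.
Proof.
move=> fM; apply/cvgrPdist_lt => e e0.
have : \forall x \near F, forall ij : 'I_m * 'I_n, `|M ij.1 ij.2 - f x ij.1 ij.2| < e.
  by apply: filter_forall => -[i j]; move/cvgrPdist_lt : (fM i j) => /(_ e e0).
apply: filterS => x fx; apply: mx_norm_lt => // i j.
by have := fx (i, j); rewrite !mxE.
Qed.

Lemma mxps_tr c n (X : 'M[R]_n) : X^T = X -> (mxps c X)^T = mxps c X.
Proof.
move=> XX; have Xk k : (X ^+ k)^T = X ^+ k.
  elim: k => [|k IH]; first by rewrite expr0 trmx1.
  by rewrite exprS -[(X * _)%R]/(X *m _) trmx_mul XX IH -[_ *m X]/(_ * X)%R -exprSr exprS.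
apply/matrixP => i j; rewrite !mxE; congr (limn (series _)); apply/funext => k.
by rewrite -[in RHS]Xk mxE.
Qed.

Lemma mxps_comm c n (X Y : 'M[R]_n) rho : opnorm X <= rho -> csum c rho ->
  X *m Y = Y *m X -> mxps c X *m Y = Y *m mxps c X.
Proof.
move=> Xr cs XY; have Xk k : X ^+ k *m Y = Y *m X ^+ k.
  elim: k => [|k IH]; first by rewrite expr0 mul1mx mulmx1.
  by rewrite exprS -[(X * _)%R]/(X *m _) -mulmxA IH !mulmxA XY.
have cv i j := mxps_cvg Xr cs i j.
apply/matrixP => i j.
have c1 : series (fun k => c k * (X ^+ k *m Y) i j) @ \oo --> (mxps c X *m Y) i j.
  rewrite mxE (_ : series _ = fun N => \sum_l series (fun k => c k * (X ^+ k) i l) N * Y l j).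
    apply: cvg_sumr => l; apply: cvgM; last exact: cvg_cst.
    by rewrite mxE; exact: cv.
  apply/funext => N; rewrite /series /=; under [RHS]eq_bigr do rewrite mulr_suml.
  rewrite exchange_big /=; apply: eq_bigr => k _; rewrite mxE mulr_sumr.
  by apply: eq_bigr => l _; rewrite mulrA.
have c2 : series (fun k => c k * (X ^+ k *m Y) i j) @ \oo --> (Y *m mxps c X) i j.
  rewrite mxE (_ : series _ = fun N => \sum_l Y i l * series (fun k => c k * (X ^+ k) l j) N).
    apply: cvg_sumr => l; apply: cvgM; first exact: cvg_cst.
    by rewrite mxE; exact: cv.
  apply/funext => N; rewrite /series /=; under [RHS]eq_bigr do rewrite mulr_sumr.
  rewrite exchange_big /=; apply: eq_bigr => k _; rewrite Xk mxE mulr_sumr.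
  by apply: eq_bigr => l _; rewrite mulrCA.
by rewrite -(cvg_lim (@Rhausdorff R) c1) (cvg_lim (@Rhausdorff R) c2).
Qed.

Lemma is_derive_curve (V : normedModType R) (f : V -> R) (g : R -> V) (r : R) (v : V) :
  differentiable f (g r) -> is_derive r (1 : R) g v ->
  is_derive r (1 : R) (fun s => f (g s)) ('D_v f (g r)).
Proof.
move=> df [dg <-]; have dg' := (derivable1_diffP _ _).1 dg.
have dfg : differentiable (f \o g) r by exact: differentiable_comp.
apply: DeriveDef; first exact: diff_derivable.
rewrite -[LHS]/('D_1 (f \o g) r) deriveE // diff_comp // /= !deriveE //.
Qed.

End MatrixSeries.

Section UcotU.
Variables (R : realType) (q m : nat) (U : 'I_m -> 'M[R]_q).
Hypothesis sU : forall j, skew_sym (U j).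
Local Notation Om := (Omega_star U).
Local Notation A := (Amat U).
Local Notation C := (UcotU U).

(** This is [U(tau) ^ 2], because [U(tau) = i A(tau)]; the series of z cot z being even, no complex
    matrix is needed. *)
Let negA2 tau := - (A tau *m A tau).

Let opB tau : Om tau -> exists2 z : R, 0 <= z < pi & opnorm (negA2 tau) <= z ^+ 2.
Proof.
move=> ot; exists (opnorm (A tau)); first by rewrite opnorm_ge0.
rewrite /negA2 -scaleN1r opnormZ normrN1 mul1r expr2; exact: opnormM.
Qed.

(* [al] are the Taylor coefficients of z coth z, so that UcotU = A coth A *)
Definition al : nat -> R := interleave0 (fun k => (-1) ^+ k * bc R k).

Lemma csum_al rho : 0 <= rho < pi -> csum al rho.
Proof.
move=> /[dup] /andP[r0 _] rp; apply: csum_interleave0 => //; rewrite /csum.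
have -> : (fun k => `|(-1) ^+ k * bc R k| * (rho ^+ 2) ^+ k) = (fun k => `|bc R k| * (rho ^+ 2) ^+ k).
  by apply/funext => k; rewrite normrM normrX normrN1 expr1n mul1r.
exact: csum_bc.
Qed.

Let negA2X tau k : negA2 tau ^+ k = (-1) ^+ k *: A tau ^+ k.*2.
Proof.
rewrite /negA2 -[A tau *m A tau]/(A tau * A tau)%R -expr2 -mul2n exprM.
move: (A tau ^+ 2) => Y; elim: k => [|k IH]; first by rewrite !expr0 scale1r.
by rewrite exprS IH -[(_ * _)%R]/(- Y *m _) mulNmx -scalemxAr -[Y *m _]/(Y * _)%R -exprS [in RHS]exprS mulN1r scaleNr.
Qed.

Let bc_limit tau i j : Om tau ->
  series (fun k => bc R k * (negA2 tau ^+ k) i j) @ \oo --> mxps (bc R) (negA2 tau) i j.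
Proof.
move=> /opB[z zp oz]; have := mxps_cvg oz (csum_bc zp) i j.
by rewrite [mxps _ _ _ _]mxE.
Qed.

(** The form in powers of [U(tau) ^ 2], from which symmetry, commutation and the square of [C] are
    read off. *)
Lemma UcotU_bc tau : Om tau -> C tau = mxps (bc R) (negA2 tau).
Proof.
move=> ot; apply/cvg_lim; first exact: norm_hausdorff.
apply: cvg_mx => i j; have := @bc_limit tau i j ot.
rewrite (_ : series (fun k => bc R k * _) =
  fun N => series (fun n => (zcot_coef R n.*2 * (-1) ^+ n) *: A tau ^+ n.*2) N i j) //.
apply/funext => N; rewrite /series /= summxE; apply: eq_bigr => k _.
by rewrite negA2X zcot_coefE /interleave0 odd_double doubleK !mxE mulrA.
Qed.

(** The same series with the argument [A tau], which is linear in [tau] as differentiation by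
    [mxps_is_diff] requires. *)
Lemma UcotU_al tau : Om tau -> C tau = mxps al (A tau).
Proof.
move=> ot; rewrite UcotU_bc //; apply/matrixP => i j.
rewrite [RHS]mxE; apply/esym/cvg_lim => //.
rewrite (_ : series _ = series (interleave0 (fun k => bc R k * (negA2 tau ^+ k) i j))).
  by apply: cvg_interleave0; exact: bc_limit.
congr series; apply/funext => k; rewrite /al /interleave0; case: ifPn => ok; first by rewrite mul0r.
by rewrite negA2X mxE even_halfK // mulrCA mulrA.
Qed.

Lemma UcotU_sym tau : Om tau -> (C tau)^T = C tau.
Proof.
move=> ot; rewrite UcotU_bc // mxps_tr // /negA2 linearN /= trmx_mul.
by rewrite (Amat_skew sU) mulNmx mulmxN opprK.
Qed.

Lemma UcotU_comm tau : Om tau -> C tau *m A tau = A tau *m C tau.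
Proof.
move=> ot; rewrite UcotU_bc //; have [z zp oz] := opB ot.
by apply: (mxps_comm oz (csum_bc zp)); rewrite /negA2 mulNmx mulmxN mulmxA.
Qed.

Lemma opset_open (r : R) : open [set s | opnorm (A s) < r].
Proof.
rewrite openE => tau /= ot; have [c c0 cP] := mxl1_Amat_le U.
have d0 : 0 < (r - opnorm (A tau)) / c by rewrite divr_gt0 // subr_gt0.
apply/nbhs_ballP; exists ((r - opnorm (A tau)) / c) => //= s.
rewrite -ball_normE /= => ts.
have -> : s = tau + (s - tau) by rewrite addrCA subrr addr0.
rewrite AmatD; apply: le_lt_trans (opnormD _ _) _.
rewrite -ltrBrDl; apply: le_lt_trans (opnorm_le_l1 _) _.
by apply: le_lt_trans (cP _) _; rewrite -ltr_pdivlMl // distrC mulrC.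
Qed.

Lemma UcotU_smooth i j : smooth_on Om (fun tau => C tau i j).
Proof.
move=> vs tau ot; have pi0 := pi_gt0 R; have o0 := opnorm_ge0 (A tau).
(* [psfun] asks for a uniform norm bound strictly inside the disc of convergence. It holds on the
   sublevel set of height [r], a neighbourhood of [tau]. *)
pose r := (opnorm (A tau) + pi) / 2; pose rho := (r + pi) / 2.
have ot' : opnorm (A tau) < pi by [].
have [r0 [tr [rrho rhop]]] : 0 < r /\ opnorm (A tau) < r /\ r < rho /\ rho < pi.
  by rewrite /rho /r; do !split; lra.
apply: (@smooth_on_eq _ _ [set s | opnorm (A s) < r] (fun s => mxps al (A s) i j)) => //.
- exact: opset_open.
- by move=> s /= sr; rewrite UcotU_al // /Omega_star /=; lra.
apply: (@psfun_smooth _ _ _ al rho); first exact: opset_open.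
  by apply: csum_al; apply/andP; split; lra.
have [c c0 cP] := mxl1_Amat_le U.
exists q, A, A, c, r, 1, i, j; split.
- by move=> y h; rewrite AmatD addrC.
- by move=> k x y; rewrite AmatD AmatZ.
- by move=> h; apply: le_trans (opnorm_le_l1 _) _.
- by rewrite r0.
- by move=> y /= /ltW yr; rewrite mul1r.
Qed.

(** In the radial direction [A tau] commutes with its increment, so differentiation multiplies the
    term of degree [2 k] by [2 k], see [dpow_self]. Then [bc_rec] splits the series into those of
    [C], [C^2] and [A^2]. *)
Lemma UcotU_radial tau i j : Om tau ->
  'D_tau (fun s => C s i j) tau = (C tau - C tau *m C tau + A tau *m A tau) i j.
Proof.
move=> ot; have pi0 := pi_gt0 R; have o0 := opnorm_ge0 (A tau).
pose r := (opnorm (A tau) + pi) / 2; pose rho := (r + pi) / 2.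
have ot' : opnorm (A tau) < pi by [].
have [r0 [tr [rrho rhop]]] : 0 < r /\ opnorm (A tau) < r /\ r < rho /\ rho < pi.
  by rewrite /rho /r; do !split; lra.
rewrite (@derive_eq_on _ _ Om _ (fun s => mxps al (A s) i j)) //; last first.
- by move=> s os; rewrite UcotU_al.
- exact: Omega_open.
have [c c0 cP] := mxl1_Amat_le U.
have rr : 0 < r < rho by rewrite r0.
have Lnear : \forall s \near tau, opnorm (A s) <= r.
  by apply: filterS (open_near (@opset_open r) tr) => s /ltW.
have Laff (y h : 'rV[R]_m) : A (h + y) = A y + A h by rewrite AmatD addrC.
have Alin : linear A by move=> k x y; rewrite AmatD AmatZ.
have Ab h : opnorm (A h) <= c * `|h| by apply: le_trans (opnorm_le_l1 _) _.
have cr : csum al rho by apply: csum_al; apply/andP; split; lra.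
rewrite (is_diff_derive _ (mxps_is_diff Laff Alin Ab rr Lnear i j cr)).
have [z zp oz] := opB ot.
have z2 : 0 <= z ^+ 2 by exact: sqr_ge0.
rewrite UcotU_bc // (mxps_sqr oz (csum_bc zp)).
apply/cvg_lim => //.
rewrite (_ : series _ = series (interleave0 (fun k => (k.*2%:R * bc R k) * (negA2 tau ^+ k) i j))); last first.
  congr series; apply/funext => k; rewrite dpow_self /al /interleave0.
  case: ifPn => ok; first by rewrite mul0r.
  rewrite negA2X !mxE even_halfK //; ring.
apply: cvg_interleave0.
rewrite (_ : series _ = fun N => series (fun k => bc R k * (negA2 tau ^+ k) i j) N
   - series (fun k => conv2 (bc R) k * (negA2 tau ^+ k) i j) N
   - series (fun k => (k == 1%N)%:R * (negA2 tau ^+ k) i j) N); last first.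
  apply/funext => N; rewrite /series /= -!sumrB; apply: eq_bigr => k _.
  by rewrite bc_rec !mulrBl.
have -> : (mxps (bc R) (negA2 tau) - mxps (conv2 (bc R)) (negA2 tau) + A tau *m A tau) i j =
  mxps (bc R) (negA2 tau) i j - mxps (conv2 (bc R)) (negA2 tau) i j - negA2 tau i j.
  by rewrite /negA2 !mxE opprK.
apply: cvgB; first apply: cvgB.
- exact: bc_limit.
- have := mxps_cvg oz (csum_conv2 z2 (csum_bc zp)) i j.
  by rewrite [mxps (conv2 _) _ _ _]mxE.
- rewrite -(cvg_shiftS (series _)) -(cvg_shiftS (fun n => series _ n.+1)).
  rewrite (_ : (fun n => _ n.+2) = cst (negA2 tau i j)); first exact: cvg_cst.
  apply/funext => n; rewrite /series /= big_nat_recl // big_nat_recl //= mul0r add0r.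
  by rewrite mul1r expr1 big1 ?addr0 // => k _; rewrite mul0r.
Qed.

Definition Kmat (tau : 'rV[R]_m) (r : R) : 'M[R]_q := r^-1 *: C (r *: tau).

Lemma Kmat_riccati tau r i j : 0 < r -> Om (r *: tau) ->
  is_derive r (1 : R) (fun r => Kmat tau r i j)
    ((A tau *m A tau - Kmat tau r *m Kmat tau r) i j).
Proof.
move=> r0 ot; have rn0 : r != 0 by rewrite gt_eqF.
have df : differentiable (fun s => C s i j) (r *: tau).
  by apply: smooth_on_diff ot; exact: UcotU_smooth.
have d0 : is_derive r (1 : R) (fun s : R => s *: tau) tau.
  have dd : is_diff r (fun s : R => s *: tau) (fun s : R => s *: tau) by exact: is_diff_scalel.
  apply: DeriveDef; first by apply: diff_derivable.
  by rewrite deriveE // diff_val scale1r.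
have d1 := is_derive_curve df d0.
have rad : 'D_tau (fun s => C s i j) (r *: tau) =
    r^-1 * (C (r *: tau) - C (r *: tau) *m C (r *: tau) + A (r *: tau) *m A (r *: tau)) i j.
  rewrite -UcotU_radial // deriveE // [in RHS]deriveE // linearZ /=.
  by rewrite -[X in r^-1 * X]/(r * _) mulKf.
have d2 : is_derive r (1 : R) (fun s : R => s^-1) (- r ^- 2).
  have := @is_deriveV _ id r 1 1 rn0 _.
  by rewrite -[_ *: _]/(- _ ^- 2 * 1) mulr1; apply.
have -> : (fun r => Kmat tau r i j) = (fun s => s^-1 * C (s *: tau) i j).
  by apply/funext => s; rewrite /Kmat mxE.
apply: is_derive_eq; rewrite rad AmatZ /Kmat -!scalemxAl -!scalemxAr !scalerA.
move: (C (r *: tau) *m C (r *: tau)) (A tau *m A tau) (C (r *: tau)) => CC AA C0.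
rewrite !mxE /GRing.scale /=; field.
by rewrite rn0.
Qed.

Lemma Kmat_sym tau r : Om (r *: tau) -> (Kmat tau r)^T = Kmat tau r.
Proof. by move=> ot; rewrite /Kmat linearZ /= UcotU_sym. Qed.

Lemma Kmat_comm tau r : r != 0 -> Om (r *: tau) -> Kmat tau r *m A tau = A tau *m Kmat tau r.
Proof.
move=> r0 ot; rewrite /Kmat -scalemxAl -scalemxAr; congr (_ *: _).
have := UcotU_comm ot; rewrite AmatZ -scalemxAl -scalemxAr => /(congr1 (fun M => r^-1 *: M)).
by rewrite !scalerA mulVf // !scale1r.
Qed.

End UcotU.

(** * Absolutely continuous functions *)

Section AbsoluteContinuity.
Variable R : realType.
Implicit Types (f g : R -> R) (l : seq (R * R)).
Local Notation mu := (@lebesgue_measure R).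

(* consecutive disjoint subintervals of [0, c], listed from right to left *)
Fixpoint chain (c : R) l : Prop :=
  if l is ab :: l' then [/\ 0 <= ab.1, ab.1 <= ab.2, ab.2 <= c & chain ab.1 l'] else True.

(** Absolute continuity tested on ordered lists of intervals. Such a list grows at its head when the
    right end point moves on, which is how [gauge_chain] builds it. *)
Definition chain_ac f : Prop := forall e : R, 0 < e -> exists2 d : R, 0 < d &
  forall l, chain 1 l -> \sum_(ab <- l) (ab.2 - ab.1) < d ->
    \sum_(ab <- l) `|f ab.2 - f ab.1| < e.

Lemma chain_le c c' l : c <= c' -> chain c l -> chain c' l.
Proof.
by case: l => //= ab l cc [a0 ab' bc ?]; split=> //; exact: le_trans cc.
Qed.

Lemma chain_nth c l i : chain c l -> (i < size l)%N ->
  [/\ 0 <= (nth (0, 0) l i).1, (nth (0, 0) l i).1 <= (nth (0, 0) l i).2 &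
      (nth (0, 0) l i).2 <= c].
Proof.
elim: l c i => //= ab l IH c [|i] [a0 aab bc cl]; first by [].
rewrite ltnS => /(IH _ _ cl)[? ? h]; split=> //.
exact: le_trans h (le_trans aab bc).
Qed.

Lemma chain_disj c l i j : chain c l -> (i < j)%N -> (j < size l)%N ->
  (nth (0, 0) l j).2 <= (nth (0, 0) l i).1.
Proof.
elim: l c i j => //= ab l IH c [|i] [|j] //= [a0 aab bc cl].
  by move=> _; rewrite ltnS => /(chain_nth cl)[].
by rewrite !ltnS; exact: IH cl.
Qed.

Lemma abs_cont_chain f : abs_cont f 0 1 -> chain_ac f.
Proof.
move=> fac e /fac[d d0 dP]; exists d => // l cl sl.
have := dP (size l) (fun k => nth (0, 0) l k).
rewrite -(big_mkord xpredT (fun k => (nth (0, 0) l k).2 - (nth (0, 0) l k).1)).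
rewrite -(big_mkord xpredT (fun k => `|f (nth (0, 0) l k).2 - f (nth (0, 0) l k).1|)).
rewrite -(big_nth (0, 0) xpredT (fun ab => ab.2 - ab.1)).
rewrite -(big_nth (0, 0) xpredT (fun ab => `|f ab.2 - f ab.1|)); apply => //.
- by move=> k; have [? ? ?] := chain_nth cl (ltn_ord k).
- move=> k j; rewrite neq_ltn => /orP[kj|jk].
    by right; exact: chain_disj cl kj (ltn_ord _).
  by left; exact: chain_disj cl jk (ltn_ord _).
Qed.

(** A single domination criterion for increments; sums, products, Lipschitz functions and the
    compositions with arc length needed later all reduce to it. *)
Lemma chain_ac_dom f g h (M : R) : 0 <= M -> chain_ac f -> chain_ac g ->
  (forall a b, 0 <= a -> a <= b -> b <= 1 ->
    `|h b - h a| <= M * (`|f b - f a| + `|g b - g a|)) -> chain_ac h.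
Proof.
move=> M0 fac gac hM e e0.
have e1 : 0 < e / (2 * (M + 1)) by rewrite divr_gt0 // mulr_gt0 //; lra.
have [d1 d10 d1P] := fac _ e1; have [d2 d20 d2P] := gac _ e1.
exists (Num.min d1 d2) => [|l cl]; first by rewrite lt_min d10.
rewrite lt_min => /andP[/(d1P _ cl) l1 /(d2P _ cl) l2].
apply: (@le_lt_trans _ _ (M * (\sum_(ab <- l) `|f ab.2 - f ab.1| + \sum_(ab <- l) `|g ab.2 - g ab.1|))).
  rewrite -big_split mulr_sumr /= {l1 l2}.
  suff : forall c, c <= 1 -> chain c l -> \sum_(ab <- l) `|h ab.2 - h ab.1| <=
      \sum_(ab <- l) M * (`|f ab.2 - f ab.1| + `|g ab.2 - g ab.1|) by apply; first exact: lexx.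
  elim: l {cl} => [|ab l IH] c c1 /=; first by rewrite !big_nil.
  move=> [a0 aab bc cl]; rewrite !big_cons lerD ?hM //; first exact: le_trans c1.
  by apply: IH cl; apply: le_trans c1; exact: le_trans bc.
have S0 : 0 <= \sum_(ab <- l) `|f ab.2 - f ab.1| by apply: sumr_ge0.
set s1 := \sum_(ab <- l) _ in l1 S0 *; set s2 := \sum_(ab <- l) _ in l2 *.
apply: (@le_lt_trans _ _ (M * (e / (M + 1)))).
  rewrite ler_wpM2l //; apply: (@le_trans _ _ (e / (2 * (M + 1)) + e / (2 * (M + 1)))).
    by rewrite lerD // ltW.
  rewrite le_eqVlt; apply/orP; left; apply/eqP; field.
  by rewrite gt_eqF //; lra.
by rewrite mulrCA gtr_pMr // ltr_pdivrMr ?mul1r; lra.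
Qed.

Lemma chain_ac_id : chain_ac id.
Proof.
move=> e e0; exists e => // l cl; apply: le_lt_trans.
suff : forall c, chain c l -> \sum_(ab <- l) `|id ab.2 - id ab.1| <= \sum_(ab <- l) (ab.2 - ab.1).
  by apply; exact: cl.
elim: l {cl} => [|ab l IH] c /=; first by rewrite !big_nil.
by move=> [a0 aab bc cl]; rewrite !big_cons lerD ?(IH _ cl) // ger0_norm // subr_ge0.
Qed.

Lemma chain_ac_lip f (M : R) : 0 <= M ->
  (forall a b, 0 <= a -> a <= b -> b <= 1 -> `|f b - f a| <= M * (b - a)) -> chain_ac f.
Proof.
move=> M0 fM; apply: (chain_ac_dom M0 chain_ac_id chain_ac_id) => a b a0 ab b1.
apply: le_trans (fM a b a0 ab b1) _; rewrite ler_wpM2l // ger0_norm ?subr_ge0 //.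
by rewrite lerDl subr_ge0.
Qed.

Lemma chain_acD f g : chain_ac f -> chain_ac g -> chain_ac (fun s => f s + g s).
Proof.
move=> fac gac; apply: (chain_ac_dom ler01 fac gac) => a b _ _ _.
by rewrite mul1r opprD addrACA ler_normD.
Qed.

(** The unit interval is crossed in finitely many steps of length [d / 2], each of which changes [f]
    by less than 1. *)
Lemma chain_ac_bounded f : chain_ac f -> exists2 M : R, 0 <= M & forall s, 0 <= s <= 1 -> `|f s| <= M.
Proof.
move=> fac; have [d d0 dP] := fac 1 ltr01.
have step a b : 0 <= a -> a <= b -> b <= 1 -> b - a < d -> `|f b - f a| < 1.
  move=> a0 ab b1 bad; have := dP [:: (a, b)]; rewrite !big_seq1 /=; apply => //.
have [n nd] : exists n : nat, n%:R * (d / 2) >= 1.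
  exists (Num.bound (2 / d)).
  have h : 0 <= 2 / d by rewrite divr_ge0 // ltW.
  have := archi_boundP h; rewrite ltr_pdivrMr // => h2; lra.
have H k : forall s, 0 <= s -> s <= 1 -> s <= k%:R * (d / 2) -> `|f s| <= `|f 0| + k%:R.
  elim: k => [|k IH] s s0 s1 sk.
    have -> : s = 0 by apply/eqP; rewrite eq_le s0 andbT; move: sk; rewrite mul0r.
    by rewrite addr0.
  pose a := Num.max 0 (s - d / 2).
  have as_ : a <= s by rewrite /a ge_max s0 /= lerBlDr lerDl; lra.
  have a0 : 0 <= a by rewrite /a le_max lexx.
  have sa : s - a < d.
    have : s - d / 2 <= a by rewrite /a le_max lexx orbT.
    lra.
  have ak : a <= k%:R * (d / 2).
    rewrite /a ge_max mulr_ge0 //=; last by lra.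
    by move: sk; rewrite -natr1; lra.
  have := IH a a0 (le_trans as_ s1) ak; have := step a s a0 as_ s1 sa.
  have := ler_normD (f s - f a) (f a); rewrite subrK -natr1; lra.
exists (`|f 0| + n%:R) => [|s /andP[s0 s1]]; first by rewrite addr_ge0.
by apply: H => //; exact: le_trans s1 nd.
Qed.

Lemma chain_acM f g : chain_ac f -> chain_ac g -> chain_ac (fun s => f s * g s).
Proof.
move=> fac gac; have [M1 M10 M1P] := chain_ac_bounded fac.
have [M2 M20 M2P] := chain_ac_bounded gac.
have M0 : 0 <= M1 + M2 by rewrite addr_ge0.
apply: (chain_ac_dom M0 fac gac) => a b a0 ab b1.
have -> : f b * g b - f a * g a = (f b - f a) * g b + f a * (g b - g a) by ring.
apply: le_trans (ler_normD _ _) _; rewrite !normrM.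
have gb : `|g b| <= M2 by apply: M2P; rewrite b1 (le_trans a0).
have fa : `|f a| <= M1 by apply: M1P; rewrite a0 (le_trans ab).
have n1 := normr_ge0 (f b - f a); have n2 := normr_ge0 (g b - g a).
have := ler_wpM2l n1 gb; have := ler_wpM2r n2 fa.
have := mulr_ge0 n1 M10; have := mulr_ge0 M20 n2; lra.
Qed.

Lemma chain_ac_sum (I : Type) (r : seq I) (F : I -> R -> R) :
  (forall i, chain_ac (F i)) -> chain_ac (fun s => \sum_(i <- r) F i s).
Proof.
move=> Fac; elim: r => [|i r IH].
  apply: (@chain_ac_lip _ 0) => // a b _ _ _.
  by rewrite !big_nil subrr normr0 mul0r.
have -> : (fun s => \sum_(i <- i :: r) F i s) = (fun s => F i s + \sum_(i <- r) F i s).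
  by apply/funext => s; rewrite big_cons.
exact: chain_acD.
Qed.

(* The chain of intervals collects the steps taken across the exceptional set. *)
Lemma gauge_chain f (N O : set R) (e : R) : 0 < e -> open O -> N `<=` O ->
  (forall s, 0 <= s <= 1 -> ~ N s -> exists2 d, is_derive s (1 : R) f d & d <= 0) ->
  exists l, [/\ chain 1 l, (forall ab, ab \in l -> `[ab.1, ab.2] `<=` O) &
    f 1 - f 0 <= e + \sum_(ab <- l) `|f ab.2 - f ab.1|].
Proof.
move=> e0 oO NO fd.
pose P c l := [/\ chain c l, (forall ab, ab \in l -> `[ab.1, ab.2] `<=` O) &
  f c - f 0 <= e * c + \sum_(ab <- l) `|f ab.2 - f ab.1|].
(* Continuous induction: the end points reached by admissible chains are shown to include 1. *)
pose S := [set c : R | 0 <= c <= 1 /\ exists l, P c l].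
suff [_ [l [cl lO fl]]] : S 1 by exists l; split=> //; move: fl; rewrite mulr1.
have S0 : S 0.
  by split; [rewrite lexx ler01|exists [::]; split=> //; rewrite big_nil subrr mulr0 addr0].
have Sub : has_ubound S by exists 1 => c [/andP[]].
have hS : has_sup S by split; [exists 0|].
pose s := sup S.
have s0 : 0 <= s by apply: sup_upper_bound.
have s1 : s <= 1 by apply: sup_le_ub => [|c [/andP[]]]; first by exists 0.
(* One more step from [u] to [v] across the supremum [s]. If [s] is exceptional, the interval lies
   in [O] and joins the chain; otherwise the nonpositive derivative at [s] limits the growth of [f]
   to slope [e] on both sides. *)
have [eta eta0 loc] : exists2 eta, 0 < eta & forall u v, S u -> s - eta < u -> u <= s -> s <= v ->
    v < s + eta -> v <= 1 -> S v.
  have [Ns|nNs] := pselect (N s).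
    have /nbhs_ballP[eta /= eta0 sO] := open_near oO (NO _ Ns).
    exists eta => // u v [/andP[u0 u1] [l [cl lO fl]]] su us sv vs v1.
    split; first by rewrite (le_trans s0).
    exists ((u, v) :: l); split => /=.
    - by split=> //; exact: le_trans sv.
    - move=> ab; rewrite inE => /orP[/eqP ->|/lO //] /= w /=; rewrite in_itv /= => /andP[uw wv].
      apply: sO; rewrite -ball_normE /= ltr_norml; apply/andP; split; lra.
    - rewrite big_cons /=; have := ler_norm (f v - f u).
      have : e * u <= e * v by rewrite ler_wpM2l ?(ltW e0) // (le_trans us).
      by lra.
  have s01 : 0 <= s <= 1 by rewrite s0.
  have [d [df dv] d0] := fd s s01 nNs.
  have /derivable1_diffP/diff_bound/(_ e e0) := df.
  move=> /nbhs_ballP[eta /= eta0 etaP]; exists eta => // u v [/andP[u0 u1] [l [cl lO fl]]] su us sv vs v1.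
  have dE h : 'd f s h = h * d.
    by rewrite -dv deriveE; [rewrite -{1}[h]mulr1 -[h * 1]/(h *: 1) linearZ|exact/derivable1_diffP].
  have B h : `|h| < eta -> `|f (h + s) - f s - h * d| <= e * `|h|.
    by move=> he; rewrite -dE; apply: etaP; rewrite -ball_normE /= sub0r normrN.
  have Bv : f v - f s <= e * (v - s).
    have := B (v - s); rewrite subrK ger0_norm ?subr_ge0 // => /(_ _)/wrap[]; first by lra.
    rewrite ler_norml => /andP[_]; have : (v - s) * d <= 0 by rewrite mulr_ge0_le0 ?subr_ge0.
    lra.
  have Bu : f s - f u <= e * (s - u).
    have := B (u - s); rewrite subrK ler0_norm ?subr_le0 // => /(_ _)/wrap[]; first by lra.
    rewrite ler_norml => /andP[+ _]; have : 0 <= (u - s) * d by rewrite mulr_le0 ?subr_le0.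
    lra.
  split; first by rewrite (le_trans s0).
  by exists l; split=> //; [apply: chain_le cl; exact: le_trans sv|lra].
have [u Su us] := sup_adherent eta0 hS.
have us' : u <= s by apply: sup_upper_bound.
have su : s - eta < u by [].
have [s1'|sn1] := eqVneq s 1.
  by apply: (loc u 1 Su su us') => //; rewrite s1' ltrDl.
exfalso; have s1lt : s < 1 by rewrite lt_neqAle sn1.
pose v := Num.min 1 (s + eta / 2).
have vs : s < v by rewrite /v lt_min s1lt /= ltrDl divr_gt0.
have : S v.
  apply: (loc u v Su su us') => //; first exact: ltW.
    by rewrite /v gt_min; apply/orP; right; rewrite ltrD2l; lra.
  by rewrite /v ge_min lexx.
by move=> /(sup_upper_bound hS); rewrite leNgt vs.
Qed.

(** Cutting [O] at [c] lets the induction separate the head interval from the tail, which lies to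
    the left of it. *)
Lemma chain_length_le (O : set R) c l : measurable O -> chain c l ->
  (forall ab, ab \in l -> `[ab.1, ab.2] `<=` O) ->
  ((\sum_(ab <- l) (ab.2 - ab.1))%:E <= mu (O `&` [set` `]-oo, c]]))%E.
Proof.
move=> mO; elim: l c => [|ab l IH] c /=; first by rewrite big_nil.
move=> [a0 aab bc cl] lO; rewrite big_cons EFinD.
have := IH _ cl (fun x xl => lO x (mem_behead (s := ab :: l) xl)).
set X := (\sum_(ab <- l) _)%:E => hX.
have m1 : measurable (O `&` [set` `]-oo, ab.1]]) by apply: measurableI.
have lab : (ab.2 - ab.1)%:E = mu [set` `]ab.1, ab.2]].
  rewrite lebesgue_measure_itv /= lte_fin; case: ltP => // ba.
  by rewrite (_ : ab.2 = ab.1) ?subrr //; apply/eqP; rewrite eq_le ba.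
rewrite lab addeC; apply: le_trans (leeD hX (lexx _)) _.
rewrite -measureU //; last first.
  apply/seteqP; split => x //= [[_]]; rewrite !in_itv /= => xa /andP[ax _].
  by move: (lt_le_trans ax xa); rewrite ltxx.
apply: le_measure; rewrite ?inE //.
- by apply: measurableU.
- by apply: measurableI.
- move=> x [[Ox]|]; rewrite /= !in_itv /=.
    by move=> xa; split=> //; apply: le_trans xa (le_trans aab bc).
  move=> /andP[ax xb]; split; last exact: le_trans bc.
  by apply: (lO ab) => /=; rewrite ?mem_head // in_itv /= xb (ltW ax).
Qed.

(** By outer regularity the exceptional set lies in an open set that exceeds it in measure by less
    than the [d] of absolute continuity. Hence the increments collected by [gauge_chain] over this
    open set add up to less than [e]. *)
Lemma chain_ac_nonincreasing f (N : set R) : chain_ac f -> mu.-negligible N ->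
  (forall s, 0 <= s <= 1 -> ~ N s -> exists2 d, is_derive s (1 : R) f d & d <= 0) ->
  f 1 <= f 0.
Proof.
move=> fac [N' [mN' N'0 NN']] fd.
suff H e : 0 < e -> f 1 - f 0 <= e + e.
  rewrite -subr_le0; apply/ler_addgt0Pr => e e0; rewrite add0r.
  have := H (e / 2); rewrite -splitr; apply; by rewrite divr_gt0.
move=> e0; have [d d0 dP] := fac e e0.
have N'fin : (mu N' < +oo)%E by rewrite N'0.
have [W [oW NW muW]] := lebesgue_regularity_outer mN' N'fin d0.
have [l [cl lW fl]] := gauge_chain e0 oW (subset_trans NN' NW) fd.
apply: le_trans fl _; rewrite lerD2l; apply/ltW/dP => //.
have mO : measurable W by apply: open_measurable.
rewrite -lte_fin; apply: le_lt_trans (chain_length_le mO cl lW) _.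
apply: le_lt_trans muW.
have mON : measurable (W `\` N') by apply: measurableD.
have mOc : measurable (W `&` [set` `]-oo, (1 : R)]]) by apply: measurableI.
apply: (@le_trans _ _ (mu ((W `\` N') `|` N'))).
  apply: le_measure; rewrite ?inE //; first exact: measurableU.
  by move=> x [Ox _]; have [N'x|N'x] := pselect (N' x); [right|left].
rewrite measureU //; last by apply/seteqP; split=> x // [[]].
by rewrite -[leRHS]adde0; apply: leeD => //; rewrite le_eqVlt; apply/orP; left; apply/eqP.
Qed.

End AbsoluteContinuity.

(** * Primitives of integrable functions *)

Section Primitive.
Variable R : realType.
Local Notation mu := (@lebesgue_measure R).
Implicit Types h : R -> R.

(** The integral of a nonnegative function is a supremum over the simple functions below it, so it
    is monotone for arbitrary functions. It is applied to [curve_length], whose integrand is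
    uncontrolled on a negligible set. *)
Lemma ge0_le_integral_nonmeasurable (D : set R) (f1 f2 : R -> \bar R) :
  (forall x, D x -> 0 <= f1 x)%E -> (forall x, D x -> f1 x <= f2 x)%E ->
  (\int[mu]_(x in D) f1 x <= \int[mu]_(x in D) f2 x)%E.
Proof.
move=> f10 f12.
have f20 x : D x -> (0 <= f2 x)%E by move=> Dx; apply: le_trans (f12 x Dx); exact: f10.
rewrite !ge0_integralE //; apply: le_ereal_sup => _ [g gf <-].
exists g => // x; apply: le_trans (gf x) _; rewrite /patch; case: ifPn => // /[!inE].
exact: f12.
Qed.

Definition prim h (s : R) : R := \int[mu]_(x in [set` `]-oo, s]]) h x.

Section PrimTheory.
Variable h : R -> R.
Hypotheses (ih : mu.-integrable setT (EFin \o h)) (h0 : forall x, 0 <= h x).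

Let ihS (A : set R) : measurable A -> mu.-integrable A (EFin \o h).
Proof. by move=> mA; apply: integrableS ih. Qed.

Lemma primB a b : a <= b -> prim h b - prim h a = \int[mu]_(x in [set` `]a, b]]) h x.
Proof. by move=> ab; apply: Rintegral_itvB => //; exact: ihS. Qed.

Lemma prim_mono a b : a <= b -> prim h a <= prim h b.
Proof. by move=> ab; rewrite -subr_ge0 primB // Rintegral_ge0. Qed.

Lemma prim_ge0 s : 0 <= prim h s.
Proof. exact: Rintegral_ge0. Qed.

Lemma prim_le s : prim h s <= \int[mu]_(x in setT) h x.
Proof.
rewrite /prim Rintegral_mkcond; apply: le_Rintegral => //.
- by rewrite -restrict_EFin; apply/integrable_restrict => //; rewrite setTI; exact: ihS.
- by move=> x _; rewrite /patch; case: ifP.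
Qed.

End PrimTheory.

Lemma chain_sum_mono (V : R -> R) c l : (forall a b, a <= b -> V a <= V b) -> 0 <= c ->
  chain c l -> \sum_(ab <- l) (V ab.2 - V ab.1) <= V c - V 0.
Proof.
move=> Vm; elim: l c => [|ab l IH] c c0 /=; first by rewrite big_nil subr_ge0 Vm.
move=> [a0 aab bc cl]; rewrite big_cons; have := IH _ a0 cl; have := Vm _ _ bc; lra.
Qed.

(** The integrand is cut at height [n]: by monotone convergence the excess has integral below
    [e / 2], and the primitive of the truncated part is Lipschitz with constant [n]. *)
Lemma chain_ac_prim h : mu.-integrable setT (EFin \o h) -> (forall x, 0 <= h x) ->
  chain_ac (prim h).
Proof.
move=> ih h0 e e0.
have mh : measurable_fun setT h by apply/measurable_EFinP; case/integrableP : ih.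
pose hn n x := Num.min (h x) n%:R.
have hn0 n x : 0 <= hn n x by rewrite le_min h0 /=.
have mhn n : measurable_fun setT (hn n) by apply: measurable_minr => //; exact: measurable_cst.
have hnh n x : hn n x <= h x by rewrite ge_min lexx.
have ihn n : mu.-integrable setT (EFin \o hn n).
  have mhE : measurable_fun setT (EFin \o hn n) by exact/measurable_EFinP.
  apply: (@le_integrable _ _ _ mu setT measurableT _ (EFin \o h)) => //.
  by move=> x _ /=; rewrite lee_fin !ger0_norm.
have [n nP] : exists n, \int[mu]_(x in setT) h x - \int[mu]_(x in setT) hn n x < e / 2.
  have cv : (\int[mu]_(x in setT) (hn n x)%:E)%E @[n --> \oo] --> (\int[mu]_(x in setT) (h x)%:E)%E.
    have -> : (\int[mu]_(x in setT) (h x)%:E = \int[mu]_(x in setT) limn (fun n => (hn n x)%:E))%E.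
      apply: eq_integral => x _; apply/esym/cvg_lim => //.
      apply: cvg_near_cst; near=> n; congr EFin; rewrite /hn min_l //.
      by near: n; exact: nbhs_infty_ger.
    have mhE n : measurable_fun setT (EFin \o hn n) by exact/measurable_EFinP.
    apply: cvg_monotone_convergence => //.
    - by move=> n x _; rewrite lee_fin.
    - move=> x _ a b ab; rewrite lee_fin /hn le_min !ge_min lexx /=.
      by rewrite ler_nat ab orbT.
  have : (\int[mu]_(x in setT) (hn n x)%:E)%E @[n --> \oo] --> (\int[mu]_(x in setT) h x)%:E.
    by rewrite /Rintegral fineK //; exact: (integrable_fin_num _ ih).
  move=> /fine_cvg /cvgrPdist_lt /(_ (e / 2)); rewrite divr_gt0 // => /(_ isT)[n _ nP].
  by exists n; have := nP n (leqnn n); rewrite /= -[fine _]/(\int[mu]_(x in setT) hn n x);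
    exact/le_lt_trans/ler_norm.
have ign : mu.-integrable setT (EFin \o (fun x => h x - hn n x)).
  rewrite (_ : _ \o _ = (EFin \o h) \- (EFin \o hn n))%E; last by apply/funext.
  exact: integrableB.
have gn0 x : 0 <= h x - hn n x by rewrite subr_ge0.
pose V := prim (fun x => h x - hn n x).
have Vm a b : a <= b -> V a <= V b by exact: prim_mono.
have step a b : a <= b -> `|prim h b - prim h a| <= (V b - V a) + n%:R * (b - a).
  move=> ab; rewrite ger0_norm; last by rewrite subr_ge0; exact: prim_mono.
  rewrite /V (primB ih ab) (primB ign ab).
  have iA f : mu.-integrable setT (EFin \o f) -> mu.-integrable [set` `]a, b]] (EFin \o f).
    by move=> iff; apply: integrableS iff.
  rewrite RintegralB //; [|exact: iA|exact: iA].
  rewrite -addrA lerDl addrC subr_ge0.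
  have E : mu [set` `]a, b]] = (b - a)%:E.
    rewrite lebesgue_measure_itv /= lte_fin; case: ltP => // ba.
    by congr EFin; apply/esym/eqP; rewrite subr_eq0 eq_le ba.
  have -> : n%:R * (b - a) = \int[mu]_(x in [set` `]a, b]]) n%:R.
    by rewrite /Rintegral integral_cst //= E.
  apply: le_Rintegral => //; [exact: iA| |].
  - apply/integrableP; split; first exact/measurable_EFinP/measurable_cst.
    under eq_integral do rewrite /=.
    by rewrite integral_cst //= E -EFinM ltry.
  - by move=> x _; rewrite ge_min lexx orbT.
exists (e / (2 * (n%:R + 1))) => [|l cl sl].
  by rewrite divr_gt0 // mulr_gt0 // ltr_wpDl.
apply: (@le_lt_trans _ _ (\sum_(ab <- l) (V ab.2 - V ab.1) + n%:R * \sum_(ab <- l) (ab.2 - ab.1))).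
  rewrite mulr_sumr -big_split /= {sl}.
  have [c cl'] : exists c, chain c l by exists 1.
  elim: l c cl' {cl} => [|ab l IH] c /=; first by rewrite !big_nil.
  by move=> [a0 aab bc cl]; rewrite !big_cons lerD ?step ?(IH _ cl).
have V1 := chain_sum_mono Vm ler01 cl.
have V0 : 0 <= V 0 by exact: prim_ge0.
have V1' : V 1 < e / 2.
  by apply: le_lt_trans nP; rewrite -RintegralB //; exact: prim_le.
have S0 : 0 <= \sum_(ab <- l) (ab.2 - ab.1).
  elim: l (1 : R) cl {sl V1} => [|ab l IH] c /=; first by rewrite big_nil.
  by move=> [a0 aab bc cl]; rewrite big_cons addr_ge0 ?(IH _ cl) // subr_ge0.
have : n%:R * \sum_(ab <- l) (ab.2 - ab.1) <= e / 2.
  apply: (@le_trans _ _ ((n%:R + 1) * (e / (2 * (n%:R + 1))))).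
    by apply: ler_pM => //; [rewrite lerDl|exact: ltW].
  rewrite le_eqVlt; apply/orP; left; apply/eqP; field.
  by rewrite gt_eqF // ltr_wpDl.
lra.
Unshelve. all: by end_near. Qed.

End Primitive.

(** * Arc length *)

Section Speed.
Variables (R : realType) (q : nat) (x : R -> 'rV[R]_q).
Local Notation mu := (@lebesgue_measure R).

(** Extends a curve by constants beyond the unit interval, so that its difference quotients are
    continuous on the whole line. *)
Let clamp (s : R) : R := Num.max 0 (Num.min s 1).

Let clampP s : 0 <= clamp s <= 1.
Proof. by rewrite /clamp le_max lexx /= ge_max ler01 ge_min lexx orbT. Qed.

Let clampE s : 0 <= s <= 1 -> clamp s = s.
Proof. by move=> /andP[s0 s1]; rewrite /clamp min_l // max_r. Qed.

Let clamp_lip s t : s <= t -> clamp s <= clamp t /\ clamp t - clamp s <= t - s.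
Proof.
rewrite /clamp => st.
case: (leP s 1) => s1; case: (leP t 1) => t1; case: (leP 0 s) => s0; case: (leP 0 t) => t0;
  rewrite ?ler01 ?(max_r ler01); split; lra.
Qed.

Lemma chain_ac_clamp_continuous (f : R -> R) : chain_ac f -> continuous (fun s => f (clamp s)).
Proof.
move=> fac s; apply/cvgrPdist_lt => e /fac[d d0 dP].
have step a b : 0 <= a -> a <= b -> b <= 1 -> b - a < d -> `|f b - f a| < e.
  by move=> a0 ab b1 bad; have := dP [:: (a, b)]; rewrite !big_seq1 /=; apply.
have /andP[cs0 cs1] := clampP s.
have B : nbhs s (ball s d) by exact: nbhsx_ballx.
apply: filterS B => t; rewrite /ball /= => st.
have /andP[ct0 ct1] := clampP t.
have [/clamp_lip[cst cd]|/ltW/clamp_lip[cst cd]] := leP s t.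
  rewrite distrC; apply: step => //; apply: le_lt_trans cd _.
  by apply: le_lt_trans st; rewrite distrC ler_norm.
apply: step => //; apply: le_lt_trans cd _.
by apply: le_lt_trans st; rewrite ler_norm.
Qed.

Lemma enorm_dist n (a b : 'rV[R]_n) : `|enorm a - enorm b| <= enorm (a - b).
Proof.
rewrite ler_norml; apply/andP; split.
  have := enormD a (b - a); rewrite addrCA subrr addr0.
  by rewrite -[b - a]opprB -scaleN1r enormZ normrN1 mul1r; lra.
by have := enormD (a - b) b; rewrite subrK; lra.
Qed.

Lemma cvg_enorm (T : Type) (G : set_system T) (FG : Filter G) (f : T -> 'rV[R]_q) (a : 'rV[R]_q) :
  (forall i, f t 0 i @[t --> G] --> a 0 i) -> enorm (f t) @[t --> G] --> enorm a.
Proof.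
move=> fa; apply: (@cvg_comp _ _ _ (fun t => dotv (f t) (f t)) (@Num.sqrt R) G (nbhs (dotv a a))).
  by apply: cvg_sumr => i; apply: cvgM; exact: fa.
exact: sqrt_continuous.
Qed.

(** On the set [E], where [x] is differentiable, the speed is a limit of continuous difference
    quotients, hence measurable; finite length makes it integrable. The primitive [F] is arc length,
    and Lebesgue differentiation gives its derivative almost everywhere. The inequality [F 1 <= L]
    is the direction that a lower bound for the length uses. *)
Lemma speed_primitive (L : R) :
  (forall i, abs_cont (fun s => x s 0 i) 0 1) ->
  (\forall s \ae mu, unit_int s -> derivable x s 1) ->
  curve_length x = L%:E ->
  exists (F : R -> R) (N : set R), [/\ F 0 = 0, (forall a b, a <= b -> F a <= F b), F 1 <= L,
    chain_ac F & mu.-negligible N /\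
    forall s, 0 <= s <= 1 -> ~ N s -> is_derive s (1 : R) F (enorm (derive1 x s))].
Proof.
move=> xac [N' [mN' N'0 N'P]] xL.
pose E : set R := [set` `]0, 1[] `\` N'.
have mE : measurable E by apply: measurableD.
pose xt s := x (clamp s).
pose fn n s := \1_E s * (n.+1%:R * enorm (xt (s + n.+1%:R^-1) - xt s)).
pose h s := \1_E s * enorm (derive1 x s).
have xtc i : continuous (fun s => xt s 0 i).
  exact: (chain_ac_clamp_continuous (abs_cont_chain (xac i))).
have mfn n : measurable_fun setT (fn n).
  apply: measurable_funM; first exact: measurable_indic.
  apply: measurable_funM; first exact: measurable_cst.
  apply: continuous_measurable_fun => s; apply: cvg_enorm => i.
  rewrite !mxE; under eq_fun do rewrite !mxE.
  apply: cvgB; last exact: xtc.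
  apply: (@cvg_comp _ _ _ (fun t : R => t + n.+1%:R^-1) (fun u => xt u 0 i) (nbhs s)
    (nbhs (s + n.+1%:R^-1))); last exact: xtc.
  by apply: cvgD; [exact: cvg_id|exact: cvg_cst].
have derE s : E s -> derivable x s 1.
  move=> [/=]; rewrite in_itv /= => /andP[s0 s1] N's.
  by apply: contrapT => nd; apply/N's/N'P => /= /(_ _)/nd; apply; rewrite /unit_int /= !ltW.
have fnh s : fn ^~ s @ \oo --> h s.
  rewrite /fn /h; have [Es|nEs] := pselect (E s); last first.
    rewrite indicE memNset // mul0r; apply: cvg_near_cst; apply: nearW => n.
    by rewrite mul0r.
  apply: cvgM; first exact: cvg_cst.
  have dx := derE s Es; have /derivable1_diffP dx' := dx.
  have dE k : 'd x s k = k *: derive1 x s.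
    rewrite derive1E deriveE // -linearZ /=; congr ('d x s _).
    by rewrite -[RHS]/(k * 1) mulr1.
  apply/cvgrPdist_lt => e e0.
  have e1 : 0 < e / (q.+1)%:R by rewrite divr_gt0.
  have /nbhs_ballP[d /= d0 dP] := diff_bound dx' e1.
  have [/=] := Es; rewrite in_itv /= => /andP[s0 s1] _.
  have s1' : 0 < 1 - s by rewrite subr_gt0.
  near=> n.
  have nd : n.+1%:R^-1 < d.
    near: n; exact: near_infty_natSinv_lt (PosNum d0).
  have ns : n.+1%:R^-1 < 1 - s.
    near: n; exact: near_infty_natSinv_lt (PosNum s1').
  have n0 : 0 < n.+1%:R^-1 :> R by rewrite invr_gt0.
  have xtE : xt (s + n.+1%:R^-1) - xt s = x (n.+1%:R^-1 + s) - x s.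
    rewrite /xt !clampE ?(addrC s) //; first by rewrite !ltW.
    by rewrite addr_ge0 ?(ltW n0) ?(ltW s0) //= -lerBrDr ltW.
  have -> : n.+1%:R * enorm (xt (s + n.+1%:R^-1) - xt s) =
      enorm (n.+1%:R *: (x (n.+1%:R^-1 + s) - x s)).
    by rewrite enormZ xtE normr_nat.
  apply: le_lt_trans (enorm_dist _ _) _.
  have -> : derive1 x s - n.+1%:R *: (x (n.+1%:R^-1 + s) - x s) =
      - (n.+1%:R *: (x (n.+1%:R^-1 + s) - x s - n.+1%:R^-1 *: derive1 x s)).
    by rewrite [in RHS]scalerBr (scalerA n.+1%:R) mulfV ?gt_eqF // scale1r opprB.
  rewrite -scaleN1r scalerA enormZ mulN1r normrN normr_nat.
  have B : `|x (n.+1%:R^-1 + s) - x s - n.+1%:R^-1 *: derive1 x s| <= e / q.+1%:R * n.+1%:R^-1.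
    rewrite -dE; apply: le_trans (dP _ _) _; last by rewrite gtr0_norm.
    by rewrite -ball_normE /= sub0r normrN gtr0_norm.
  apply: (@le_lt_trans _ _ (n.+1%:R * (q%:R * (e / q.+1%:R * n.+1%:R^-1)))).
    by rewrite ler_wpM2l // (le_trans (enorm_le_norm _)) // ler_wpM2l.
  have -> : n.+1%:R * (q%:R * (e / q.+1%:R * n.+1%:R^-1)) = e * (q%:R / q.+1%:R) :> R.
    have fe (b c d' : R) (a : R) : a != 0 -> b != 0 -> a * (c * (d' / b / a)) = d' * (c / b).
      by move=> a0 b0; field; apply/andP.
    by apply: fe; rewrite pnatr_eq0.
  by rewrite gtr_pMr // ltr_pdivrMr // mul1r ltr_nat.
have mh : measurable_fun setT h.
  by apply: (@measurable_fun_cvg _ _ _ setT fn) => // s _; exact: fnh.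
have h0 s : 0 <= h s by rewrite mulr_ge0 ?enorm_ge0 // indicE.
have hL : (\int[mu]_(s in setT) (h s)%:E <= L%:E)%E.
  rewrite -xL /curve_length [leRHS]integral_mkcond; apply: ge0_le_integral_nonmeasurable.
    by move=> s _; rewrite lee_fin.
  move=> s _; rewrite /patch /h indicE; have [Es|nEs] := pselect (E s).
    rewrite (mem_set Es) mul1r; case: ifPn => // /negP; case; apply/mem_set.
    by case: Es => /=; rewrite in_itv /= => /andP[? ?] _; rewrite /unit_int /= !ltW.
  rewrite (memNset nEs) mul0r; case: ifP => _ //.
  by rewrite lee_fin enorm_ge0.
have ih : mu.-integrable setT (EFin \o h).
  apply/integrableP; split; first exact/measurable_EFinP.
  under eq_integral do rewrite /= ger0_norm //.
  exact: le_lt_trans hL (ltry _).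
have ihy y : mu.-integrable [set` `]-oo, y]] (EFin \o h) by apply: integrableS ih.
have FTC := FTC1Ny ihy (open_integrable_locally openT ih).
(* The end points join the exceptional set because [h] is cut off outside the open interval. *)
exists (prim h), (N' `|` [set 0] `|` [set 1] `|`
  ~` [set s | derivable (prim h) s 1 /\ derive1 (prim h) s = h s]); split.
- rewrite /prim (@eq_Rintegral _ _ _ _ _ (cst 0)) ?Rintegral0 //.
    by rewrite /Rintegral integral0.
  move=> s /[!inE] /=; rewrite in_itv /= => s0.
  rewrite /h indicE memNset ?mul0r // => -[/=]; rewrite in_itv /= ltNge s0.
  by [].
- exact: prim_mono.
- apply: le_trans (prim_le ih h0 1) _.
  rewrite -lee_fin /Rintegral fineK //; exact: (integrable_fin_num _ ih).
- exact: chain_ac_prim.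
- have n1 (c : R) : mu.-negligible [set c].
    by apply/negligibleP => //; exact: lebesgue_measure_set1.
  have nN' : mu.-negligible N' by exists N'; split.
  split.
    apply: negligibleU; last exact: FTC.
    by apply: negligibleU => //; apply: negligibleU.
  move=> s /andP[s0 s1] Ns.
  have [N's sn0 sn1 dP] : [/\ ~ N' s, s != 0, s != 1 &
      derivable (prim h) s 1 /\ derive1 (prim h) s = h s].
    split.
    + by move=> ?; apply: Ns; do 3 left.
    + by apply/eqP => ?; apply: Ns; do 2 left; right.
    + by apply/eqP => ?; apply: Ns; left; right.
    + by apply: contrapT => ?; apply: Ns; right.
  have Es : E s.
    by split=> //=; rewrite in_itv /= !lt_neqAle s0 s1 eq_sym sn0 sn1.
  apply: DeriveDef; first by case: dP.
  by case: dP => _; rewrite derive1E /h indicE (mem_set Es) mul1r.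
Unshelve. all: by end_near. Qed.

End Speed.

(** * Lower bound for the distance *)

Section DerivativeRules.
Variable R : realType.

Section Directional.
Variables (V : normedModType R) (s v : V).

Lemma is_derive_sumr n (F : 'I_n -> V -> R) (dF : 'I_n -> R) :
  (forall i, is_derive s v (F i) (dF i)) ->
  is_derive s v (fun t => \sum_i F i t) (\sum_i dF i).
Proof.
move=> Fd; have -> : (fun t => \sum_i F i t) = \sum_i F i.
  by apply/funext => t; rewrite fct_sumE.
exact: is_derive_sum.
Qed.

Lemma is_derive_dotv n (a b : V -> 'rV[R]_n) (da db : 'rV[R]_n) :
  (forall i, is_derive s v (fun t => a t 0 i) (da 0 i)) ->
  (forall i, is_derive s v (fun t => b t 0 i) (db 0 i)) ->
  is_derive s v (fun t => dotv (a t) (b t)) (dotv da (b s) + dotv (a s) db).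
Proof.
move=> ad bd; rewrite /dotv -big_split /=; apply: is_derive_sumr => i.
have ai := ad i; have bi := bd i.
by apply: is_derive_eq; rewrite /GRing.scale /=; ring.
Qed.

Lemma is_derive_mxapp n (M : V -> 'M[R]_n) (dM : 'M[R]_n) (x : V -> 'rV[R]_n) (dx : 'rV[R]_n) :
  (forall i j, is_derive s v (fun t => M t i j) (dM i j)) ->
  (forall i, is_derive s v (fun t => x t 0 i) (dx 0 i)) ->
  forall i, is_derive s v (fun t => mxapp (M t) (x t) 0 i)
    ((mxapp dM (x s) + mxapp (M s) dx) 0 i).
Proof.
move=> Md xd i; rewrite mxE !mxappE -big_split /=.
have -> : (fun t => mxapp (M t) (x t) 0 i) = (fun t => \sum_j M t i j * x t 0 j).
  by apply/funext => t; rewrite mxappE.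
apply: is_derive_sumr => j; have Mij := Md i j; have xj := xd j.
by apply: is_derive_eq; rewrite /GRing.scale /=; ring.
Qed.

End Directional.

Lemma derivable_bounded (f df : R -> R) (a b : R) : a <= b ->
  (forall s, a <= s <= b -> is_derive s (1 : R) f (df s)) ->
  exists2 B, 0 <= B & forall s, a <= s <= b -> `|f s| <= B.
Proof.
move=> ab fd.
have fc : {within `[a, b], continuous f}.
  by apply: derivable_within_continuous => y; rewrite in_itv /= => /fd[].
have [c1 _ c1P] := EVT_max ab fc; have [c2 _ c2P] := EVT_min ab fc.
exists (`|f c1| + `|f c2|) => [|s sab]; first by rewrite addr_ge0.
have := c1P s; have := c2P s; rewrite in_itv /= sab => /(_ isT) h2 /(_ isT) h1.
rewrite ler_norml; have := ler_norm (f c1); have := normr_ge0 (f c1); have := normr_ge0 (f c2).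
have := ler_norm (- f c2); rewrite normrN => *; apply/andP; split; lra.
Qed.

Lemma lipschitz_MVT (f df : R -> R) (a b M : R) :
  (forall s, a <= s <= b -> is_derive s (1 : R) f (df s)) ->
  (forall s, a <= s <= b -> `|df s| <= M) ->
  forall u v, a <= u -> u <= v -> v <= b -> `|f v - f u| <= M * (v - u).
Proof.
move=> fd dM u v au uv vb.
have sub s : s \in `[u, v] -> a <= s <= b.
  by rewrite in_itv /= => /andP[us sv]; rewrite (le_trans au) // (le_trans sv).
have [||c cuv ->] := @MVT_segment _ f df u v uv.
- by move=> s /subset_itv_oo_cc/sub/fd.
- by apply: derivable_within_continuous => s /sub/fd[].
- rewrite normrM (ger0_norm (x := v - u)) ?subr_ge0 // ler_wpM2r ?subr_ge0 //.
  exact/dM/sub.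
Qed.

Lemma is_derive_line (V : normedModType R) (v c : V) (s : R) :
  is_derive s (1 : R) (fun s : R => s *: v + c) v.
Proof.
have d0 : is_derive s (1 : R) (fun s : R => s *: v) v.
  have dd : is_diff s (fun s : R => s *: v) (fun s : R => s *: v) by exact: is_diff_scalel.
  apply: DeriveDef; first by apply: diff_derivable.
  by rewrite deriveE // diff_val scale1r.
by apply: is_derive_eq; rewrite addr0.
Qed.

End DerivativeRules.

Section LowerBound.
Variables (R : realType) (q m : nat) (U : 'I_m -> 'M[R]_q).
Hypothesis sU : forall j, skew_sym (U j).
Local Notation mu := (@lebesgue_measure R).

(** [Kmat] behaves like [1 / s] at zero, hence the lower end [a > 0]. *)
Lemma Kmat_bounded tau (a : R) : 0 < a <= 1 -> Omega_star U tau ->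
  exists2 S : R, 0 <= S & forall i j s, a <= s <= 1 -> `|Kmat U tau s i j| <= S.
Proof.
move=> /andP[a0 a1] ot.
have Kd i j s : a <= s <= 1 -> is_derive s (1 : R) (fun r => Kmat U tau r i j)
    ((Amat U tau *m Amat U tau - Kmat U tau s *m Kmat U tau s) i j).
  move=> /andP[as_ s1]; have s0 := lt_le_trans a0 as_.
  by apply: Kmat_riccati => //; apply: Omega_shrink => //; rewrite ltW.
have /choice[B BP] : forall ij : 'I_q * 'I_q, exists B : R, 0 <= B /\
    forall s, a <= s <= 1 -> `|Kmat U tau s ij.1 ij.2| <= B.
  by move=> [i j]; have [B B0 BP] := derivable_bounded a1 (Kd i j); exists B.
exists (\sum_ij B ij) => [|i j s sa]; first by apply: sumr_ge0 => kl _; case: (BP kl).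
apply: le_trans (_ : B (i, j) <= _); first by case: (BP (i, j)) => _; exact.
by rewrite (bigD1 (i, j)) //= lerDl sumr_ge0 // => kl _; case: (BP kl).
Qed.

Lemma Kmat_lipschitz tau (a : R) : 0 < a <= 1 -> Omega_star U tau ->
  exists2 M : R, 0 <= M & forall i j u v, a <= u -> u <= v -> v <= 1 ->
    `|Kmat U tau v i j - Kmat U tau u i j| <= M * (v - u).
Proof.
move=> a01 ot; have [S S0 SP] := Kmat_bounded a01 ot; have /andP[a0 a1] := a01.
have Kd i j s : a <= s <= 1 -> is_derive s (1 : R) (fun r => Kmat U tau r i j)
    ((Amat U tau *m Amat U tau - Kmat U tau s *m Kmat U tau s) i j).
  move=> /andP[as_ s1]; have s0 := lt_le_trans a0 as_.
  by apply: Kmat_riccati => //; apply: Omega_shrink => //; rewrite ltW.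
exists (mxl1 (Amat U tau *m Amat U tau) + q%:R * S ^+ 2) => [|i j u v].
  by rewrite addr_ge0 ?mxl1_ge0 // mulr_ge0 // sqr_ge0.
apply: lipschitz_MVT (Kd i j) _ _ _ => s as1; rewrite mxE [X in _ + X]mxE.
apply: le_trans (ler_normB _ _) _; rewrite lerD ?coord_le_mxl1 // mxE.
apply: le_trans (ler_norm_sum _ _ _) _.
apply: (@le_trans _ _ (\sum_(k < q) S ^+ 2)); last by rewrite sumr_const card_ord mulr_natl.
by apply: ler_sum => k _; rewrite normrM expr2; apply: ler_pM => //; exact: SP.
Qed.

(** Commutation makes the product of the symmetric and the skew matrix skew. *)
Lemma symm_skew_dotv0 (K A : 'M[R]_q) x : K^T = K -> skew_sym A -> K *m A = A *m K ->
  dotv (mxapp K x) (mxapp A x) = 0.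
Proof.
move=> KK sA KA; rewrite dotv_mxapp KK -mxapp_mul dotvC; apply: skew_dotv0.
by rewrite /skew_sym trmx_mul KK sA mulNmx -KA.
Qed.

(* E_r(x,t) = phi((x,t); r tau) / r solves the Hamilton-Jacobi equation
   d_r E + |grad_H E|^2 / 4 = 0, so that along a curve with r' = |x'| / Lam the function
   E_r - Lam * length is nonincreasing. *)
Lemma calibration_le (K A : 'M[R]_q) (x v : 'rV[R]_q) (Lam : R) :
  0 < Lam -> K^T = K -> skew_sym A -> K *m A = A *m K ->
  (enorm v / Lam) * dotv (mxapp (A *m A - K *m K) x) x + 2 * dotv (mxapp K x) v
  + 2 * dotv (mxapp A x) v - Lam * enorm v <= 0.
Proof.
move=> L0 KK sA KA; pose P := mxapp K x + mxapp A x.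
have -> : dotv (mxapp (A *m A - K *m K) x) x = - enorm P ^+ 2.
  have h0 : dotv (mxapp K x) (mxapp A x) = 0 by exact: symm_skew_dotv0.
  rewrite enormE /P dotvDl !dotvDr (dotvC (mxapp A x)) h0 addr0 add0r.
  rewrite mxappDm dotvDl mxappNm dotvNl !mxapp_mul (dotv_mxapp A) sA mxappNm dotvNr.
  by rewrite (dotv_mxapp K (mxapp K x)) KK; ring.
have : dotv (mxapp K x) v + dotv (mxapp A x) v <= enorm P * enorm v.
  by rewrite -dotvDl; exact: dotv_le.
set p := enorm P; set n := enorm v => h.
have n0 : 0 <= n by exact: enorm_ge0.
have : 0 <= n / Lam * (p - Lam) ^+ 2 by rewrite mulr_ge0 ?sqr_ge0 // divr_ge0 // ltW.
have -> : n / Lam * (p - Lam) ^+ 2 = n / Lam * p ^+ 2 - 2 * p * n + Lam * n.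
  by field; rewrite gt_eqF.
lra.
Qed.

(** With [r] increasing to 1 in proportion to arc length, [G] is nonincreasing by [calibration_le].
    It starts at 0 and ends at [phi U g tau - Lam * L1]; as [eps] tends to zero this becomes
    [phi U g tau <= L1 ^ 2]. *)
Lemma phi_le_length g x t tau L : horizontal_curve U g x t -> Omega_star U tau ->
  curve_length x = L%:E -> phi U g tau <= L ^+ 2.
Proof.
move=> [[x0 t0 x1 t1] [xac tac der]] ot xL.
have derx : \forall s \ae mu, unit_int s -> derivable x s 1.
  by apply: negligibleS der => s h h'; apply: h => /h'[].
have [F [N [F0 Fm FL Fac [Nn NF]]]] := speed_primitive xac derx xL.
pose L1 := F 1.
have L10 : 0 <= L1 by rewrite -F0; exact: Fm.
suff H eps : 0 < eps -> phi U g tau <= (L1 + eps) * L1.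
  apply: (@le_trans _ _ (L1 ^+ 2)); last by rewrite lerXn2r // nnegrE // (le_trans L10).
  apply/ler_addgt0Pr => e e0.
  have e1 : 0 < e / (L1 + 1) by rewrite divr_gt0 // ltr_wpDl.
  apply: le_trans (H _ e1) _; rewrite mulrDl expr2 lerD2l mulrAC.
  by rewrite ler_pdivrMr ?ltr_wpDl // ler_wpM2l ?(ltW e0) // lerDl.
move=> eps0; pose Lam := L1 + eps.
have Lam0 : 0 < Lam by rewrite /Lam ltr_wpDl.
(* The shift by [eps] keeps [r] away from the pole of [Kmat] at zero, and it keeps [Lam] positive
   for curves of length zero. *)
pose r s := (F s + eps) / Lam.
have a01 : 0 < eps / Lam <= 1.
  by rewrite divr_gt0 //= ler_pdivrMr // mul1r /Lam lerDr.
have rm a b : a <= b -> r a <= r b.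
  by move=> ab; rewrite ler_wpM2r ?invr_ge0 ?(ltW Lam0) // lerD2r Fm.
have ra s : 0 <= s -> eps / Lam <= r s by move=> /rm; rewrite {1}/r F0 add0r.
have r1 : r 1 = 1 by rewrite /r divff // gt_eqF.
have rle s : s <= 1 -> r s <= 1 by move=> /rm; rewrite r1.
have rb a b : r b - r a = (F b - F a) / Lam by rewrite /r; field; rewrite gt_eqF.
have [M M0 MP] := Kmat_lipschitz a01 ot.
pose G s := dotv (mxapp (Kmat U tau (r s)) (x s)) (x s) + 4 * dotv (t s) tau + (- Lam) * F s.
have cst_ac (c : R) : chain_ac (fun _ : R => c).
  by apply: (@chain_ac_lip _ _ 0) => // a b _ _ _; rewrite subrr normr0 mul0r.
have Gac : chain_ac G.
  apply: chain_acD; last by apply: chain_acM.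
  apply: chain_acD; last first.
    apply: chain_acM => //; apply: chain_ac_sum => j; apply: chain_acM => //.
    exact: abs_cont_chain.
  apply: chain_ac_sum => i; apply: chain_acM; last exact: abs_cont_chain.
  rewrite (_ : (fun s => _) = (fun s => \sum_j Kmat U tau (r s) i j * x s 0 j)); last first.
    by apply/funext => s; rewrite mxappE.
  apply: chain_ac_sum => j; apply: chain_acM; last exact: abs_cont_chain.
  have ML : 0 <= M / Lam by rewrite divr_ge0 // ltW.
  apply: (chain_ac_dom ML Fac Fac) => a b a0 ab b1.
  apply: le_trans (MP i j _ _ (ra _ a0) (rm _ _ ab) (rle _ b1)) _.
  rewrite rb mulrA mulrAC; apply: ler_wpM2l => //.
  by apply: le_trans (ler_norm _) _; rewrite lerDl.
pose N1 := N `|` ~` [set s | unit_int s -> [/\ derivable x s 1, derivable t s 1 &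
             derive1 t s = 2^-1 *: Uform U (x s) (derive1 x s)]].
have N1n : mu.-negligible N1 by apply: negligibleU.
have Gd s : 0 <= s <= 1 -> ~ N1 s -> exists2 d, is_derive s (1 : R) G d & d <= 0.
  move=> s01 nN1.
  have Fd : is_derive s (1 : R) F (enorm (derive1 x s)).
    by apply: NF => // Ns; apply: nN1; left.
  have [dx dt tE] : [/\ derivable x s 1, derivable t s 1 &
             derive1 t s = 2^-1 *: Uform U (x s) (derive1 x s)].
    suff : unit_int s -> [/\ derivable x s 1, derivable t s 1 &
             derive1 t s = 2^-1 *: Uform U (x s) (derive1 x s)] by apply.
    by apply: contrapT => h; apply: nN1; right.
  have /andP[s0 s1] := s01.
  have xd i : is_derive s (1 : R) (fun u => x u 0 i) (derive1 x s 0 i).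
    apply: DeriveDef; first by have /derivable_mxP := dx; apply.
    by rewrite derive1E (derive_mx dx) mxE.
  have td i : is_derive s (1 : R) (fun u => t u 0 i) (derive1 t s 0 i).
    apply: DeriveDef; first by have /derivable_mxP := dt; apply.
    by rewrite derive1E (derive_mx dt) mxE.
  have rd : is_derive s (1 : R) r (enorm (derive1 x s) / Lam).
    apply: is_derive_eq; rewrite /GRing.scale /=; ring.
  set v := derive1 x s in Fd tE xd td rd *.
  have rs0 : 0 < r s by apply: lt_le_trans (ra _ s0); case/andP: a01.
  have ors : Omega_star U (r s *: tau) by apply: Omega_shrink => //; rewrite (ltW rs0) rle.
  set K := Kmat U tau (r s); set A := Amat U tau.
  have Kd i j : is_derive s (1 : R) (fun u => Kmat U tau (r u) i j)
     (((enorm v / Lam) *: (A *m A - K *m K)) i j).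
    have -> : ((enorm v / Lam) *: (A *m A - K *m K)) i j = (A *m A - K *m K) i j * (enorm v / Lam).
      by rewrite [LHS]mxE mulrC.
    refine (@is_derive1_comp _ (fun w => Kmat U tau w i j) r s _ _ (Kmat_riccati i j rs0 ors) rd).
  have d1 := is_derive_dotv (is_derive_mxapp Kd xd) xd.
  have d2 : is_derive s (1 : R) (fun u => dotv (t u) tau) (dotv (derive1 t s) tau + dotv (t s) 0).
    by apply: is_derive_dotv td _ => i; rewrite mxE; exact: is_derive_cst.
  have Gder : is_derive s (1 : R) G
     ((dotv (mxapp ((enorm v / Lam) *: (A *m A - K *m K)) (x s) + mxapp K v) (x s)
       + dotv (mxapp K (x s)) v) + 4 * (dotv (derive1 t s) tau + dotv (t s) 0)
      + (- Lam) * enorm v).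
    by rewrite /G; apply: is_derive_eq; rewrite /GRing.scale /=; ring.
  eexists; first exact: Gder.
  have KT : K^T = K by exact: Kmat_sym.
  have KA : K *m A = A *m K by apply: Kmat_comm => //; rewrite gt_eqF.
  have := calibration_le (x s) v Lam0 KT (Amat_skew sU tau) KA.
  rewrite dotv0 addr0 tE dotvZl dotv_Uform dotvDl mxappZm dotvZl (dotv_mxapp K v) KT.
  rewrite (dotvC v); lra.
have := chain_ac_nonincreasing Gac N1n Gd.
have K1 : Kmat U tau 1 = UcotU U tau by rewrite /Kmat invr1 !scale1r.
rewrite /G r1 x0 t0 x1 t1 F0 K1 mxapp0 !dot0v mulr0 add0r mulr0 addr0 -/L1.
rewrite /phi -/Lam mulNr => h; rewrite -subr_le0; exact: h.
Qed.

End LowerBound.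

(** * Geodesics *)

Section Curves.
Variable R : realType.
Local Notation mu := (@lebesgue_measure R).

Lemma is_derive0_const (f : R -> R) (a b : R) : a <= b ->
  (forall s, a <= s <= b -> is_derive s (1 : R) f 0) -> f a = f b.
Proof.
move=> ab fd; apply/eqP; rewrite eq_sym -subr_eq0 -normr_le0.
have := @lipschitz_MVT _ f (fun=> 0) a b 0 fd _ a b (lexx a) ab (lexx b).
by rewrite mul0r; apply => s _; rewrite normr0.
Qed.

Lemma abs_cont_lip (f : R -> R) (a b M : R) : 0 <= M ->
  (forall u v, a <= u -> u <= v -> v <= b -> `|f v - f u| <= M * (v - u)) -> abs_cont f a b.
Proof.
move=> M0 fM e e0; have M1 : 0 < M + 1 by rewrite ltr_wpDl.
exists (e / (M + 1)) => [|n I Iab _ Is]; first by rewrite divr_gt0.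
apply: (@le_lt_trans _ _ (\sum_(k < n) M * ((I k).2 - (I k).1))).
  by apply: ler_sum => k _; have [? [? ?]] := Iab k; exact: fM.
rewrite -mulr_sumr; apply: (@le_lt_trans _ _ ((M + 1) * \sum_(k < n) ((I k).2 - (I k).1))).
  rewrite ler_wpM2r ?lerDl // sumr_ge0 // => k _; rewrite subr_ge0.
  by have [? [? ?]] := Iab k.
by rewrite mulrC -ltr_pdivlMr.
Qed.

Lemma abs_cont_derive2 (f df ddf : R -> R) (a b : R) : a <= b ->
  (forall s, a <= s <= b -> is_derive s (1 : R) f (df s)) ->
  (forall s, a <= s <= b -> is_derive s (1 : R) df (ddf s)) -> abs_cont f a b.
Proof.
move=> ab fd dfd; have [M M0 MP] := derivable_bounded ab dfd.
exact: abs_cont_lip M0 (lipschitz_MVT fd MP).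
Qed.

Lemma continuous_primitive (f : R -> R) : continuous f ->
  exists2 F : R -> R, F 0 = 0 & forall s : R, 0 <= s <= 1 -> is_derive s (1 : R) F (f s).
Proof.
move=> fc; pose G (s : R) := \int[mu]_(t in [set` `[(-1 : R), s]]) f t.
exists (fun s => G s - G 0) => [|s /andP[s0 s1]]; first by rewrite subrr.
have fi : mu.-integrable `[(-1 : R), 2] (EFin \o f).
  apply: continuous_compact_integrable; first exact: segment_compact.
  exact: continuous_subspaceT.
have [|||d1 d2] := @continuous_FTC1_closed _ f (-1) s 2 _ fi.
- by lra.
- by lra.
- exact: fc.
have dG : is_derive s (1 : R) G (f s).
  by apply: DeriveDef; [exact: d1|rewrite -derive1E; exact: d2].
by apply: is_derive_eq; rewrite subr0.
Qed.

Lemma csum_exp c (K o rho : R) : 0 <= rho -> (forall k, `|c k| <= K * (o ^+ k / k`!%:R)) ->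
  csum c rho.
Proof.
move=> r0 cK.
have cv : cvgn (series (K *: (exp_coeff (o * rho)))).
  by apply: is_cvg_seriesZ; exact: is_cvg_series_exp_coeff.
apply: (lim_series_abs_le cv _).1 => k.
rewrite normrM normr_id normrX (ger0_norm r0).
apply: le_trans (ler_wpM2r _ (cK k)) _; first by rewrite exprn_ge0.
change (K * (o ^+ k / k`!%:R) * rho ^+ k <= K * ((o * rho) ^+ k / k`!%:R)).
by rewrite exprMn le_eqVlt; apply/orP; left; apply/eqP; ring.
Qed.

(** The velocity is [exp ((s - 1) B) v0]. Velocity and position are power series about [s = 1],
    where the data are prescribed; comparison with the exponential series makes them converge
    everywhere. *)
Lemma linear_ode2 n (B : 'M[R]_n) (x0 v0 : 'rV[R]_n) :
  exists (x v : R -> 'rV[R]_n), [/\ x 1 = x0, v 1 = v0,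
    (forall s i, is_derive s (1 : R) (fun u => x u 0 i) (v s 0 i)) &
    (forall s i, is_derive s (1 : R) (fun u => v u 0 i) (mxapp B (v s) 0 i))].
Proof.
pose w k := iter k (mxapp B) v0.
pose d (i : 'I_n) k := w k 0 i / k`!%:R.
pose c (i : 'I_n) k := if k is k'.+1 then w k' 0 i / k`!%:R else x0 0 i.
have o1 : 1 <= opnorm B + 1 by rewrite lerDr opnorm_ge0.
have wb k i : `|w k 0 i| <= enorm v0 * (opnorm B + 1) ^+ k.
  apply: le_trans (enorm_coord _ _) _; elim: k => [|k IH]; first by rewrite expr0 mulr1.
  apply: le_trans (enorm_mxapp _ _) _; rewrite exprS mulrCA; apply: ler_pM => //.
  - exact: opnorm_ge0.
  - exact: enorm_ge0.
  - by rewrite lerDl.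
have f0 k : 0 < k`!%:R :> R by rewrite ltr0n fact_gt0.
have cr i r : rad (c i) r.
  move=> rho /andP[r0 _]; apply: (@csum_exp _ (`|x0 0 i| + enorm v0) (opnorm B + 1)) => //.
  case=> [|k] /=; first by rewrite expr0 fact0 invr1 !mulr1 lerDl enorm_ge0.
  rewrite normrM normfV (ger0_norm (ltW (f0 k.+1))) mulrA ler_wpM2r ?invr_ge0 ?(ltW (f0 _)) //.
  apply: le_trans (wb k i) _; apply: ler_pM.
  - exact: enorm_ge0.
  - by rewrite exprn_ge0 // (le_trans ler01).
  - by rewrite lerDr.
  - by rewrite exprS ler_peMl // exprn_ge0 // (le_trans ler01).
have fld (a b z : R) : a != 0 -> b != 0 -> a * (z / (a * b)) = z / b.
  by move=> a0 b0; field; apply/andP.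
have cd i : pseries_diffs (c i) = d i.
  apply/funext => k; rewrite /pseries_diffs /d /c factS natrM.
  by apply: fld; [rewrite pnatr_eq0|rewrite gt_eqF].
have dd i k : pseries_diffs (d i) k = \sum_j B i j * d j k.
  rewrite /pseries_diffs /d [w _]iterS mxappE factS natrM.
  rewrite mulr_suml mulr_sumr; apply: eq_bigr => j _; rewrite -/(w k) [in RHS]mulrA.
  by apply: fld; [rewrite pnatr_eq0|rewrite gt_eqF].
have dr i r : rad (d i) r by rewrite -cd; exact: rad_diffs.
pose ps (e : 'I_n -> nat -> R) (s : R) : 'rV[R]_n := \row_i limn (pseries (e i) (s - 1)).
have psd (e : 'I_n -> nat -> R) s i : (forall r, rad (e i) r) ->
    is_derive s (1 : R) (fun u => ps e u 0 i) (limn (pseries (pseries_diffs (e i)) (s - 1))).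
  move=> er; have -> : (fun u => ps e u 0 i) = (fun u => limn (pseries (e i) u)) \o (fun u => u - 1).
    by apply/funext => u; rewrite /= mxE.
  have d1 : is_derive s (1 : R) (fun u : R => u - 1) 1.
    by apply: is_derive_eq; rewrite subr0.
  have d2 := @pseries_is_derive _ (e i) (`|s - 1| + 1) (s - 1) (er _).
  rewrite -[limn _]mulr1; apply: is_derive1_comp; apply: d2.
  by rewrite ltrDl.
have ps1 e : ps e 1 = \row_i e i 0%N.
  by apply/rowP => i; rewrite !mxE subrr pseries0.
exists (ps c), (ps d); split.
- by rewrite ps1; apply/rowP => i; rewrite mxE.
- by rewrite ps1; apply/rowP => i; rewrite mxE /d fact0 invr1 mulr1.
- by move=> s i; rewrite [ps d s 0 i]mxE -cd; exact: psd.
- move=> s i; rewrite mxappE.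
  have -> : \sum_j B i j * ps d s 0 j = limn (pseries (pseries_diffs (d i)) (s - 1)); last exact: psd.
  apply/esym/cvg_lim => //.
  rewrite (_ : pseries _ _ = fun N => \sum_j B i j * pseries (d j) (s - 1) N).
    apply: cvg_sumr => j; apply: cvgM; first exact: cvg_cst.
    by rewrite mxE; apply: csum_pseries; apply: (dr _ (`|s - 1| + 1)); rewrite normr_ge0 ltrDl /=.
  apply/funext => N; rewrite /pseries /series /=; under [RHS]eq_bigr do rewrite mulr_sumr.
  rewrite exchange_big /=; apply: eq_bigr => k _; rewrite dd mulr_suml.
  by apply: eq_bigr => j _; rewrite mulrA.
Qed.

Lemma derivable_row n (x : R -> 'rV[R]_n) (v : 'rV[R]_n) (s : R) :
  (forall i, is_derive s (1 : R) (fun u => x u 0 i) (v 0 i)) ->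
  derivable x s 1 /\ derive1 x s = v.
Proof.
move=> xd; have dx : derivable x s 1.
  by apply/derivable_mxP => i j; rewrite ord1; case: (xd j).
split=> //; rewrite derive1E (derive_mx dx); apply/rowP => i; rewrite mxE.
by case: (xd i).
Qed.

End Curves.

Section Geodesic.
Variables (R : realType) (q m : nat) (U : 'I_m -> 'M[R]_q).
Hypothesis sU : forall j, skew_sym (U j).
Local Notation mu := (@lebesgue_measure R).
Local Notation Om := (Omega_star U).
Local Notation A := (Amat U).
Local Notation C := (UcotU U).

Lemma Amat0 : A 0 = 0.
Proof. by rewrite -(scale0r 0) AmatZ scale0r. Qed.

Lemma Omega0 : Om 0.
Proof. by rewrite /Omega_star /= Amat0 opnorm0 pi_gt0. Qed.

Lemma UcotU0 : C 0 = 1%:M.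
Proof.
rewrite UcotU_bc; last exact: Omega0.
rewrite Amat0 mul0mx oppr0; apply/matrixP => i j; rewrite mxE; apply/cvg_lim => //.
rewrite -(cvg_shiftS (series _)).
rewrite (_ : (fun n => _ n.+1) = cst ((1%:M : 'M[R]_q) i j)); first exact: cvg_cst.
apply/funext => n; rewrite /series /= big_nat_recl //= big1 => [|k _].
  by rewrite /bc bz0 eqxx subr0 mul1r expr0 addr0.
by rewrite exprS mul0r mxE mulr0.
Qed.

Section Curve.
Variables (theta : 'rV[R]_m) (x0 : 'rV[R]_q) (x v : R -> 'rV[R]_q).
Hypothesis ot : Om theta.
Let v0 := mxapp (C theta + A theta) x0.
Hypotheses (x1 : x 1 = x0) (v1 : v 1 = v0).
Hypothesis xd : forall s i, is_derive s (1 : R) (fun u => x u 0 i) (v s 0 i).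
Hypothesis vd : forall s i,
  is_derive s (1 : R) (fun u => v u 0 i) (mxapp (2 *: A theta) (v s) 0 i).

Let K := Kmat U theta.

(* x' - (K + A) x solves a linear equation because K' = A^2 - K^2 *)
Lemma geodesic_velocity s : 0 < s <= 1 -> v s = mxapp (K s + A theta) (x s).
Proof.
move=> /andP[s0 s1]; have s01 : 0 < s <= 1 by rewrite s0.
have [S S0 SP] := Kmat_bounded s01 ot.
pose d u := v u - mxapp (K u + A theta) (x u).
have oK u : s <= u <= 1 -> Om (u *: theta) /\ 0 < u.
  move=> /andP[su u1]; have u0 := lt_le_trans s0 su; split=> //.
  by apply: Omega_shrink => //; rewrite ltW.
have dd u : s <= u <= 1 ->
    forall i, is_derive u (1 : R) (fun z => d z 0 i) (mxapp (A theta - K u) (d u) 0 i).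
  move=> su i; have [ou u0] := oK u su.
  have Kd k l : is_derive u (1 : R) (fun z => (K z + A theta) k l)
     ((A theta *m A theta - K u *m K u) k l).
    have -> : (fun z => (K z + A theta) k l) = (fun z => K z k l + A theta k l).
      by apply/funext => z; rewrite mxE.
    have d1 := Kmat_riccati k l u0 ou.
    by apply: is_derive_eq; rewrite addr0.
  have -> : (fun z => d z 0 i) = (fun z => v z 0 i - mxapp (K z + A theta) (x z) 0 i).
    by apply/funext => z; rewrite !mxE.
  have d1 := is_derive_mxapp Kd (xd u) i; have d2 := vd u i.
  apply: is_derive_eq; rewrite /d.
  have KA : K u *m A theta = A theta *m K u by apply: Kmat_comm => //; rewrite gt_eqF.
  move: (K u) KA => Ku KA.
  rewrite !(mxappDm, mxappNm, mxappD, mxappN, mxappZm).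
  rewrite !mxapp_mul -(mxapp_mul Ku (A theta)) KA mxapp_mul.
  move: (mxapp (A theta) (v u)) (mxapp Ku (v u)) => a b.
  move: (mxapp (A theta) (mxapp Ku (x u))) (mxapp (A theta) (mxapp (A theta) (x u))) => e f.
  by move: (mxapp Ku (mxapp Ku (x u))) => g; rewrite !mxE; ring.
(* Here [d' = (A - K) d] and [d 1 = 0]. The skew part drops out of the derivative of [|d|^2], and
   [gronwall0] runs backwards from 1 to [s], where [K] is bounded. *)
pose f u := dotv (d u) (d u).
have f1 : f 1 = 0.
  rewrite /f /d v1 x1 /v0 /K /Kmat invr1 !scale1r subrr; exact: dot0v.
have fd u : s <= u <= 1 -> is_derive u (1 : R) f (- 2 * dotv (mxapp (K u) (d u)) (d u)).
  move=> su; have d1 := is_derive_dotv (dd u su) (dd u su).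
  apply: is_derive_eq; rewrite (dotvC (d u)) mxappDm mxappNm dotvDl dotvNl.
  by rewrite skew_dotv0; [ring|exact: Amat_skew].
have fb u : s <= u <= 1 -> `|- 2 * dotv (mxapp (K u) (d u)) (d u)| <=
    (2 * ((q * q)%:R * S)) * `|f u|.
  move=> su; rewrite normrM normrN (ger0_norm (ler0n _ 2)) -mulrA ler_wpM2l //.
  rewrite (ger0_norm (dotv_ge0 _)) /f -enormE expr2 mulrA.
  have Kb : enorm (mxapp (K u) (d u)) <= (q * q)%:R * S * enorm (d u).
    apply: le_trans (enorm_mxapp_l1 _ _) _; rewrite ler_wpM2r ?enorm_ge0 //.
    by apply: mxl1_le => i j; exact: SP.
  rewrite ler_norml; apply/andP; split.
    rewrite lerNl -dotvNr; apply: le_trans (dotv_le _ _) _.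
    by rewrite -[- d u]scaleN1r enormZ normrN1 mul1r ler_wpM2r ?enorm_ge0.
  by apply: le_trans (dotv_le _ _) _; rewrite ler_wpM2r ?enorm_ge0.
have : f s = 0.
  by apply: (gronwall0 fd fb) f1; rewrite ?lexx ?s1.
by move=> /dotv_eq0 /eqP; rewrite subr_eq0 => /eqP.
Qed.

(** Multiplied by [s], the velocity formula reads [s v = (C(s theta) + s A) x] and has lost its
    pole. Continuity at zero and [C(0) = 1] then force [x 0 = 0]. *)
Lemma geodesic_start : x 0 = 0.
Proof.
apply/rowP => i; rewrite [RHS]mxE.
pose g (s : R) := s * v s 0 i - \sum_j (C (s *: theta) i j + s * A theta i j) * x s 0 j.
have g0 : g 0 = - x 0 0 i.
  rewrite /g scale0r UcotU0 mul0r sub0r (bigD1 i) //= mxE eqxx mul0r addr0 mul1r.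
  by rewrite big1 ?addr0 // => j ji; rewrite mxE eq_sym (negPf ji) !mul0r add0r mul0r.
have c1 (f : R -> R) df : is_derive (0 : R) (1 : R) f df -> f s @[s --> (0 : R)] --> f 0.
  by move=> [/derivable1_diffP/differentiable_continuous].
have gc : g s @[s --> (0 : R)] --> g 0.
  apply: cvgB; first by apply: cvgM; [exact: cvg_id|exact: c1 (vd 0 i)].
  apply: cvg_sumr => j; apply: cvgM; last exact: c1 (xd 0 j).
  apply: cvgD; last by apply: cvgM; [exact: cvg_id|exact: cvg_cst].
  apply: (@cvg_comp _ _ _ (fun s : R => s *: theta) (fun w => C w i j) _ (nbhs ((0 : R) *: theta))).
    by apply: cvgZr_tmp; exact: cvg_id.
  have cc : {for 0, continuous (fun w => C w i j)}.
    by apply: differentiable_continuous; apply: smooth_on_diff Omega0; exact: UcotU_smooth.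
  by rewrite scale0r; exact: cc.
have gz : g s @[s --> (0 : R)^'+] --> (0 : R).
  apply: cvg_near_cst; near=> s.
  have s0 : 0 < s by near: s; exact: nbhs_right_gt.
  have s1 : s <= 1 by near: s; exact: nbhs_right_le.
  rewrite /g geodesic_velocity ?s0 // mxappE mulr_sumr -sumrB big1 // => j _.
  rewrite /K /Kmat !mxE; field.
  by rewrite gt_eqF.
have /(cvg_unique (@Rhausdorff R) gz) : g s @[s --> (0 : R)^'+] --> g 0.
  exact: cvg_at_right_filter.
by rewrite g0 => /eqP; rewrite eq_sym oppr_eq0 => /eqP.
Unshelve. all: by end_near. Qed.

Lemma geodesic_speed s : 0 <= s <= 1 -> dotv (v s) (v s) = dotv v0 v0.
Proof.
move=> /andP[s0 s1]; rewrite -v1.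
apply: (@is_derive0_const _ (fun s => dotv (v s) (v s)) s 1 s1) => u _.
have d1 := is_derive_dotv (vd u) (vd u).
apply: is_derive_eq; rewrite (dotvC (v u)) mxappZm dotvZl skew_dotv0 ?mulr0 ?addr0 //.
exact: Amat_skew.
Qed.

End Curve.

(** The vertical end point [t1] is whatever the horizontal lift of [x] produces. That it is the
    prescribed one follows from criticality of [theta], in [ccdist_crit]. *)
Lemma geodesic (theta : 'rV[R]_m) (x0 : 'rV[R]_q) : Om theta ->
  let v0 := mxapp (C theta + A theta) x0 in
  exists t1 x t, [/\ horizontal_curve U (x0, t1) x t, curve_length x = (enorm v0)%:E &
    phi U (x0, t1) theta = enorm v0 ^+ 2].
Proof.
move=> ot v0; have [x [v [x1 v1 xd vd]]] := linear_ode2 (2 *: A theta) x0 v0.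
have xs := geodesic_start ot x1 v1 xd vd.
have sp := geodesic_speed v1 vd.
pose h j (s : R) := 2^-1 * dotv (mxapp (U j) (x s)) (v s).
have hd j s : is_derive s (1 : R) (h j) (2^-1 *
    (dotv (0 + mxapp (U j) (v s)) (v s) + dotv (mxapp (U j) (x s)) (mxapp (2 *: A theta) (v s)))).
  have cd k l : is_derive s (1 : R) (fun _ : R => U j k l) ((0 : 'M[R]_q) k l).
    by rewrite mxE; exact: is_derive_cst.
  have d1 := is_derive_mxapp cd (xd s).
  have d2 := is_derive_dotv d1 (vd s).
  rewrite /h; apply: is_derive_eq; rewrite /GRing.scale /=.
  by rewrite [mxapp 0 _](_ : _ = 0); [ring|rewrite /mxapp trmx0 mulmx0].
have /choice[t tP] : forall j, exists F : R -> R, F 0 = 0 /\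
    forall s : R, 0 <= s <= 1 -> is_derive s (1 : R) F (h j s).
  move=> j; have hc : continuous (h j).
    by move=> s; have [/derivable1_diffP/differentiable_continuous] := hd j s.
  by have [F F0 FP] := continuous_primitive hc; exists F.
pose T (s : R) : 'rV[R]_m := \row_j t j s.
have TE j : (fun s => T s 0 j) = t j by apply/funext => s; rewrite mxE.
have Td (s : R) : 0 <= s <= 1 -> forall j, is_derive s (1 : R) (fun u => T u 0 j)
    ((2^-1 *: Uform U (x s) (v s)) 0 j).
  by move=> s01 j; rewrite TE !mxE; exact: (tP j).2.
have T0 : T 0 = 0 by apply/rowP => j; rewrite !mxE (tP j).1.
have xv s := derivable_row (xd s).
exists (T 1), x, T; split.
- split; first by split.
  split.
  + by move=> i; exact: (abs_cont_derive2 ler01 (fun s _ => xd s i) (fun s _ => vd s i)).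
  + by move=> j; rewrite TE; exact: (abs_cont_derive2 ler01 (tP j).2 (fun s _ => hd j s)).
  + apply: aeW => s s01; have [? ->] := xv s; have [? ->] := derivable_row (Td s s01).
    by split.
- rewrite /curve_length (_ : @unit_int R = [set` `[0, 1]]); last first.
    by apply/seteqP; split => s /=; rewrite in_itv.
  rewrite (@eq_integral _ _ _ _ _ (cst (enorm v0)%:E)); last first.
    move=> s /[!inE] /=; rewrite in_itv /= => s01; have [_ ->] := xv s.
    by rewrite /enorm sp.
  rewrite integral_cst //= lebesgue_measure_itv /= lte_fin ltr01 oppr0 adde0 mule1 //.
(* A conserved quantity: the derivative of the vertical term cancels the term that [x'' = 2 A x']
   contributes, and the speed is constant. Its values at 0 and 1 give [phi]. *)
- pose f (s : R) := 4 * dotv (T s) theta + dotv (x s) (v s) + (- s) * dotv v0 v0.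
  have : f 0 = f 1.
    apply: (is_derive0_const ler01) => s s01.
    have d1 := is_derive_dotv (xd s) (vd s).
    have d2 : is_derive s (1 : R) (fun u => dotv (T u) theta)
        (dotv (2^-1 *: Uform U (x s) (v s)) theta + dotv (T s) 0).
      by apply: is_derive_dotv (Td s s01) _ => i; rewrite mxE; exact: is_derive_cst.
    rewrite /f; apply: is_derive_eq.
    have E : dotv (x s) (mxapp (2 *: A theta) (v s)) = - (2 * dotv (mxapp (A theta) (x s)) (v s)).
      by rewrite mxappZm dotvZr dotv_mxapp (Amat_skew sU) mxappNm dotvNr; ring.
    by rewrite dotv0 addr0 dotvZl dotv_Uform sp // E /GRing.scale /=; field.
  rewrite /f T0 xs x1 v1 !dot0v oppr0 !mul0r mulr0 !addr0 /phi /=.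
  rewrite mulN1r => /eqP; rewrite eq_sym subr_eq0 => /eqP; rewrite enormE => <-.
  rewrite addrC; congr (_ + _); rewrite /v0 mxappDm dotvDr (dotvC x0 (mxapp (A theta) x0)).
  by rewrite (skew_dotv0 _ (Amat_skew sU theta)) addr0 dotvC.
Qed.

Lemma UcotU_diff theta i j : Om theta -> differentiable (fun s => C s i j) theta.
Proof. by move=> ot; apply: smooth_on_diff ot; exact: UcotU_smooth. Qed.

Lemma dotv_is_diff n (a b : 'rV[R]_n) : is_diff b (dotv a) (dotv a).
Proof.
have al : linear (dotv a) by move=> k x y; rewrite dotvDr dotvZr.
apply: (@linear_is_diff _ _ _ _ (enorm a * n%:R)) => // h.
rewrite -mulrA; apply: (@le_trans _ _ (enorm a * enorm h)).
  rewrite ler_norml dotv_le andbT lerNl -dotvNl; apply: le_trans (dotv_le _ _) _.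
  by rewrite -scaleN1r enormZ normrN1 mul1r.
by rewrite ler_wpM2l ?enorm_ge0 // enorm_le_norm.
Qed.

Lemma dotv_ebasis n (a : 'rV[R]_n) j : dotv a (ebasis R j) = a 0 j.
Proof.
rewrite /dotv (bigD1 j) //= mxE !eqxx mulr1 big1 ?addr0 // => k kj.
by rewrite mxE eqxx (negPf kj) mulr0.
Qed.

Lemma dotv_diff n (a b : 'rV[R]_n) : differentiable (dotv a) b.
Proof. by case: (dotv_is_diff a b). Qed.

Lemma phi_diff g theta : Om theta -> differentiable (phi U g) theta.
Proof.
move=> ot; have -> : phi U g = (\sum_i \sum_j (g.1 0 i * g.1 0 j) *: (fun s => C s i j))
    + 4 *: dotv g.2.
  apply/funext => s; rewrite /phi quadE fctE; congr (_ + _).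
  rewrite fct_sumE; apply: eq_bigr => i _; rewrite fct_sumE; apply: eq_bigr => j _.
  by [].
apply: differentiableD; last by apply: differentiableZ; exact: dotv_diff.
apply: differentiable_sum => i; apply: differentiable_sum => j.
by apply: differentiableZ; exact: UcotU_diff.
Qed.

Lemma derive_phi_vertical x t t' theta j : Om theta ->
  'D_(ebasis R j) (phi U (x, t')) theta =
  'D_(ebasis R j) (phi U (x, t)) theta + 4 * (t' - t) 0 j.
Proof.
move=> ot; have -> : phi U (x, t') = phi U (x, t) + 4 *: dotv (t' - t).
  apply/funext => s; rewrite /phi fctE /= -addrA; congr (_ + _).
  rewrite -[X in _ = _ + X]/(4 * dotv (t' - t) s) dotvDl dotvNl; ring.
have dd := dotv_diff (t' - t) theta.
rewrite deriveD; first last.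
- by apply: diff_derivable; apply: differentiableZ.
- by apply: diff_derivable; exact: phi_diff.
rewrite deriveZ; last exact: diff_derivable.
by rewrite (is_diff_derive _ (dotv_is_diff _ _)) dotv_ebasis.
Qed.

(** The geodesic generated by [theta] ends at some [(x0, t1)] and has squared length
    [phi U (x0, t1) theta]. By calibration [theta] maximises the phase of [(x0, t1)] on the open
    domain, hence is critical for it as well. The phases of [(x0, t0)] and [(x0, t1)] differ by the
    linear function [4 (t1 - t0) . tau], so [t1 = t0], and the calibration bound for [(x0, t0)] is
    attained. *)
Lemma ccdist_crit g theta : Om theta -> (forall j, 'D_(ebasis R j) (phi U g) theta = 0) ->
  ccdist U g = enorm (mxapp (C theta + A theta) g.1) /\
  phi U g theta = enorm (mxapp (C theta + A theta) g.1) ^+ 2.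
Proof.
case: g => x0 t0 ot crit /=; set v0 := mxapp _ _.
have [t1 [x [t [hc lx pE]]]] := geodesic x0 ot.
have pm tau : Om tau -> phi U (x0, t1) tau <= phi U (x0, t1) theta.
  by move=> /(phi_le_length sU hc) /(_ lx); rewrite pE.
have crit1 j : 'D_(ebasis R j) (phi U (x0, t1)) theta = 0.
  pose f (s : R) := phi U (x0, t1) (s *: ebasis R j + theta).
  have fd s : Om (s *: ebasis R j + theta) ->
      is_derive s (1 : R) f ('D_(ebasis R j) (phi U (x0, t1)) (s *: ebasis R j + theta)).
    move=> os; apply: is_derive_curve; first exact: phi_diff.
    exact: is_derive_line.
  have cO : \forall s \near (0 : R), Om (s *: ebasis R j + theta).
    have c : (s *: ebasis R j + theta) @[s --> (0 : R)] --> theta.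
      rewrite -[X in _ --> X]add0r -[X in X + theta](scale0r (ebasis R j)).
      by apply: cvgD; [apply: cvgZr_tmp; exact: cvg_id|exact: cvg_cst].
    by apply: c; apply: open_near ot; exact: Omega_open.
  move: cO => /nbhs_ballP[e /= e0 eP].
  have eP' s : `|s| < e -> Om (s *: ebasis R j + theta).
    by move=> se; apply: eP; rewrite -ball_normE /= sub0r normrN.
  have o0 : Om (0 *: ebasis R j + theta) by apply: eP'; rewrite normr0.
  have [_ d0] := fd 0 o0.
  rewrite -[X in 'D__ _ X]add0r -[X in X + theta](scale0r (ebasis R j)) -d0.
  have := @derive1_at_max _ f (- (e / 2)) (e / 2) 0.
  move=> [||||_] //.
  - lra.
  - move=> s; rewrite in_itv /= => /andP[s1 s2].
    have os : Om (s *: ebasis R j + theta).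
      by apply: eP'; rewrite ltr_norml; apply/andP; split; lra.
    by case: (fd s os).
  - by rewrite in_itv /=; apply/andP; split; lra.
  - move=> s; rewrite in_itv /= => /andP[s1 s2].
    rewrite /f scale0r add0r; apply: pm; apply: eP'; rewrite ltr_norml.
    by apply/andP; split; lra.
have t01 : t1 = t0.
  apply/eqP; rewrite -subr_eq0; apply/eqP/rowP => j.
  have := crit1 j; rewrite (derive_phi_vertical x0 t0 t1 j ot) crit add0r => h; rewrite [RHS]mxE.
  by move/eqP: h; rewrite mulf_eq0 pnatr_eq0 /= => /eqP.
rewrite t01 in hc pE.
split=> //; rewrite /ccdist.
suff -> : ereal_inf [set L | exists x t, horizontal_curve U (x0, t0) x t /\ L = curve_length x]
  = (enorm v0)%:E by [].
apply/eqP; rewrite eq_le; apply/andP; split.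
  by apply: ereal_inf_lbound; exists x, t.
apply: le_ereal_inf_tmp => _ [x' [t' [hc' ->]]].
have L0 : (0 <= curve_length x')%E by apply: integral_ge0 => s _; rewrite lee_fin enorm_ge0.
case E : (curve_length x') L0 => [L| |] //; last by move=> _; exact: leey.
rewrite !lee_fin => L0.
have := phi_le_length sU hc' ot E; rewrite pE ler_pXn2r ?nnegrE ?enorm_ge0 //.
Qed.

End Geodesic.

(** * Smooth functions *)

Section SmoothAlgebra.
Variables (R : realType) (V : normedModType R) (A : set V).
Hypothesis oA : open A.
Implicit Types (f g : V -> R).

(** Closure under sums and products absorbs the product rule, so only derivatives of generators have
    to be examined. Equality is required on [A] alone, because the rules of differentiation are
    available only there. *)
Inductive fun_alg (G : (V -> R) -> Prop) : (V -> R) -> Prop :=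
| fun_alg_gen f : G f -> fun_alg G f
| fun_alg_add f g : fun_alg G f -> fun_alg G g -> fun_alg G (f + g)
| fun_alg_mul f g : fun_alg G f -> fun_alg G g -> fun_alg G (f * g)
| fun_alg_eq f g : fun_alg G f -> (forall x, A x -> f x = g x) -> fun_alg G g.

Lemma fun_alg_smooth (G : (V -> R) -> Prop) :
  (forall f x, G f -> A x -> differentiable f x) ->
  (forall f v, G f -> fun_alg G ('D_v f)) ->
  forall f, fun_alg G f -> smooth_on A f.
Proof.
move=> Gd GD.
have Fd f x : fun_alg G f -> A x -> differentiable f x.
  move=> Gf Ax; elim: Gf => {f} [f Gf|f g _ df _ dg|f g _ df _ dg|f g _ df fg].
  - exact: Gd.
  - exact: differentiableD.
  - exact: differentiableM.
  - by apply: near_eq_diff df; apply: filterS (open_near oA Ax) => y; exact: fg.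
apply: smooth_on_coind => //; first by move=> f g Gf fg; exact: fun_alg_eq fg.
move=> f v; elim=> {f} [f Gf|f g Gf IHf Gg IHg|f g Gf IHf Gg IHg|f g Gf IHf fg].
- exact: GD.
- apply: fun_alg_eq (fun_alg_add IHf IHg) _ => x Ax.
  by rewrite deriveD //; apply: diff_derivable; exact: Fd.
- apply: fun_alg_eq (fun_alg_add (fun_alg_mul Gf IHg) (fun_alg_mul Gg IHf)) _ => x Ax.
  by rewrite deriveM //; apply: diff_derivable; exact: Fd.
- by apply: fun_alg_eq IHf _ => x Ax; exact: (derive_eq_on _ oA fg Ax).
Qed.

Lemma smooth_onI f : (forall x, A x -> differentiable f x) ->
  (forall v, smooth_on A ('D_v f)) -> smooth_on A f.
Proof.
move=> fd sD vs x Ax; case/lastP: vs => [|vs v]; first exact: fd.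
by rewrite -cats1 iterD_cat; exact: sD.
Qed.

Lemma smooth_cst c : smooth_on A (fun=> c).
Proof.
have H (vs : seq V) : exists c', iterD vs (fun=> c) = fun=> c'.
  elim: vs => [|v vs [c' /= ->]]; first by exists c.
  by exists 0; apply/funext => y; exact: derive_cst.
by move=> vs x _; have [c' ->] := H vs; exact: differentiable_cst.
Qed.

Lemma smooth_linear f K : linear f -> (forall h, `|f h| <= K * `|h|) -> smooth_on A f.
Proof.
move=> fl fK; have fd x := linear_is_diff x fl fK.
apply: smooth_onI => [x _|v]; first by case: (fd x).
have -> : 'D_v f = fun=> f v by apply/funext => x; exact: is_diff_derive.
exact: smooth_cst.
Qed.

Lemma smooth_add f g : smooth_on A f -> smooth_on A g -> smooth_on A (fun x => f x + g x).
Proof.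
move=> sf sg; apply: (@fun_alg_smooth (smooth_on A)) => //.
- by move=> h x; exact: smooth_on_diff.
- by move=> h v sh; apply: fun_alg_gen; exact: smooth_onD1.
- by apply: fun_alg_add; exact: fun_alg_gen.
Qed.

Lemma smooth_mul f g : smooth_on A f -> smooth_on A g -> smooth_on A (fun x => f x * g x).
Proof.
move=> sf sg; apply: (@fun_alg_smooth (smooth_on A)) => //.
- by move=> h x; exact: smooth_on_diff.
- by move=> h v sh; apply: fun_alg_gen; exact: smooth_onD1.
- by apply: fun_alg_mul; exact: fun_alg_gen.
Qed.

Lemma smooth_sum (I : Type) (r : seq I) (F : I -> V -> R) :
  (forall i, smooth_on A (F i)) -> smooth_on A (fun x => \sum_(i <- r) F i x).
Proof.
move=> sF; elim: r => [|i r IH].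
  by apply: smooth_on_eq (smooth_cst 0) => // x _; rewrite big_nil.
by apply: smooth_on_eq (smooth_add (sF i) IH) => // x _; rewrite big_cons.
Qed.

Lemma smooth_prod (I : Type) (r : seq I) (F : I -> V -> R) :
  (forall i, smooth_on A (F i)) -> smooth_on A (fun x => \prod_(i <- r) F i x).
Proof.
move=> sF; elim: r => [|i r IH].
  by apply: smooth_on_eq (smooth_cst 1) => // x _; rewrite big_nil.
by apply: smooth_on_eq (smooth_mul (sF i) IH) => // x _; rewrite big_cons.
Qed.

Lemma smooth_det n (M : V -> 'M[R]_n) : (forall i j, smooth_on A (fun x => M x i j)) ->
  smooth_on A (fun x => \det (M x)).
Proof.
move=> sM; apply: smooth_sum => s; apply: smooth_mul; first exact: smooth_cst.
by apply: smooth_prod => i; exact: sM.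
Qed.

(** The derivative of [1 / f] is [- (1 / f)^2 f'], so the algebra generated by [1 / f] and the
    smooth functions is stable under derivatives. *)
Lemma smooth_inv f : smooth_on A f -> (forall x, A x -> f x != 0) ->
  smooth_on A (fun x => (f x)^-1).
Proof.
move=> sf f0.
pose G h := smooth_on A h \/ forall x, A x -> h x = (f x)^-1.
apply: (@fun_alg_smooth G); last by apply: fun_alg_gen; right.
- move=> h x [sh|hf] Ax; first exact: smooth_on_diff Ax.
  apply: (@near_eq_diff _ _ (fun x => (f x)^-1)).
    by apply: filterS (open_near oA Ax) => y Ay; rewrite hf.
  by apply: differentiableV; [exact: smooth_on_diff Ax|exact: f0].
- move=> h v [sh|hf]; first by apply: fun_alg_gen; left; exact: smooth_onD1.
  have gh : fun_alg G h by apply: fun_alg_gen; right.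
  have gc : fun_alg G (fun=> -1) by apply: fun_alg_gen; left; exact: smooth_cst.
  have gd : fun_alg G ('D_v f) by apply: fun_alg_gen; left; exact: smooth_onD1.
  apply: fun_alg_eq (fun_alg_mul gc (fun_alg_mul (fun_alg_mul gh gh) gd)) _ => x Ax.
  rewrite (derive_eq_on _ oA hf Ax) deriveV ?f0 //; last first.
    by apply: diff_derivable; exact: smooth_on_diff Ax.
  rewrite -[LHS]/(-1 * (h x * h x * 'D_v f x)) -[RHS]/(- (f x) ^- 2 * 'D_v f x) hf //.
  by rewrite expr2 invfM; ring.
Qed.

End SmoothAlgebra.

Section ChainRule.
Variables (R : realType) (V W : normedModType R).

Lemma derive_dirD (f : V -> R) (v w x : V) :
  differentiable f x -> 'D_(v + w) f x = 'D_v f x + 'D_w f x.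
Proof. by move=> df; rewrite !deriveE // linearD. Qed.

Lemma diff_bounded n (f : 'I_n -> V -> R) x : (forall j, differentiable (f j) x) ->
  exists2 K : R, 0 <= K & forall j w, `|'d (f j) x w| <= K * `|w|.
Proof.
move=> fd.
have /choice[K KP] : forall j, exists K : R, 0 < K /\ forall w, `|'d (f j) x w| <= K * `|w|.
  by move=> j; have [K K0 KP] := linear_lipschitz (diff_continuous (fd j)); exists K.
exists (\sum_j K j) => [|j w]; first by apply: sumr_ge0 => j _; have [/ltW] := KP j.
apply: le_trans ((KP j).2 w) _; rewrite ler_wpM2r // (bigD1 j) //= lerDl.
by apply: sumr_ge0 => k _; have [/ltW] := KP k.
Qed.

Lemma derive_comp (s : V -> W) (f : W -> R) (p v : V) :
  differentiable s p -> differentiable f (s p) ->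
  differentiable (fun x => f (s x)) p /\
  'D_v (fun x => f (s x)) p = 'D_('D_v s p) f (s p).
Proof.
move=> ds df; have dc : differentiable (f \o s) p by exact: differentiable_comp.
by split=> //; rewrite -[LHS]/('D_v (f \o s) p) deriveE // diff_comp //= !deriveE.
Qed.

Lemma smooth_comp_linear (L : V -> W) K (A : set V) (B : set W) (f : W -> R) :
  linear L -> (forall h, `|L h| <= K * `|h|) -> open A -> (forall x, A x -> B (L x)) ->
  smooth_on B f -> smooth_on A (fun x => f (L x)).
Proof.
move=> Ll LK oA AB sf; have Ld x := linear_is_diff x Ll LK.
pose S h := exists2 k, smooth_on B k & forall x, A x -> h x = k (L x).
apply: (@smooth_on_coind _ _ A S) => //; last by exists f.
- by move=> h1 h2 [k sk hk] h12; exists k => // x Ax; rewrite -h12 // hk.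
- move=> h x [k sk hk] Ax; apply: (@near_eq_diff _ _ (fun x => k (L x))).
    by apply: filterS (open_near oA Ax) => y Ay; rewrite hk.
  have dL : differentiable L x by case: (Ld x).
  by have [] := @derive_comp L k x 0 dL (smooth_on_diff sk (AB _ Ax)).
- move=> h v [k sk hk]; exists ('D_(L v) k); first exact: smooth_onD1.
  move=> x Ax; rewrite (derive_eq_on _ oA hk Ax).
  have [||_ ->] := @derive_comp L k x v; first by case: (Ld x).
    by apply: smooth_on_diff (AB _ Ax).
  by rewrite (is_diff_derive _ (Ld x)).
Qed.

Lemma line_MVT (f : V -> R) (v c : V) :
  (forall s : R, 0 <= s <= 1 -> differentiable f (s *: v + c)) ->
  exists2 s : R, 0 <= s <= 1 & f (v + c) - f c = 'D_v f (s *: v + c).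
Proof.
move=> fd; have dl (s : R) : 0 <= s <= 1 ->
    is_derive s (1 : R) (fun s : R => f (s *: v + c)) ('D_v f (s *: v + c)).
  by move=> s01; apply: is_derive_curve (is_derive_line v c s); exact: fd.
have [||s s01] := @MVT_segment _ (fun s : R => f (s *: v + c))
  (fun s : R => 'D_v f (s *: v + c)) 0 1 ler01.
- by move=> s /subset_itv_oo_cc; rewrite in_itv /= => /dl.
- by apply: derivable_within_continuous => s; rewrite in_itv /= => /dl[].
rewrite scale1r scale0r add0r subr0 mulr1 => E; exists s => //.
Qed.

End ChainRule.

(** * Implicit function theorem *)

Section FixedPoint.
Variables (R : realType) (m : nat).

Definition row_complete : completeNormedModType R :=
  HB.pack_for (completeNormedModType R) 'rV[R]_m.

Lemma row_fixed_point (c : 'rV[R]_m) (r k : R) (T : 'rV[R]_m -> 'rV[R]_m) :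
  0 <= k < 1 -> 0 <= r -> (forall t, `|t - c| <= r -> `|T t - c| <= r) ->
  (forall s t, `|s - c| <= r -> `|t - c| <= r -> `|T s - T t| <= k * `|s - t|) ->
  exists2 t, `|t - c| <= r & T t = t.
Proof.
move=> /andP[k0 k1] r0 Tr Tk.
pose U : set row_complete := closed_ball_ (fun x : row_complete => `|x|) c r.
have Ts : set_fun U U T by move=> t; rewrite /U /closed_ball_ /= !(distrC c) => /Tr.
pose f : {fun U >-> U} := HB.pack_for {fun U >-> U} T (isFun.Build _ _ U U T Ts).
have fk : is_contraction f.
  exists (NngNum k0); split=> // -[s t] [/= Us Ut].
  by apply: Tk; rewrite distrC.
have [||t Ut tf] := banach_fixed_point fk.
- exact: closed_closed_ball_.
- by exists c; rewrite /U /closed_ball_ /= subrr normr0.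
by exists t; [rewrite distrC|exact/esym].
Qed.

Lemma norm_mulmx_le n (a : 'rV[R]_m) (M : 'M[R]_(m, n)) : `|a *m M| <= `|a| * mxl1 M.
Proof.
apply: mx_norm_le => [|i j]; first by rewrite mulr_ge0 // mxl1_ge0.
rewrite mxE; apply: le_trans (ler_norm_sum _ _ _) _; rewrite /mxl1 mulr_sumr.
apply: ler_sum => l _; rewrite normrM; apply: ler_pM => //; first exact: coord_le_norm.
by rewrite (bigD1 j) //= lerDl sumr_ge0.
Qed.

End FixedPoint.

Section ImplicitFunction.
Variables (R : realType) (P : normedModType R) (m : nat).
Variables (W : set (P * 'rV[R]_m)) (F : 'I_m -> P * 'rV[R]_m -> R).
Hypotheses (oW : open W) (sF : forall j, smooth_on W (F j)).
Implicit Types (z : P * 'rV[R]_m) (p h : P) (t w : 'rV[R]_m).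

Definition param_jac z : 'M[R]_m :=
  \matrix_(j, k) 'D_((0 : P), ebasis R k) (F j) z.
Local Notation H := param_jac.

Lemma derive_param (f : P * 'rV[R]_m -> R) z w : differentiable f z ->
  'D_((0 : P), w) f z = \sum_k w 0 k * 'D_((0 : P), ebasis R k) f z.
Proof.
move=> df; rewrite deriveE //.
have -> : ((0 : P), w) = \sum_k w 0 k *: ((0 : P), ebasis R k).
  rewrite [LHS]surjective_pairing /=; apply/esym.
  rewrite (surjective_pairing (\sum_k _)); congr pair.
    by rewrite (raddf_sum fst) /= big1 // => k _; exact: scaler0.
  rewrite (raddf_sum snd) /= [RHS]row_sum_delta; apply: eq_bigr => k _.
  by [].
rewrite linear_sum /=; apply: eq_bigr => k _.
by rewrite linearZ /= deriveE.
Qed.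

Lemma diff_param j z w : W z -> 'D_((0 : P), w) (F j) z = (w *m (H z)^T) 0 j.
Proof.
move=> Wz; rewrite derive_param; last exact: smooth_on_diff Wz.
by rewrite mxE; apply: eq_bigr => k _; rewrite !mxE.
Qed.

Lemma smooth_param_jac j k : smooth_on W (fun z => H z j k).
Proof.
have -> : (fun z => H z j k) = 'D_((0 : P), ebasis R k) (F j).
  by apply/funext => z; rewrite mxE.
exact: smooth_onD1.
Qed.

(** Simplified Newton iteration with the Jacobian frozen at [z0]: [T p] contracts a ball around
    [t0], uniformly for [p] near [p0], and its fixed point is the zero. The derivative is delivered
    in closed form because [implicit_smooth] differentiates through it repeatedly. *)
Lemma implicit_function z0 : W z0 -> (forall j, F j z0 = 0) -> \det (H z0) != 0 ->
  exists (theta : P -> 'rV[R]_m) (N : set P),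
    [/\ open N, N z0.1, theta z0.1 = z0.2 &
    forall p, N p -> [/\ W (p, theta p), \det (H (p, theta p)) != 0,
      (forall j, F j (p, theta p) = 0) &
      is_diff p theta (fun h => - (\row_j 'D_(h, (0 : 'rV[R]_m)) (F j) (p, theta p))
                                  *m (invmx (H (p, theta p)))^T)]].
Proof.
case: z0 => p0 t0 Wz0 Fz0 dz0 /=.
pose H0 := H (p0, t0); pose B := (invmx H0)^T; pose b := mxl1 B.
have H0u : H0 \in unitmx by rewrite unitmxE unitfE.
have HB : H0^T *m B = 1%:M by rewrite -trmx_mul mulVmx // trmx1.
(* If the entries of the Jacobian vary by less than [e], then [T p] contracts with factor
   [m e b <= 1 / 2]. The added 1 covers [b = 0]. *)
pose e := (2 * (m%:R * b + 1))^-1.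
have b0 : 0 <= b by exact: mxl1_ge0.
have mb0 : 0 <= m%:R * b by rewrite mulr_ge0.
have e0 : 0 < e by rewrite invr_gt0 mulr_gt0 // ltr_wpDl.
have eb : m%:R * e * b <= 2^-1.
  have -> : m%:R * e * b = 2^-1 * (m%:R * b / (m%:R * b + 1)).
    by rewrite /e; field; rewrite gt_eqF // ltr_wpDl.
  by rewrite ler_piMr // ler_pdivrMr ?ltr_wpDl // mul1r lerDl.
have cont (f : P * 'rV[R]_m -> R) : smooth_on W f ->
    f z @[z --> (p0, t0)] --> f (p0, t0).
  by move=> sf; apply: differentiable_continuous; exact: smooth_on_diff sf Wz0.
have near1 : \forall z \near (p0, t0), [/\ W z, \det (H z) != 0 &
    forall jk : 'I_m * 'I_m, `|H0 jk.1 jk.2 - H z jk.1 jk.2| < e].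
  have n1 : \forall z \near (p0, t0), W z by exact: open_near.
  have n2 : \forall z \near (p0, t0), \det (H z) != 0.
    have cd := cont _ (smooth_det oW smooth_param_jac).
    exact: cvgr_neq0 cd dz0.
  have n3 : \forall z \near (p0, t0), forall jk : 'I_m * 'I_m,
      `|H0 jk.1 jk.2 - H z jk.1 jk.2| < e.
    have n4 (jk : 'I_m * 'I_m) : \forall z \near (p0, t0), `|H0 jk.1 jk.2 - H z jk.1 jk.2| < e.
      by have /cvgrPdist_lt /(_ e e0) := cont _ (smooth_param_jac jk.1 jk.2).
    exact: (@filter_forall _ _ _ _ (nbhs_filter (p0, t0)) n4).
  by apply: filterS3 n1 n2 n3.
have [r r0 rP] : exists2 r, 0 < r & forall p t, `|p - p0| < r -> `|t - t0| <= r ->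
    [/\ W (p, t), \det (H (p, t)) != 0 &
    forall j k, `|H0 j k - H (p, t) j k| < e].
  move: near1 => /nbhs_ballP[r /= r0 rP]; exists (r / 2); first by rewrite divr_gt0.
  move=> p t pr tr; have [] := rP (p, t).
    rewrite -ball_normE /= prod_normE /= gt_max !(distrC p0) (distrC t0).
    by apply/andP; split; lra.
  by move=> ? ? h; split=> // j k; exact: (h (j, k)).
pose Fv p t : 'rV[R]_m := \row_j F j (p, t).
pose T p t := t - Fv p t *m B.
have Tk p s t : `|p - p0| < r -> `|s - t0| <= r -> `|t - t0| <= r ->
    `|T p s - T p t| <= 2^-1 * `|s - t|.
  move=> pr sr tr.
  have -> : T p s - T p t = ((s - t) *m H0^T - (Fv p s - Fv p t)) *m B.
    rewrite mulmxBl -mulmxA HB mulmx1 mulmxBl /T.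
    move: (Fv p s *m B) (Fv p t *m B) => u v; apply/rowP => i; rewrite !mxE; ring.
  apply: le_trans (norm_mulmx_le _ _) _.
  apply: (@le_trans _ _ (m%:R * e * `|s - t| * b)); last first.
    by rewrite mulrAC ler_wpM2r.
  rewrite ler_wpM2r //; apply: mx_norm_le => [|i j].
    by rewrite !mulr_ge0 // ltW.
  rewrite ord1.
  have zE (l : R) : l *: ((0 : P), s - t) + (p, t) = (p, l *: (s - t) + t).
    by congr pair; rewrite /= ?scaler0 ?add0r.
  have inb (l : R) : 0 <= l <= 1 -> `|l *: (s - t) + t - t0| <= r.
    move=> /andP[l0 l1].
    have -> : l *: (s - t) + t - t0 = l *: (s - t0) + (1 - l) *: (t - t0).
      apply/rowP => k; rewrite !mxE; ring.
    apply: le_trans (ler_normD _ _) _; rewrite !normrZ !ger0_norm ?subr_ge0 //.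
    have := ler_wpM2l l0 sr; have : (1 - l) * `|t - t0| <= (1 - l) * r.
      by rewrite ler_wpM2l // subr_ge0.
    lra.
  have [l l01|l l01] := @line_MVT _ _ (F j) ((0 : P), s - t) (p, t).
    rewrite zE; have [Wl _ _] := rP p _ pr (inb l l01).
    exact: smooth_on_diff (sF j) Wl.
  have [Wl _ Hl] := rP p _ pr (inb l l01).
  have := zE 1; rewrite !scale1r subrK => ->.
  rewrite zE diff_param // => E.
  rewrite !mxE E !mxE -sumrB; apply: le_trans (ler_norm_sum _ _ _) _.
  rewrite -mulrA mulr_natl -[X in _ *+ X](card_ord m) -sumr_const; apply: ler_sum => k _.
  rewrite !(mxE trmx_key) -mulrBr normrM mulrC; apply: ler_pM => //.
    by rewrite ltW //; exact: Hl.
  exact: coord_le_norm.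
(* For the ball of radius [r] to be mapped into itself, contraction contributes one half of [r] and
   the smallness of [F] at [(p, t0)] the other. *)
have [d d0 dP] : exists2 d, 0 < d & forall p, `|p - p0| < d -> b * `|Fv p t0| <= r / 2.
  have c0 : 0 < r / (2 * (b + 1)) by rewrite divr_gt0 // mulr_gt0 // ltr_wpDl.
  have nj (j : 'I_m) : \forall z \near (p0, t0), `|F j z| < r / (2 * (b + 1)).
    by have := cont _ (sF j); rewrite Fz0 => /cvgr0_norm_lt; exact.
  have /nbhs_ballP[d /= d0 dP] := @filter_forall _ _ _ _ (nbhs_filter (p0, t0)) nj.
  exists d => // p pd.
  apply: (@le_trans _ _ (b * (r / (2 * (b + 1))))).
    rewrite ler_wpM2l //; apply: mx_norm_le => [|i j].
      by rewrite divr_ge0 ?(ltW r0) // mulr_ge0 // addr_ge0.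
    rewrite mxE ltW //; apply: dP.
    by rewrite -ball_normE /= prod_normE /= gt_max distrC pd subrr normr0.
  have -> : b * (r / (2 * (b + 1))) = (r / 2) * (b / (b + 1)).
    by field; rewrite gt_eqF // ltr_wpDl.
  by rewrite ler_piMr ?divr_ge0 ?(ltW r0) // ler_pdivrMr ?ltr_wpDl // mul1r lerDl.
pose N : set P := ball p0 (Num.min r d).
have NP p : N p -> `|p - p0| < r /\ `|p - p0| < d.
  by rewrite /N -ball_normE /= distrC lt_min => /andP[].
have ex p : exists t, N p -> `|t - t0| <= r /\ T p t = t.
  have [Np|nN] := pselect (N p); last by exists t0.
  have [pr pd] := NP p Np.
  have [||||t tr Tt] := @row_fixed_point R m t0 r 2^-1 (T p); last by exists t.
  - by apply/andP; split; lra.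
  - exact: ltW.
  - move=> t tr; have t00 : `|t0 - t0| <= r by rewrite subrr normr0 ltW.
    have -> : T p t - t0 = (T p t - T p t0) + (T p t0 - t0) by rewrite addrA subrK.
    apply: le_trans (ler_normD _ _) _.
    have h1 := Tk p t t0 pr tr t00.
    have h2 : `|T p t0 - t0| <= r / 2.
      rewrite /T addrAC subrr add0r normrN; apply: le_trans (norm_mulmx_le _ _) _.
      by rewrite mulrC; exact: dP.
    lra.
  - by move=> s t; exact: Tk.
have {ex}/choice[theta thP] := ex.
(* The distance to the fixed point is at most twice the length of one step. Taken at [t = theta p]
   for a neighbouring parameter, this is the Lipschitz estimate for [theta]. *)
have lip p t : N p -> `|t - t0| <= r -> `|theta p - t| <= 2 * (`|Fv p t| * b).
  move=> Np tr; have [pr pd] := NP p Np; have [thr thT] := thP p Np.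
  have h1 := Tk p _ _ pr thr tr; rewrite thT in h1.
  have h2 : `|T p t - t| <= `|Fv p t| * b.
    by rewrite /T addrAC subrr add0r normrN; exact: norm_mulmx_le.
  have : `|theta p - t| <= `|theta p - T p t| + `|T p t - t|.
    by apply: le_trans (ler_normD _ _); rewrite addrA subrK.
  lra.
have Np0 : N p0 by apply: ballxx; rewrite lt_min r0.
have F0 p : N p -> Fv p (theta p) = 0.
  move=> Np; have [_ thT] := thP p Np.
  have : Fv p (theta p) *m B = 0.
    by move/eqP: thT; rewrite /T -subr_eq0 addrAC subrr add0r oppr_eq0 => /eqP.
  move=> /(congr1 (mulmx^~ H0^T)); rewrite mul0mx -mulmxA /B -trmx_mul mulmxV //.
  by rewrite trmx1 mulmx1.
exists theta, N; split => //.
- exact: ball_open.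
- have t00 : `|t0 - t0| <= r by rewrite subrr normr0 ltW.
  have := lip p0 t0 Np0 t00.
  have -> : Fv p0 t0 = 0 by apply/rowP => j; rewrite !mxE Fz0.
  by rewrite normr0 mul0r mulr0 normr_le0 subr_eq0 => /eqP.
move=> p Np; have [pr pd] := NP p Np; have [thr _] := thP p Np.
have [Wz dz _] := rP p _ pr thr.
have Fz j : F j (p, theta p) = 0 by have /rowP/(_ j) := F0 p Np; rewrite !mxE.
split=> //.
set z := (p, theta p) in Wz dz Fz *.
have dF j : differentiable (F j) z by exact: smooth_on_diff (sF j) Wz.
have [K K0 KP] := diff_bounded dF.
have nh (h : P) : `|(h, (0 : 'rV[R]_m))| = `|h|.
  by rewrite prod_normE /= normr0 max_l.
pose D (h : P) : 'rV[R]_m := \row_j 'D_(h, (0 : 'rV[R]_m)) (F j) z.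
have DE h j : D h 0 j = 'd (F j) z (h, 0) by rewrite mxE deriveE.
pose B1 := (invmx (H z))^T; pose b1 := mxl1 B1.
have b10 : 0 <= b1 by exact: mxl1_ge0.
have HB1 : (H z)^T *m B1 = 1%:M by rewrite -trmx_mul mulVmx ?trmx1 // unitmxE unitfE.
rewrite -[is_diff _ _ _]/(is_diff p theta (fun h => - D h *m B1)).
have Dlin a h k : D (a *: h + k) = a *: D h + D k.
  apply/rowP => j.
  have -> : (a *: D h + D k) 0 j = a * D h 0 j + D k 0 j.
    by rewrite [LHS]mxE; congr (_ + _); rewrite [LHS]mxE.
  rewrite !DE -[a * _]/(a *: _) -linearP /=; congr ('d (F j) z _).
  by congr pair; rewrite /= scaler0 add0r.
apply: (@is_diff_bound _ _ _ _ _ _ (K * b1)).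
- by move=> a h k; rewrite Dlin opprD mulmxDl !mulNmx scalerN -scalemxAl.
- move=> h; apply: le_trans (norm_mulmx_le _ _) _; rewrite normrN mulrAC ler_wpM2r //.
  apply: mx_norm_le => [|i j]; first by rewrite mulr_ge0.
  by rewrite ord1 DE; apply: le_trans (KP j _) _; rewrite nh.
(* Lipschitz constant of [theta] at [p]: the differential of [F] contributes [K], its remainder
   1. *)
move=> e1 e10; pose L := 2 * ((K + 1) * b).
have L0 : 0 <= L by rewrite !mulr_ge0 // addr_ge0.
pose e' := e1 / ((1 + L) * b1 + 1).
have den : 0 < (1 + L) * b1 + 1 by rewrite ltr_wpDl // mulr_ge0 // addr_ge0.
have e'0 : 0 < e' by rewrite divr_gt0.
have small (c : R) : 0 < c -> exists2 d1, 0 < d1 & forall w : P * 'rV[R]_m, `|w| < d1 ->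
    forall j, `|F j (w + z) - 'd (F j) z w| <= c * `|w|.
  move=> c0.
  have nj (j : 'I_m) : \forall w \near (0 : P * 'rV[R]_m),
      `|F j (w + z) - 'd (F j) z w| <= c * `|w|.
    by have := diff_bound (dF j) c0; apply: filterS => w; rewrite Fz subr0.
  have := @filter_forall _ _ _ _ (nbhs_filter (0 : P * 'rV[R]_m)) nj.
  move=> /nbhs_ballP[d1 /= d10 dw]; exists d1 => // w wd; apply: dw.
  by rewrite -ball_normE /= sub0r normrN.
have [d1 d10 d1P] := small 1 ltr01.
have [d2 d20 d2P] := small e' e'0.
have : \forall h \near (0 : P), [/\ N (h + p), `|h| < d1 & (1 + L) * `|h| < d2].
  have n1 : \forall h \near (0 : P), N (h + p).
    have : \forall q \near p, N q by apply: open_near Np; exact: ball_open.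
    by rewrite {1}(near_shift 0 p); apply: filterS => h /=; rewrite subr0.
  have n2 c : 0 < c -> \forall h \near (0 : P), `|h| < c.
    move=> c0; apply/nbhs_ballP; exists c => //= h.
    by rewrite -ball_normE /= sub0r normrN.
  have d2L : 0 < d2 / (1 + L) by rewrite divr_gt0 // ltr_wpDr.
  apply: filterS3 n1 (n2 _ d10) (n2 _ d2L) => h h1 h2 h3; split=> //.
  by rewrite mulrC -ltr_pdivlMr // ltr_wpDr.
apply: filterS => h [Nh hd1 hd2].
pose k := theta (h + p) - theta p.
have kL : `|k| <= L * `|h|.
  apply: le_trans (lip _ _ Nh thr) _.
  rewrite /L -!mulrA ler_wpM2l // (mulrC b) [leRHS]mulrA ler_wpM2r //.
  apply: mx_norm_le => [|i j]; first by rewrite mulr_ge0 // addr_ge0.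
  rewrite mxE; have := d1P (h, 0); rewrite nh => /(_ hd1 j).
  have -> : (h, 0) + z = (h + p, theta p) by congr pair; rewrite /= add0r.
  rewrite mul1r => B2; have := KP j (h, 0); rewrite nh => B3.
  set a := F j _ in B2 *; set a' := 'd (F j) z _ in B2 B3.
  have : `|a| <= `|a - a'| + `|a'| by rewrite -{1}(subrK a' a) ler_normD.
  lra.
have hk : `|(h, k)| <= (1 + L) * `|h|.
  rewrite prod_normE /= ge_max mulrDl mul1r lerDl mulr_ge0 //=.
  by rewrite (le_trans kL) // lerDr.
have -> : theta (h + p) - theta p - (- D h *m B1) = (D h + k *m (H z)^T) *m B1.
  by rewrite mulNmx opprK mulmxDl -mulmxA HB1 mulmx1 addrC.
apply: le_trans (norm_mulmx_le _ _) _.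
apply: (@le_trans _ _ (e' * ((1 + L) * `|h|) * b1)).
  rewrite ler_wpM2r //; apply: mx_norm_le => [|i j].
    by rewrite mulr_ge0 ?(ltW e'0) // mulr_ge0 // addr_ge0.
  rewrite ord1 mxE DE -diff_param // deriveE // -linearD /=.
  have -> : (h, 0) + (0, k) = (h, k) by congr pair; rewrite /= ?addr0 ?add0r.
  have := d2P (h, k) (le_lt_trans hk hd2) j.
  have -> : (h, k) + z = (h + p, theta (h + p)).
    by congr pair; rewrite /= subrK.
  have /rowP/(_ j) := F0 _ Nh; rewrite !mxE => ->.
  rewrite sub0r normrN => /le_trans; apply.
  by rewrite ler_wpM2l // ltW.
have -> : e' * ((1 + L) * `|h|) * b1 = e1 * (((1 + L) * b1) / ((1 + L) * b1 + 1)) * `|h|.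
  by rewrite /e'; field; rewrite gt_eqF.
rewrite ler_wpM2r // ler_piMr ?(ltW e10) // ler_pdivrMr // mul1r lerDl //.
Qed.


End ImplicitFunction.

(** * Directional derivatives and symmetry of second derivatives *)

Section DirectionalDerivatives.
Variable R : realType.

Lemma derive_congr (V W : normedModType R) (f : V -> R) (g : W -> R) v x w y :
  (forall h : R, f (h *: v + x) = g (h *: w + y)) -> 'D_v f x = 'D_w g y.
Proof.
move=> fg; have fx : f x = g y by have := fg 0; rewrite !scale0r !add0r.
rewrite /derive fx.
have -> : (fun h : R => h^-1 *: ((f \o shift x) (h *: v) - g y)) =
  (fun h : R => h^-1 *: ((g \o shift y) (h *: w) - g y)) by apply/funext => h /=; rewrite fg.
by [].
Qed.

Lemma derive_snd (V W : normedModType R) (f : V * W -> R) (w t : W) (p : V) :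
  'D_((0 : V), w) f (p, t) = 'D_w (fun t => f (p, t)) t.
Proof.
by apply: derive_congr => h; congr f; congr pair; rewrite /= scaler0 add0r.
Qed.

Lemma derive_lineE (V : normedModType R) (f : V -> R) (v x : V) (d : R) :
  is_derive (0 : R) (1 : R) (fun s : R => f (s *: v + x)) d -> 'D_v f x = d.
Proof.
case=> _ <-; apply: derive_congr => h; congr (f (_ *: _ + _)).
by rewrite addr0 -[_ *: _]/(h * 1) mulr1.
Qed.

Section Schwarz.
Variables (V : normedModType R) (A : set V) (f : V -> R).
Hypotheses (oA : open A) (sf : smooth_on A f).

(** The mean value theorem applied twice: along [v] to the increment of [f] by [w], then along [w]
    to the derivative in direction [v]. *)
Lemma second_difference v w x :
  (forall s r : R, 0 <= s <= 1 -> 0 <= r <= 1 -> A (s *: v + (r *: w + x))) ->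
  exists s r : R, [/\ 0 <= s <= 1, 0 <= r <= 1 &
    f (v + (w + x)) - f (v + x) - (f (w + x) - f x) =
    'D_w ('D_v f) (s *: v + (r *: w + x))].
Proof.
move=> inA; have I0 : 0 <= (0 : R) <= 1 by rewrite lexx ler01.
have I1 : 0 <= (1 : R) <= 1 by rewrite lexx ler01.
have fd (g : V -> R) s r : smooth_on A g -> 0 <= s <= 1 -> 0 <= r <= 1 ->
  differentiable g (s *: v + (r *: w + x)) by move=> sg s01 r01; apply: smooth_on_diff sg (inA s r s01 r01).
pose g y := f (w + y) - f y.
have shift_diff (y : V) : differentiable f (w + y) -> differentiable (fun y => f (w + y)) y.
  move=> d; have [] := @derive_comp _ _ _ (fun y => w + y) f y 0 _ d => //.
have shift_D (y u : V) : 'D_u (fun y => f (w + y)) y = 'D_u f (w + y).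
  by apply: derive_congr => h; rewrite addrCA.
have wE s : w + (s *: v + x) = s *: v + (1 *: w + x) by rewrite scale1r addrCA.
have xE s : s *: v + x = s *: v + (0 *: w + x) by rewrite scale0r add0r.
have [s s01|s s01 E] := @line_MVT _ _ g v x.
  apply: differentiableB; last by rewrite xE; exact: fd.
  by apply: shift_diff; rewrite wE; exact: fd.
have [r r01|r r01 E2] := @line_MVT _ _ ('D_v f) w (s *: v + x).
  by rewrite addrCA; apply: fd => //; exact: smooth_onD1.
exists s, r; split; [exact: s01|exact: r01|rewrite [s *: v + (r *: w + x)]addrCA -E2].
have -> : f (v + (w + x)) - f (v + x) - (f (w + x) - f x) = g (v + x) - g x.
  by rewrite /g addrCA.
rewrite E /g deriveB; last first.
- by apply: diff_derivable; rewrite xE; exact: fd.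
- by apply: diff_derivable; apply: shift_diff; rewrite wE; exact: fd.
by rewrite shift_D.
Qed.

(** The second difference is symmetric in its two increments, and [second_difference] equates it
    with either mixed derivative at a point near [x]. Scaling the increments by a small [h] and
    continuity at [x] give the equality. *)
Lemma smooth_schwarz v w x : A x -> 'D_v ('D_w f) x = 'D_w ('D_v f) x.
Proof.
move=> Ax; apply/eqP; rewrite -subr_eq0 -normr_le0; apply/ler_addgt0Pr => e e0.
rewrite add0r; have e2 : 0 < e / 2 by rewrite divr_gt0.
have fin1 (a b c d' X Y : R) : a - b - (c - d') = X -> a - c - (b - d') = Y -> X = Y.
  by move=> <- <-; ring.
have fin2 (a b c : R) : `|a - c| < e / 2 -> `|b - c| < e / 2 -> `|a - b| <= e.
  rewrite !ltr_norml ler_norml => /andP[? ?] /andP[? ?]; apply/andP; split; lra.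
have cont u1 u2 : \forall y \near x, `|'D_u1 ('D_u2 f) x - 'D_u1 ('D_u2 f) y| < e / 2.
  have d : differentiable ('D_u1 ('D_u2 f)) x.
    by apply: smooth_on_diff Ax; do 2 apply: smooth_onD1.
  by have /cvgrPdist_lt /(_ _ e2) := differentiable_continuous d.
have : \forall y \near x, [/\ `|'D_v ('D_w f) x - 'D_v ('D_w f) y| < e / 2,
  `|'D_w ('D_v f) x - 'D_w ('D_v f) y| < e / 2 & A y].
  by apply: filterS3 (cont v w) (cont w v) (open_near oA Ax) => y ? ? ?; split.
move=> /nbhs_ballP[d /= d0 dP].
have S0 : 0 < `|v| + `|w| + 1 by rewrite ltr_wpDl // addr_ge0.
(* Small enough for the parallelogram spanned by [h v] and [h w] at [x] to stay in the ball of
   radius [d]. *)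
have [h h0 hE] : exists2 h, 0 < h & h = d / (2 * (`|v| + `|w| + 1)).
  by exists (d / (2 * (`|v| + `|w| + 1))) => //; rewrite divr_gt0 // mulr_gt0.
have inb (s r : R) : 0 <= s <= 1 -> 0 <= r <= 1 -> ball x d (s *: (h *: v) + (r *: (h *: w) + x)).
  move=> /andP[s0 s1] /andP[r0 r1]; rewrite -ball_normE /= !addrA opprD addrCA subrr addr0 normrN.
  apply: le_lt_trans (ler_normD _ _) _; rewrite !normrZ (ger0_norm s0) (ger0_norm r0) !(ger0_norm (ltW h0)).
  have B1 : s * (h * `|v|) <= h * `|v| by rewrite ler_piMl // mulr_ge0 // ltW.
  have B2 : r * (h * `|w|) <= h * `|w| by rewrite ler_piMl // mulr_ge0 // ltW.
  apply: le_lt_trans (lerD B1 B2) _; rewrite -mulrDr.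
  have -> : h * (`|v| + `|w|) = d / 2 * ((`|v| + `|w|) / (`|v| + `|w| + 1)).
    by rewrite hE; field; rewrite gt_eqF.
  have d2 : 0 <= d / 2 by apply: divr_ge0 => //; exact: ltW.
  apply: (@le_lt_trans _ _ (d / 2)); last by lra.
  by rewrite ler_piMr // ler_pdivrMr // mul1r lerDl.
have inb' (s r : R) : 0 <= s <= 1 -> 0 <= r <= 1 -> ball x d (s *: (h *: w) + (r *: (h *: v) + x)).
  by move=> s0 r0; rewrite addrCA; exact: inb.
have scal u1 u2 y : A y -> 'D_(h *: u1) ('D_(h *: u2) f) y = h ^+ 2 * 'D_u1 ('D_u2 f) y.
  move=> Ay; have E z : A z -> 'D_(h *: u2) f z = (h *: 'D_u2 f) z.
    move=> Az; have df : differentiable f z by exact: smooth_on_diff Az.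
    by rewrite deriveE // linearZ /= -deriveE.
  have dD : differentiable ('D_u2 f) y by apply: smooth_on_diff Ay; exact: smooth_onD1.
  rewrite (derive_eq_on _ oA E Ay) deriveZ; last exact: diff_derivable.
  rewrite deriveE // linearZ /= -deriveE // expr2 -mulrA.
  by rewrite -[LHS]/(h * (h * _)).
have [s [r [s01 r01 E1]]] := @second_difference (h *: v) (h *: w) x
  (fun s r s01 r01 => let: And3 _ _ a := dP _ (inb s r s01 r01) in a).
have [s' [r' [s01' r01' E2]]] := @second_difference (h *: w) (h *: v) x
  (fun s r s01 r01 => let: And3 _ _ a := dP _ (inb' s r s01 r01) in a).
have [_ b1 Ay1] := dP _ (inb s r s01 r01); have [b2 _ Ay2] := dP _ (inb' s' r' s01' r01').
rewrite scal // in E1; rewrite scal // in E2.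
rewrite [h *: w + (h *: v + x)]addrCA in E2.
have {E1 E2} E := mulfI (lt0r_neq0 (exprn_gt0 2 h0)) (fin1 _ _ _ _ _ _ E1 E2).
by rewrite E in b1; exact: fin2 b2 b1.
Qed.

End Schwarz.

End DirectionalDerivatives.

(** * Smoothness of implicit functions *)

Section ImplicitSmooth.
Variables (R : realType) (P : normedModType R) (m : nat).
Variables (W : set (P * 'rV[R]_m)) (F : 'I_m -> P * 'rV[R]_m -> R).
Hypotheses (oW : open W) (sF : forall j, smooth_on W (F j)).
Local Notation H := (param_jac F).

Definition regular_set := [set z | W z /\ \det (H z) != 0].

Lemma regular_set_open : open regular_set.
Proof.
rewrite openE => z [Wz dz].
have cd : \det (H y) @[y --> z] --> \det (H z).
  have d : differentiable (fun y => \det (H y)) z.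
    by apply: smooth_on_diff Wz; apply: smooth_det => // j k; exact: smooth_param_jac.
  exact: (differentiable_continuous d).
have n2 : \forall y \near z, \det (H y) != 0 by exact: cvgr_neq0 cd dz.
have n3 : nbhs z regular_set by apply: filterS (filterI (open_near oW Wz) n2) => y [].
exact: n3.
Qed.

Lemma smooth_on_sub (V : normedModType R) (A B : set V) f :
  A `<=` B -> smooth_on B f -> smooth_on A f.
Proof. by move=> AB sf vs x /AB; exact: sf. Qed.

(** Cramer's rule: a cofactor divided by the determinant, which does not vanish on [regular_set]. *)
Lemma smooth_inv_jac j k : smooth_on regular_set (fun z => invmx (H z) j k).
Proof.
have oR := regular_set_open.
have sH i l : smooth_on regular_set (fun z => H z i l).
  by apply: smooth_on_sub (smooth_param_jac sF i l) => z [].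
apply: (@smooth_on_eq _ _ _ (fun z => (\det (H z))^-1 * cofactor (H z) k j)) => //.
  move=> z [Wz dz]; rewrite /invmx unitmxE unitfE dz !mxE //.
apply: smooth_mul => //.
  by apply: smooth_inv => //; [apply: smooth_det|move=> z []].
apply: smooth_mul => //; first exact: smooth_cst.
apply: smooth_det => // a b.
by apply: smooth_on_eq (sH (lift k a) (lift j b)) => // z _; rewrite !mxE.
Qed.

Variables (theta : P -> 'rV[R]_m) (N : set P).
Hypothesis oN : open N.
Hypothesis thetaP : forall p, N p -> [/\ W (p, theta p), \det (H (p, theta p)) != 0,
      (forall j, F j (p, theta p) = 0) &
      is_diff p theta (fun h => - (\row_j 'D_(h, (0 : 'rV[R]_m)) (F j) (p, theta p))
                                  *m (invmx (H (p, theta p)))^T)].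

Lemma derive_graph p v : N p ->
  differentiable (fun p => (p, theta p)) p /\ 'D_v (fun p => (p, theta p)) p = (v, 'D_v theta p).
Proof.
move=> Np; have [_ _ _ dth] := thetaP Np; have dt : differentiable theta p by case: dth.
have dp : differentiable (fun p => (p, theta p)) p by apply: differentiable_pair.
split=> //; rewrite deriveE // diff_pair //=.
by rewrite (_ : 'd id p v = v) ?deriveE // diff_val.
Qed.

(** The stable class consists of the functions [k (p, theta p)] with [k] smooth on [regular_set]:
    the chain rule and the closed formula for the derivative of [theta] give a function of the same
    form. *)
Lemma implicit_smooth f : smooth_on regular_set f -> smooth_on N (fun p => f (p, theta p)).
Proof.
move=> sf; pose S h := exists2 k, smooth_on regular_set k & forall p, N p -> h p = k (p, theta p).
have gr p : N p -> regular_set (p, theta p) by move=> /thetaP[].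
apply: (@smooth_on_coind _ _ N S) => //; last by exists f.
- by move=> f1 f2 [k sk kE] f12; exists k => // p Np; rewrite -f12 // kE.
- move=> h p [k sk kE] Np; apply: (@near_eq_diff _ _ (fun p => k (p, theta p))).
    by apply: filterS (open_near oN Np) => y Ny; rewrite kE.
  have [dg _] := derive_graph 0 Np.
  by have [] := derive_comp 0 dg (smooth_on_diff sk (gr p Np)).
- move=> h v [k sk kE].
  exists (fun z => 'D_(v, (0 : 'rV[R]_m)) k z + \sum_l (- 1 * \sum_j 'D_(v, (0 : 'rV[R]_m)) (F j) z
      * invmx (H z) l j) * 'D_((0 : P), ebasis R l) k z).
    have oR := regular_set_open.
    apply: smooth_add => //; first exact: smooth_onD1.
    apply: smooth_sum => // l; apply: smooth_mul => //; last exact: smooth_onD1.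
    apply: smooth_mul => //; first exact: smooth_cst.
    apply: smooth_sum => // j; apply: smooth_mul => //; last exact: smooth_inv_jac.
    by apply: smooth_onD1; apply: smooth_on_sub (sF j) => z [].
  move=> p Np; rewrite (derive_eq_on _ oN kE Np).
  have [dg Dg] := derive_graph v Np; have rp := gr p Np.
  have dk : differentiable k (p, theta p) by exact: smooth_on_diff rp.
  have [_ ->] := derive_comp v dg dk.
  have [_ _ _ dth] := thetaP Np.
  rewrite Dg (is_diff_derive v dth); set w := _ *m _.
  have -> : (v, w) = (v, 0) + (0, w) by congr pair; rewrite /= ?addr0 ?add0r.
  rewrite derive_dirD // derive_param //; congr (_ + _).
  apply: eq_bigr => l _; congr (_ * _).
  rewrite /w mxE mulr_sumr; apply: eq_bigr => j _.
  by rewrite !mxE mulN1r mulNr.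
Qed.

End ImplicitSmooth.

(** * The cut locus *)

Lemma row_is_diff (R : realType) (V : normedModType R) n (f : V -> 'rV[R]_n) x :
  (forall j, differentiable (fun h => f h 0 j) x) ->
  is_diff x f (fun v => \row_j 'D_v (fun h => f h 0 j) x).
Proof.
move=> fd.
have -> : (fun v => \row_j 'D_v (fun h => f h 0 j) x) =
    fun v => \row_j 'd (fun h => f h 0 j) x v.
  by apply/funext => v; apply/rowP => j; rewrite !mxE deriveE.
have [K K0 KP] := diff_bounded fd.
apply: (@is_diff_bound _ _ _ _ _ _ K).
- by move=> a v w; apply/rowP => j; rewrite !mxE linearP.
- move=> w; apply: mx_norm_le => [|i j]; first by rewrite mulr_ge0.
  by rewrite mxE.
- move=> e e0; have nj (j : 'I_n) := diff_bound (fd j) e0.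
  have := @filter_forall _ _ _ _ (nbhs_filter (0 : V)) nj.
  apply: filterS => w wP; apply: mx_norm_le => [|i j]; first by rewrite mulr_ge0 // ltW.
  by rewrite ord1; have := wP j; rewrite !mxE.
Qed.

Section Phase.
Variables (R : realType) (q m : nat) (U : 'I_m -> 'M[R]_q).
Hypothesis sU : forall j, skew_sym (U j).
Local Notation G := ('rV[R]_q * 'rV[R]_m)%type.
Local Notation Om := (Omega_star U).
Local Notation dist2 := (fun h : G => ccdist U h ^+ 2).

Definition phase (z : G * 'rV[R]_m) : R := phi U z.1 z.2.
Definition phase_dom : set (G * 'rV[R]_m) := [set z | Om z.2].
Definition phase_grad (j : 'I_m) := 'D_((0 : G), ebasis R j) phase.

Lemma norm_fst_le (V W : normedModType R) (z : V * W) : `|z.1| <= `|z|.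
Proof. by rewrite prod_normE le_max lexx. Qed.

Lemma norm_snd_le (V W : normedModType R) (z : V * W) : `|z.2| <= `|z|.
Proof. by rewrite prod_normE le_max lexx orbT. Qed.

Lemma phase_dom_open : open phase_dom.
Proof.
rewrite openE => z Oz.
have /nbhs_ballP[e /= e0 eP] := open_near (@Omega_open _ _ _ U) Oz.
have n : nbhs z phase_dom.
  apply/nbhs_ballP; exists e => //= y; rewrite -ball_normE /= => zy; apply: eP.
  by rewrite -ball_normE /=; apply: le_lt_trans zy; exact: (norm_snd_le (z - y)).
exact: n.
Qed.

Lemma smooth_phase : smooth_on phase_dom phase.
Proof.
have oD := phase_dom_open.
have sx i : smooth_on phase_dom (fun z => z.1.1 0 i).
  apply: (@smooth_linear _ _ _ _ 1) => [a y z|z]; first by rewrite /= !mxE.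
  rewrite mul1r (le_trans (coord_le_norm _ _ _)) // (le_trans (norm_fst_le _)) //.
  exact: norm_fst_le.
have st j : smooth_on phase_dom (fun z => z.1.2 0 j).
  apply: (@smooth_linear _ _ _ _ 1) => [a y z|z]; first by rewrite /= !mxE.
  rewrite mul1r (le_trans (coord_le_norm _ _ _)) // (le_trans (norm_snd_le _)) //.
  exact: norm_fst_le.
have stau j : smooth_on phase_dom (fun z => z.2 0 j).
  apply: (@smooth_linear _ _ _ _ 1) => [a y z|z]; first by rewrite /= !mxE.
  by rewrite mul1r (le_trans (coord_le_norm _ _ _)) // norm_snd_le.
have sC i j : smooth_on phase_dom (fun z => UcotU U z.2 i j).
  apply: (@smooth_comp_linear _ _ _ (@snd G 'rV[R]_m) 1 phase_dom Om (fun t => UcotU U t i j)) => //.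
    by move=> h; rewrite mul1r; exact: norm_snd_le.
  exact: UcotU_smooth.
apply: (@smooth_on_eq _ _ _ (fun z : G * 'rV[R]_m => \sum_i \sum_j (z.1.1 0 i * z.1.1 0 j) * UcotU U z.2 i j
  + 4 * \sum_j z.1.2 0 j * z.2 0 j)) => //.
  by move=> z _; rewrite /phase /phi quadE.
apply: smooth_add => //.
  apply: smooth_sum => // i; apply: smooth_sum => // j; apply: smooth_mul => //.
  exact: smooth_mul.
apply: smooth_mul => //; first exact: smooth_cst.
by apply: smooth_sum => // j; exact: smooth_mul.
Qed.

Lemma smooth_phase_grad j : smooth_on phase_dom (phase_grad j).
Proof. by apply: smooth_onD1; exact: smooth_phase. Qed.

Lemma phase_gradE j g tau : phase_grad j (g, tau) = 'D_(ebasis R j) (phi U g) tau.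
Proof. by rewrite /phase_grad derive_snd. Qed.

(** Puts membership in M into the form that [implicit_function] expects; the Hessian of
    [nondeg_crit] is the transpose of [param_jac phase_grad]. *)
Lemma Mset_phase g : Mset U g <-> exists2 tau, Om tau &
  (forall j, phase_grad j (g, tau) = 0) /\ \det (param_jac phase_grad (g, tau)) != 0.
Proof.
have HE tau : \matrix_(j < m, k < m) 'D_(ebasis R j) ('D_(ebasis R k) (phi U g)) tau =
    (param_jac phase_grad (g, tau))^T.
  apply/matrixP => j k; rewrite [LHS]mxE [RHS]mxE [RHS]mxE derive_snd.
  have -> : (fun t => phase_grad k (g, t)) = 'D_(ebasis R k) (phi U g); last by [].
  by apply/funext => t; rewrite phase_gradE.
split=> -[tau ot].
  move=> [_ crit]; rewrite HE det_tr => dH; exists tau => //; split=> // j.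
  by rewrite phase_gradE.
move=> [crit dH]; exists tau; first exact: ot.
split; [exact: phi_diff|by move=> j; rewrite -phase_gradE|by rewrite HE det_tr].
Qed.

Lemma phase_Dt j g tau :
  'D_(((0 : 'rV[R]_q), ebasis R j), (0 : 'rV[R]_m)) phase (g, tau) = 4 * tau 0 j.
Proof.
case: g => x t; apply: derive_lineE.
have -> : (fun s : R => phase (s *: (((0 : 'rV[R]_q), ebasis R j), (0 : 'rV[R]_m)) + ((x, t), tau)))
    = fun s => phi U (x, t) tau + s * (4 * tau 0 j).
  apply/funext => s; rewrite /phase /phi /= !scaler0 !add0r dotvDl dotvZl.
  by rewrite (dotvC (ebasis R j)) dotv_ebasis; ring.
by apply: is_derive_eq; rewrite /GRing.scale /=; ring.
Qed.

Lemma phase_Dx i g tau : Om tau ->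
  'D_((ebasis R i, (0 : 'rV[R]_m)), (0 : 'rV[R]_m)) phase (g, tau) =
  2 * mxapp (UcotU U tau) g.1 0 i.
Proof.
case: g => x t ot; apply: derive_lineE => /=.
have -> : (fun s : R => phase (s *: ((ebasis R i, (0 : 'rV[R]_m)), (0 : 'rV[R]_m)) + ((x, t), tau)))
    = fun s => phi U (x, t) tau + s * (2 * mxapp (UcotU U tau) x 0 i) +
      s * s * dotv (mxapp (UcotU U tau) (ebasis R i)) (ebasis R i).
  apply/funext => s; rewrite /phase /phi /= !scaler0 !add0r.
  rewrite !(mxappD, mxappZ) !dotvDl !dotvDr !dotvZl !dotvZr.
  rewrite (dotv_mxapp _ (ebasis R i) x) UcotU_sym // (dotvC (ebasis R i) (mxapp _ _)).
  by rewrite (dotv_ebasis (mxapp _ x)); ring.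
by apply: is_derive_eq; rewrite /GRing.scale /=; ring.
Qed.

Lemma phase_grad_Dt j k g tau : Om tau ->
  'D_(((0 : 'rV[R]_q), ebasis R k), (0 : 'rV[R]_m)) (phase_grad j) (g, tau) = 4 * (j == k)%:R.
Proof.
case: g => x t ot; apply: derive_lineE.
have -> : (fun s : R => phase_grad j
    (s *: (((0 : 'rV[R]_q), ebasis R k), (0 : 'rV[R]_m)) + ((x, t), tau)))
    = fun s => phase_grad j ((x, t), tau) + s * (4 * (j == k)%:R).
  apply/funext => s; rewrite -[_ + _ in LHS]/((s *: 0 + x, s *: ebasis R k + t), s *: 0 + tau).
  rewrite !scaler0 !add0r !phase_gradE (derive_phi_vertical x t _ j ot) addrK.
  have -> : (s *: ebasis R k) 0 j = s * (j == k)%:R by rewrite !mxE eqxx.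
  by ring.
by apply: is_derive_eq; rewrite /GRing.scale /=; ring.
Qed.

(** Envelope argument: near [g] the squared distance is the phase on the graph of the implicit
    function. The derivative of the phase in [tau] vanishes there, so that of [theta] contributes
    nothing to the gradient of the squared distance. *)
Lemma Mset_local g : Mset U g -> exists tau (A : set G),
  [/\ open A, A g, smooth_on A dist2,
      Om tau /\ (forall j, phase_grad j (g, tau) = 0) &
      forall v, 'D_v dist2 g = 'D_(v, (0 : 'rV[R]_m)) phase (g, tau)].
Proof.
move=> /Mset_phase[tau ot [crit dH]].
have oD := phase_dom_open.
have [theta [N [oN /= Ng thg thP]]] := @implicit_function _ _ _ _ _ oD smooth_phase_grad
  (g, tau) ot crit dH.
have dE h : N h -> phase (h, theta h) = ccdist U h ^+ 2.
  move=> /thP[oh _ Fh _].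
  have [|-> <-] := ccdist_crit sU (g := h) oh; last by [].
  by move=> j; rewrite -phase_gradE.
exists tau, N; split=> //.
  apply: (@smooth_on_eq _ _ _ (fun h => phase (h, theta h))) => //.
  apply: (implicit_smooth oD smooth_phase_grad oN thP).
  by apply: smooth_on_sub smooth_phase => z [].
move=> v; rewrite -(derive_eq_on _ oN dE Ng).
have [dg Dg] := derive_graph thP v Ng.
have dp : differentiable phase (g, theta g).
  by apply: smooth_on_diff smooth_phase _; rewrite /phase_dom /= thg.
have [_ ->] := derive_comp v dg dp.
rewrite Dg thg; rewrite thg in dp; set w := 'D_v theta g.
have -> : (v, w) = (v, 0) + (0, w) by congr pair; rewrite /= ?addr0 ?add0r.
rewrite derive_dirD // derive_param // big1 ?addr0 // => l _.
by rewrite (crit l : 'D_((0 : G), ebasis R l) phase (g, tau) = 0) mulr0.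
Qed.

(** * Points near which the squared distance is smooth *)

Section CutPoint.
Variables (A : set G) (u : G -> R) (th : G -> 'rV[R]_m) (p : G -> 'rV[R]_q).
Local Notation Tv j := ((0, ebasis R j) : G).
Local Notation Xh i := ((ebasis R i, 0) : G).
Hypotheses (Mdense : closure (Mset U) = setT) (oA : open A).
Hypotheses (uE : u = dist2) (su : smooth_on A u).
Hypothesis thE : forall h j, th h 0 j = 4^-1 * 'D_(Tv j) u h.
Hypothesis pE : forall h i, p h 0 i =
  2^-1 * 'D_(Xh i) u h + \sum_k (\sum_l th h 0 l * U l i k) * h.1 0 k.

Lemma dual_smooth j : smooth_on A (fun h => th h 0 j).
Proof.
apply: (@smooth_on_eq _ _ _ (fun h => 4^-1 * 'D_(Tv j) u h)) => //.
by apply: smooth_mul => //; [exact: smooth_cst|exact: smooth_onD1].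
Qed.

Lemma momentum_smooth i : smooth_on A (fun h => p h 0 i).
Proof.
have sx k : smooth_on A (fun h : G => h.1 0 k).
  apply: (@smooth_linear _ _ _ _ 1) => [a y z|z]; first by rewrite /= !mxE.
  by rewrite mul1r (le_trans (coord_le_norm _ _ _)) // norm_fst_le.
apply: (@smooth_on_eq _ _ _ (fun h : G => 2^-1 * 'D_(Xh i) u h
  + \sum_k (\sum_l th h 0 l * U l i k) * h.1 0 k)) => //.
apply: smooth_add => //.
  by apply: smooth_mul => //; [exact: smooth_cst|exact: smooth_onD1].
apply: smooth_sum => // k; apply: smooth_mul => //; apply: smooth_sum => // l.
by apply: smooth_mul => //; [exact: dual_smooth|exact: smooth_cst].
Qed.

(** At the critical point [tau] the phase has vertical gradient [4 tau] and horizontal gradient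
    [2 C x], and by [Mset_local] so has the squared distance. Hence [th] is the critical point,
    [p = (C + A) x], and the eikonal equation is [ccdist_crit]. *)
Lemma dual_on_Mset h : Mset U h ->
  [/\ Om (th h), (forall j, phase_grad j (h, th h) = 0) & u h = dotv (p h) (p h)].
Proof.
move=> Mh; have [tau [B [_ _ _ [ot crit]]]] := Mset_local Mh; rewrite -uE => D.
have tE : th h = tau.
  by apply/rowP => j; rewrite thE D phase_Dt mulKf // pnatr_eq0.
split; rewrite ?tE //.
have [|cE _] := ccdist_crit sU (g := h) ot; first by move=> j; rewrite -phase_gradE.
rewrite uE cE enormE; suff -> : p h = mxapp (UcotU U tau + Amat U tau) h.1 by [].
apply/rowP => i; rewrite pE D phase_Dx // mulKf ?pnatr_eq0 // mxappDm [RHS]mxE; congr (_ + _).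
rewrite mxappE; apply: eq_bigr => k _; rewrite /Amat summxE; congr (_ * _).
by apply: eq_bigr => l _; rewrite [in RHS]mxE tE.
Qed.

Lemma Mset_meets (B : set G) (h : G) : nbhs h B -> exists2 h', Mset U h' & B h'.
Proof.
move=> hB; have : closure (Mset U) h by rewrite Mdense.
by move=> /(_ B hB)[h' [Mh' Bh']]; exists h'.
Qed.

Lemma dense_eq0 (f : G -> R) (B : set G) : open B -> (forall h, B h -> differentiable f h) ->
  (forall h, B h -> Mset U h -> f h = 0) -> forall h, B h -> f h = 0.
Proof.
move=> oB fd fM h Bh; apply: contrapT => /eqP f0.
have cf : f y @[y --> h] --> f h by exact: (differentiable_continuous (fd h Bh)).
have n : \forall y \near h, f y != 0 by exact: cvgr_neq0 cf f0.
have [h' Mh' [Bh' /eqP]] := Mset_meets (filterI (open_near oB Bh) n).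
by apply; exact: fM.
Qed.

Lemma dual_is_diff h : A h -> is_diff h th (fun v => \row_j 'D_v (fun h => th h 0 j) h).
Proof. by move=> Ah; apply: row_is_diff => j; exact: smooth_on_diff (@dual_smooth j) Ah. Qed.

Lemma dual_cvg h : A h -> th y @[y --> h] --> th h.
Proof.
by move=> Ah; have [dt _] := dual_is_diff Ah; exact: (differentiable_continuous dt).
Qed.

(** A norm above pi would persist near [h] by continuity of [th], in particular at some point of M,
    where the norm is below pi. *)
Lemma dual_opnorm_le h : A h -> opnorm (Amat U (th h)) <= pi.
Proof.
move=> Ah; rewrite leNgt; apply/negP => hpi.
have [c c0 cP] := mxl1_Amat_le U.
have d0 : 0 < (opnorm (Amat U (th h)) - pi) / c by rewrite divr_gt0 // subr_gt0.
have := dual_cvg Ah; move=> /cvgrPdist_lt /(_ _ d0) n.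
have [y My [Ay yd]] := Mset_meets (filterI (open_near oA Ah) n).
have [oy _ _] := dual_on_Mset My.
have : opnorm (Amat U (th h)) < opnorm (Amat U (th h)).
  rewrite -{1}(subrK (th y) (th h)) AmatD; apply: le_lt_trans (opnormD _ _) _.
  have h1 : opnorm (Amat U (th h - th y)) < opnorm (Amat U (th h)) - pi.
    apply: le_lt_trans (opnorm_le_l1 _) _; apply: le_lt_trans (cP _) _.
    by rewrite mulrC -ltr_pdivlMr.
  have h2 : opnorm (Amat U (th y)) < pi by exact: oy.
  by rewrite -[ltRHS](subrK pi) ltrD.
by rewrite ltxx.
Qed.

Lemma eikonal h : A h -> u h = dotv (p h) (p h).
Proof.
move=> Ah; apply/eqP; rewrite -subr_eq0; apply/eqP.
pose f h := u h + -1 * \sum_i p h 0 i * p h 0 i.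
have sf : smooth_on A f.
  apply: smooth_add => //; apply: smooth_mul => //; first exact: smooth_cst.
  by apply: smooth_sum => // i; apply: smooth_mul => //; exact: momentum_smooth.
have fE y : f y = u y - dotv (p y) (p y) by rewrite /f mulN1r.
rewrite -fE; apply: (@dense_eq0 f A) => // y Ay; first exact: smooth_on_diff sf Ay.
by move=> My; rewrite fE; have [_ _ ->] := dual_on_Mset My; rewrite subrr.
Qed.

Lemma interior_dual g0 : A g0 -> Om (th g0) -> Mset U g0.
Proof.
move=> Ag0 o0; apply/Mset_phase; exists (th g0) => //.
(* Open set on which the phase is defined along [th]; there the critical equation extends from M by
   continuity. *)
pose B := [set h | A h /\ Om (th h)].
have oB : open B.
  rewrite openE => h [Ah oh].
  have n : nbhs h B.
    apply: filterI (open_near oA Ah) _.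
    by apply: dual_cvg => //; apply: open_near oh; exact: Omega_open.
  exact: n.
have dgr h : B h -> differentiable (fun h => (h, th h)) h /\
    forall v, 'D_v (fun h => (h, th h)) h = (v, 'D_v th h).
  move=> [Ah _]; have [dt _] := dual_is_diff Ah.
  have dp : differentiable (fun h => (h, th h)) h by apply: differentiable_pair.
  split=> // v; rewrite deriveE // diff_pair //=.
  by rewrite (_ : 'd id h v = v) ?deriveE // diff_val.
have dgrad h j : B h -> differentiable (phase_grad j) (h, th h).
  move=> [_ oh]; have oz : phase_dom (h, th h) by exact: oh.
  exact: (smooth_on_diff (@smooth_phase_grad j) oz).
have z j h : B h -> phase_grad j (h, th h) = 0.
  apply: (@dense_eq0 (fun h => phase_grad j (h, th h)) B) => // y By.
    by have [] := derive_comp 0 (dgr y By).1 (dgrad y j By).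
  by move=> My; have [_ -> _] := dual_on_Mset My.
have Bg0 : B g0 by [].
split=> [j|]; first exact: z.
pose H := param_jac phase_grad (g0, th g0).
pose Q : 'M[R]_m := \matrix_(k, l) ('D_(Tv k) th g0) 0 l.
have QH : Q *m H^T = (-4)%:M.
  apply/matrixP => k j.
  have -> : (Q *m H^T) k j = ('D_(Tv k) th g0 *m H^T) 0 j.
    by rewrite [LHS]mxE [RHS]mxE; apply: eq_bigr => l _; rewrite [Q k l]mxE.
  rewrite -(@diff_param _ _ _ phase_dom phase_grad smooth_phase_grad j (g0, th g0)) //.
  have : 'D_(Tv k) (fun h => phase_grad j (h, th h)) g0 = 0.
    rewrite (derive_eq_on (Tv k) oB (z j) Bg0); exact: derive_cst.
  have [dg Dg] := dgr g0 Bg0.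
  have [_ ->] := derive_comp (Tv k) dg (dgrad g0 j Bg0).
  rewrite Dg; set w := 'D_(Tv k) th g0.
  have -> : (Tv k, w) = (Tv k, 0) + (0, w) by congr pair; rewrite /= ?addr0 ?add0r.
  have dF := dgrad g0 j Bg0.
  rewrite derive_dirD // phase_grad_Dt //.
  rewrite mxE [k == j]eq_sym => /eqP; rewrite addrC addr_eq0 => /eqP ->.
  by case: (j == k); rewrite ?mulr1 ?mulr0 ?mulr1n ?mulr0n ?oppr0.
have : \det Q * \det H != 0.
  have := congr1 (@determinant _ _) QH; rewrite det_mulmx det_tr det_scalar => ->.
  by rewrite expf_neq0 // oppr_eq0 pnatr_eq0.
by rewrite mulf_eq0 negb_or => /andP[].
Qed.

(* Differentiating the eikonal equation vertically, [th] is homogeneous of degree one along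
   the horizontal field in the direction of the momentum [p]. *)
Lemma dual_homogeneous h j : A h ->
  'D_(p h, 2^-1 *: Uform U h.1 (p h)) (fun h => th h 0 j) h = th h 0 j.
Proof.
move=> Ah; pose Q (a b : G) := 'D_a ('D_b u) h.
have Qs a b : Q a b = Q b a by exact: (smooth_schwarz oA su a b Ah).
have dDu a : differentiable ('D_a u) h by apply: smooth_on_diff Ah; exact: smooth_onD1.
have thF l : (fun h => th h 0 l) = 4^-1 *: 'D_(Tv l) u by apply/funext => y; rewrite thE.
have Dth a l : 'D_a (fun h => th h 0 l) h = 4^-1 * Q a (Tv l).
  by rewrite thF deriveZ //; exact: diff_derivable.
have dth l : is_derive h (Tv j) (fun h => th h 0 l) (4^-1 * Q (Tv j) (Tv l)).
  rewrite -Dth; apply: DeriveDef => //; apply: diff_derivable.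
  by apply: smooth_on_diff Ah; exact: dual_smooth.
have dX i : is_derive h (Tv j) ('D_(Xh i) u) (Q (Tv j) (Xh i)).
  by apply: DeriveDef; [exact: diff_derivable|exact: erefl].
have dx k : is_derive h (Tv j) (fun y : G => y.1 0 k) 0.
  have dl : is_diff h (fun y : G => y.1 0 k) (fun y : G => y.1 0 k).
    apply: (@linear_is_diff _ _ _ _ 1) => [a y z|z]; first by rewrite /= !mxE.
    by rewrite mul1r (le_trans (coord_le_norm _ _ _)) // norm_fst_le.
  apply: DeriveDef; first by apply: diff_derivable.
  by rewrite (is_diff_derive _ dl) /= mxE.
pose dp : 'rV[R]_q := \row_i (2^-1 * Q (Tv j) (Xh i)
  + \sum_k (\sum_l 4^-1 * Q (Tv j) (Tv l) * U l i k) * h.1 0 k).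
have pd i : is_derive h (Tv j) (fun y => p y 0 i) (dp 0 i).
  rewrite mxE; have -> : (fun y => p y 0 i) = (fun y : G => 2^-1 * 'D_(Xh i) u y
    + \sum_k (\sum_l th y 0 l * U l i k) * y.1 0 k) by apply/funext => y; rewrite pE.
  have ds : is_derive h (Tv j) (fun y : G => \sum_k (\sum_l th y 0 l * U l i k) * y.1 0 k)
      (\sum_k (\sum_l 4^-1 * Q (Tv j) (Tv l) * U l i k) * h.1 0 k).
    apply: is_derive_sumr => k; have dxk := dx k.
    have dl : is_derive h (Tv j) (fun y : G => \sum_l th y 0 l * U l i k)
        (\sum_l 4^-1 * Q (Tv j) (Tv l) * U l i k).
      apply: is_derive_sumr => l; have dthl := dth l.
      by apply: is_derive_eq; rewrite /GRing.scale /=; ring.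
    by apply: is_derive_eq; rewrite /GRing.scale /= mulr0 add0r mulrC.
  have dXi := dX i.
  by apply: is_derive_eq.
(* The vertical derivative of the eikonal equation, with the definition of [th] on the left. *)
have E : 4 * th h 0 j = 2 * dotv dp (p h).
  have [_ D2] := is_derive_dotv pd pd.
  rewrite thE mulVKf ?pnatr_eq0 // (derive_eq_on _ oA eikonal Ah) D2 (dotvC (p h)).
  by rewrite mulr_natl mulr2n.
set V := (p h, _).
(* Expanding along coordinate directions, the derivative of [th] along [V] becomes the right side of
   [E] by symmetry of second derivatives. The term [A(th) x] in [p] is what produces the vertical
   component of [V]. *)
have VE : V = \sum_i p h 0 i *: Xh i + \sum_l (2^-1 * dotv (mxapp (U l) h.1) (p h)) *: Tv l.
  rewrite [RHS]surjective_pairing; congr pair; rewrite [RHS]/=.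
    rewrite (raddf_sum fst) (raddf_sum fst) /= [X in _ + X]big1 ?addr0; last first.
      by move=> l _; exact: scaler0.
    exact: row_sum_delta.
  rewrite (raddf_sum snd) (raddf_sum snd) /= [X in X + _]big1 ?add0r; last first.
    by move=> l _; exact: scaler0.
  by rewrite [LHS]row_sum_delta; apply: eq_bigr => l _; rewrite !mxE.
rewrite Dth; apply: (@mulfI _ 4); first by rewrite pnatr_eq0.
rewrite E mulVKf ?pnatr_eq0 // /Q VE deriveE // linearD !linear_sum /=.
rewrite /dotv mulr_sumr.
have -> : \sum_i 2 * (dp 0 i * p h 0 i) = \sum_i p h 0 i * Q (Xh i) (Tv j)
    + \sum_i \sum_l 2^-1 * (Q (Tv l) (Tv j) * (mxapp (U l) h.1 0 i * p h 0 i)).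
  rewrite -big_split /=; apply: eq_bigr => i _; rewrite mxE (Qs (Tv j) (Xh i)).
  have -> : \sum_k (\sum_l 4^-1 * Q (Tv j) (Tv l) * U l i k) * h.1 0 k =
      \sum_l 4^-1 * (Q (Tv l) (Tv j) * mxapp (U l) h.1 0 i).
    under eq_bigr do rewrite mulr_suml.
    rewrite exchange_big /=; apply: eq_bigr => l _; rewrite mxappE !mulr_sumr.
    by apply: eq_bigr => k _; rewrite (Qs (Tv j)); ring.
  rewrite [(_ + _) * p h 0 i]mulrDl mulrDr mulr_suml mulr_sumr; congr (_ + _); first by field.
  by apply: eq_bigr => l _; field.
rewrite exchange_big /=; congr (_ + _); apply: eq_bigr => i _.
  by rewrite linearZ /= -deriveE.
rewrite linearZ /= -deriveE // -[_ *: _]/(_ * _) -/(Q (Tv i) (Tv j)) -!mulr_sumr.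
by rewrite [_ * Q _ _]mulrC mulrCA.
Qed.

(** By homogeneity [th (h + s V) = (1 + s) th h + o(s)]. A norm of at least pi at [h] would give at
    least [(1 + s) pi - s pi / 2] at the nearby point, which contradicts [dual_opnorm_le] there. *)
Lemma dual_interior h : A h -> Om (th h).
Proof.
move=> Ah; rewrite /Omega_star /= ltNge; apply/negP => hpi.
have pi0 := pi_gt0 R; have [c c0 cP] := mxl1_Amat_le U.
pose V : G := (p h, 2^-1 *: Uform U h.1 (p h)).
have [dt dE] := dual_is_diff Ah.
have DV s : 'd th h (s *: V) = s *: th h.
  rewrite linearZ /= dE; congr (_ *: _); apply/rowP => j.
  by rewrite mxE dual_homogeneous.
(* With this [e] the error has operator norm at most [s pi / 2], half of the gain [s pi]. *)
pose e := pi / (2 * (c * (`|V| + 1))).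
have V1 : 0 < `|V| + 1 by rewrite ltr_wpDl.
have e0 : 0 < e by rewrite divr_gt0 // !mulr_gt0.
have n1 := diff_bound dt e0.
have n2 : \forall w \near (0 : G), A (w + h).
  have := open_near oA Ah; rewrite {1}(near_shift 0 h); apply: filterS => w /=.
  by rewrite subr0.
have n3 : \forall w \near (0 : G), `|th (w + h) - th h - 'd th h w| <= e * `|w| /\ A (w + h).
  exact: filterI n1 n2.
move: n3 => /nbhs_ballP[d /= d0 dP].
pose s := d / (2 * (`|V| + 1)).
have s0 : 0 < s by rewrite divr_gt0 // mulr_gt0.
have sVE : `|s *: V| = s * `|V| by rewrite normrZ gtr0_norm.
have sV : `|s *: V| < d.
  rewrite sVE; have -> : s * `|V| = d * (2^-1 * (`|V| / (`|V| + 1))).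
    by rewrite /s; field; rewrite gt_eqF.
  rewrite gtr_pMr //; apply: (@le_lt_trans _ _ 2^-1); last by lra.
  by rewrite ler_piMr // ler_pdivrMr // mul1r lerDl.
have [] := dP (s *: V); first by rewrite -ball_normE /= sub0r normrN.
rewrite DV sVE; set y := s *: V + h => B Ay.
have o1 : opnorm (Amat U (th y - th h - s *: th h)) <= pi / 2 * s.
  apply: le_trans (opnorm_le_l1 _) _; apply: le_trans (cP _) _.
  apply: le_trans (ler_wpM2l (ltW c0) B) _.
  have -> : c * (e * (s * `|V|)) = pi / 2 * s * (`|V| / (`|V| + 1)).
    by rewrite /e; field; rewrite !gt_eqF.
  have ps : 0 <= pi / 2 * s by apply: mulr_ge0; [apply: divr_ge0 => //|]; exact: ltW.
  by rewrite ler_piMr // ler_pdivrMr // mul1r lerDl.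
have o2 : opnorm (Amat U ((1 + s) *: th h)) = (1 + s) * opnorm (Amat U (th h)).
  by rewrite AmatZ opnormZ gtr0_norm // ltr_wpDl // ltW.
have o3 : opnorm (Amat U ((1 + s) *: th h)) <=
    opnorm (Amat U (th y)) + opnorm (Amat U (th y - th h - s *: th h)).
  have -> : (1 + s) *: th h = th y + (-1) *: (th y - th h - s *: th h).
    by apply/rowP => i; rewrite !mxE; ring.
  rewrite AmatD; apply: le_trans (opnormD _ _) _.
  by rewrite AmatZ opnormZ normrN1 mul1r.
have o4 := dual_opnorm_le Ay.
have o5 : (1 + s) * pi <= (1 + s) * opnorm (Amat U (th h)).
  by rewrite ler_wpM2l // addr_ge0 // ltW.
have sp : 0 < pi * s :> R by rewrite mulr_gt0.
move: o1 o2 o3 o4 o5 sp; move: (opnorm _) (opnorm _) (opnorm _) (opnorm _) => a b c' d'.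
lra.
Qed.

End CutPoint.

Lemma smooth_dist_Mset (A : set G) g : closure (Mset U) = setT -> open A -> A g ->
  smooth_on A dist2 -> Mset U g.
Proof.
move=> Md oA Ag sd.
pose th h : 'rV[R]_m := \row_j (4^-1 * 'D_((0, ebasis R j) : G) dist2 h).
pose p h : 'rV[R]_q := \row_i (2^-1 * 'D_((ebasis R i, 0) : G) dist2 h
  + \sum_k (\sum_l th h 0 l * U l i k) * h.1 0 k).
have thE h j : th h 0 j = 4^-1 * 'D_((0, ebasis R j) : G) dist2 h by rewrite mxE.
have pE h i : p h 0 i = 2^-1 * 'D_((ebasis R i, 0) : G) dist2 h
  + \sum_k (\sum_l th h 0 l * U l i k) * h.1 0 k by rewrite mxE.
have og := dual_interior Md oA erefl sd thE pE Ag.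
exact: (interior_dual Md oA erefl sd thE pE Ag og).
Qed.

End Phase.

Unset Implicit Arguments.

Theorem theorem2p12 (R : realType) (q m : nat) (U : 'I_m -> 'M[R]_q) :
  (0 < q)%N -> (0 < m)%N ->
  (forall j, skew_sym (U j)) -> lin_indep U ->
  closure (Mset U) = setT ->
  cut_locus U = ~` Mset U.
Proof.
move=> _ _ sU _ Md; apply/seteqP; split=> g /=.
  move=> ns Mg; apply: ns; have [_ [A [oA Ag sA _ _]]] := Mset_local sU Mg.
  by exists A.
by move=> nM [A [oA Ag sA]]; apply: nM; exact: (smooth_dist_Mset sU Md oA Ag sA).
Qed.
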